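(* Let $p$ be a prime number. A positive integer $d$ is admissible (with respect to $p$) if and only if $d\not\equiv -1\pmod p$.
   Context: A one-dimensional separable function field $F|K$ is a separable field extension of transcendence degree one (finitely generated), with $K$ algebraically closed in $F$; these are the function fields of regular geometrically integral projective curves over $K$. Throughout, $K$ has characteristic $p>0$. A prime $\mathfrak{p}$ of $F|K$ is (the maximal ideal of) a discrete valuation ring $\mathcal{O}_{\mathfrak p}$ of $F$ containing $K$ with fraction field $F$ (i.e. a closed point of the regular curve); $\kappa(\mathfrak p)$ is its residue field. A prime is purely inseparable if the extension $K\subset\kappa(\mathfrak p)$ is purely inseparable. A pair $(F|K,\mathfrak p)$ is a one-dimensional separable function field $F|K$ together with a purely inseparable prime $\mathfrak p$. The geometric singularity degree $\delta(\mathfrak p)$ is the $\overline K$-codimension of the semilocal domain $\mathcal{O}_{\mathfrak p}\otimes_K\overline K\subset F\otimes_K\overline K$ in its integral closure. A positive integer $d$ is called admissible if there exists a pair $(F|K,\mathfrak p)$, with $K$ of characteristic $p$, such that $\delta(\mathfrak p)=\frac{p-1}{2}\cdot d$. *)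

(* Defs.v *)
From HB Require Import structures.
From mathcomp Require Import all_boot all_order all_algebra all_field.

Set Implicit Arguments.
Unset Strict Implicit.
Unset Printing Implicit Defensive.

Import Order.TTheory GRing.Theory Num.Theory.
Local Open Scope ring_scope.

(* Field extensions F|K are of infinite degree here, so they are given by
   embeddings iota : {rmorphism K -> F} rather than by a fieldExtType. *)

(* The subfield K(s) of F.  The case a = 1, 0 of [adjoin_const] and the closure
   under differences and quotients give all the field operations; x / 0 = 0. *)
Inductive adjoin (K F : fieldType) (iota : {rmorphism K -> F}) (s : seq F) :
    F -> Prop :=
| adjoin_const a : adjoin iota s (iota a)
| adjoin_gen x : x \in s -> adjoin iota s x
| adjoin_sub x y : adjoin iota s x -> adjoin iota s y -> adjoin iota s (x - y)
| adjoin_div x y : adjoin iota s x -> adjoin iota s y -> adjoin iota s (x / y).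

Definition coefs_in (R : nzRingType) (A : R -> Prop) (q : {poly R}) : Prop :=
  forall i, A q`_i.

Definition algebraic_over_sub (F : fieldType) (E : F -> Prop) (x : F) : Prop :=
  exists q : {poly F}, [/\ q != 0, coefs_in E q & root q x].

(* [separable_poly q] is coprimality of q and q'; it excludes q = 0. *)
Definition separable_over_sub (F : fieldType) (E : F -> Prop) (x : F) : Prop :=
  exists q : {poly F}, [/\ separable_poly q, coefs_in E q & root q x].

Definition finitely_generated (K F : fieldType) (iota : {rmorphism K -> F}) :
    Prop :=
  exists s : seq F, forall x, adjoin iota s x.

Definition trdeg_one (K F : fieldType) (iota : {rmorphism K -> F}) : Prop :=
  exists t : F, ~ algebraicOver iota t /\
    forall x, algebraic_over_sub (adjoin iota [:: t]) x.

(* Separability of a finitely generated extension of transcendence degree one: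
   existence of a separating transcendence basis {t}. *)
Definition separable_ext (K F : fieldType) (iota : {rmorphism K -> F}) : Prop :=
  exists t : F, ~ algebraicOver iota t /\
    forall x, separable_over_sub (adjoin iota [:: t]) x.

Definition algebraically_closed_in (K F : fieldType)
    (iota : {rmorphism K -> F}) : Prop :=
  forall x, algebraicOver iota x -> exists a, x = iota a.

Definition separable_function_field (K F : fieldType)
    (iota : {rmorphism K -> F}) : Prop :=
  [/\ finitely_generated iota, trdeg_one iota, separable_ext iota
    & algebraically_closed_in iota].

(* The value of v at 0, conventionally infinite, is irrelevant. *)
Definition discrete_valuation (F : fieldType) (v : F -> int) : Prop :=
  [/\ forall x y, x != 0 -> y != 0 -> v (x * y) = v x + v y,
      forall x y, x != 0 -> y != 0 -> x + y != 0 ->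
        Num.min (v x) (v y) <= v (x + y)
    & forall n : int, exists2 x, x != 0 & v x = n].

(* A discrete valuation ring with fraction field F. *)
Definition DVR_of (F : fieldType) (O : {pred F}) : Prop :=
  exists2 v : F -> int, discrete_valuation v &
    forall x, (x \in O) = (x == 0) || (0 <= v x).

Definition function_field_prime (K F : fieldType) (iota : {rmorphism K -> F})
    (O : {pred F}) : Prop :=
  DVR_of O /\ forall a, iota a \in O.

(* The non-units of O; the case x = 0 is separate because 0^-1 = 0. *)
Definition max_ideal (F : fieldType) (O : {pred F}) (x : F) : bool :=
  (x \in O) && ((x == 0) || (x^-1 \notin O)).

(* Every element of the residue field O / max_ideal O has a p^n-th power in
   the image of K. *)
Definition purely_inseparable_prime (p : nat) (K F : fieldType)
    (iota : {rmorphism K -> F}) (O : {pred F}) : Prop :=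
  forall x, x \in O ->
    exists (n : nat) (a : K), max_ideal O (x ^+ (p ^ n) - iota a).

Definition algebraic_closure (K : fieldType) (L : closedFieldType)
    (j : {rmorphism K -> L}) : Prop :=
  forall y, algebraicOver j y.

(* T, with the maps f and g, is the tensor product of the commutative
   R-algebras A and B, i.e. their coproduct. *)
Definition is_tensor_product (R A B T : comNzRingType)
    (i : {rmorphism R -> A}) (j : {rmorphism R -> B})
    (f : {rmorphism A -> T}) (g : {rmorphism B -> T}) : Prop :=
  (forall r, f (i r) = g (j r)) /\
  forall (S : comNzRingType) (u : {rmorphism A -> S}) (w : {rmorphism B -> S}),
    (forall r, u (i r) = w (j r)) ->
    exists h : {rmorphism T -> S},
      [/\ forall a, h (f a) = u a, forall b, h (g b) = w b
        & forall h' : {rmorphism T -> S},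
            (forall a, h' (f a) = u a) -> (forall b, h' (g b) = w b) ->
            forall t, h' t = h t].

(* The image of O (x) B in A (x) B; as a ring it is O (x) B itself, since B is
   flat over the base field in the use below. *)
Definition tensor_sub (A B T : comNzRingType) (f : {rmorphism A -> T})
    (g : {rmorphism B -> T}) (O : {pred A}) (t : T) : Prop :=
  exists (n : nat) (a : 'I_n -> A) (b : 'I_n -> B),
    (forall i, a i \in O) /\ t = \sum_(i < n) f (a i) * g (b i).

Definition integral_closure (T : comNzRingType) (A : T -> Prop) (z : T) : Prop :=
  exists q : {poly T}, [/\ q \is monic, coefs_in A q & root q z].

(* The quotient B / A of an L-subspace B of T by a subspace A of B, with L
   acting through g, has a basis of n elements (the classes of the b i). *)
Definition has_codim (L : fieldType) (T : comNzRingType)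
    (g : {rmorphism L -> T}) (A B : T -> Prop) (n : nat) : Prop :=
  exists b : 'I_n -> T, (forall i, B (b i)) /\
    forall z, B z ->
      exists! c : 'rV[L]_n, A (z - \sum_(i < n) g (c 0 i) * b i).

(* The geometric singularity degree of O is n.  Since F|K is separable and K is
   algebraically closed in F, the ring T below is a field, namely the fraction
   field of the image of O (x) L, so the integral closure is taken in T. *)
Definition geometric_singularity_degree (K F : fieldType)
    (iota : {rmorphism K -> F}) (O : {pred F}) (n : nat) : Prop :=
  exists (L : closedFieldType) (j : {rmorphism K -> L}) (T : comNzRingType)
         (f : {rmorphism F -> T}) (g : {rmorphism L -> T}),
    [/\ algebraic_closure j, is_tensor_product iota j f g
      & has_codim g (tensor_sub f g O) (integral_closure (tensor_sub f g O)) n].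

(* The equality delta = (p - 1) / 2 * d of rationals is cleared of its
   denominator, so that p = 2 is covered. *)
Definition admissible (p d : nat) : Prop :=
  exists (K F : fieldType) (iota : {rmorphism K -> F}) (O : {pred F})
         (delta : nat),
    [/\ p \in [pchar K], separable_function_field iota,
        function_field_prime iota O /\ purely_inseparable_prime p iota O,
        geometric_singularity_degree iota O delta
      & (2 * delta = (p - 1) * d)%N].

(* Main.v *)
From HB Require Import structures.
Require Import Defs.
From mathcomp Require Import all_boot all_order all_algebra all_field.
From mathcomp Require Import boolp ring lra zify.

Set Implicit Arguments.
Unset Strict Implicit.
Unset Printing Implicit Defensive.

Import Order.TTheory GRing.Theory Num.Theory.
Local Open Scope ring_scope.

(** Write delta for the geometric singularity degree of a purely inseparable
    prime O of F|K, L for the algebraic closure of K and T for F (x) L, which is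
    the function field of the curve over L.

    Necessity.  Since O is purely inseparable there is exactly one place W of T
    over it; its valuation ring B is the integral closure of the image Ob of
    O (x) L, and its residue field is L.  Let F1 = K F^p and O1 the intersection
    of O and F1.  As F|K is separable, F has degree p over F1, and O is O1[z] for
    some z: if the value group of F1 is smaller than that of F, a uniformizer z
    does; else the residue field of F1 is smaller, for otherwise every element of
    Ob would be congruent to a p-th power of T modulo any power of a uniformizer,
    which delta < oo excludes; any z with a new residue then does
    ([simple_generator]).  A uniformizer s of W generates T over T^p, so z is a
    combination of 1, s, ..., s^(p-1) over T^p; without its constant term, an
    element of B^p, it becomes an element y whose value m is prime to p.  If
    delta1 is the codimension of O1 (x) L in B^p, then that of
    Ob = (O1 (x) L)[z] in B^p[z] = B^p[y] is p delta1, and the codimension of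
    B^p[y] in B is the sum of the floor (m i / p) for i < p, because the y^i have
    values distinct modulo p; this sum is (p - 1)(m - 1) / 2.  Hence
      2 delta = 2 p delta1 + (p - 1)(m - 1)
    ([singularity_degree_formula]).  If 2 delta = (p - 1) d, then m = d + 1 modulo
    p, so p does not divide d + 1.

    The ring T is not known beforehand to be a field, nor W to exist.  Every
    element of T has a p^n-th power of the form pi^k (c + pi r) with pi a
    uniformizer of O, c a nonzero constant of L and r in Ob, unless it is
    nilpotent ([frob_power_normal_form]); k / p^n is then the value of the
    element.  This shows that, modulo the intersection of the pi^k Ob, T is a
    field ([geometric_quotient_field]) whose values lie in Q
    ([rational_value]); as T is finite over a rational function field over L,
    the values form a cyclic group ([geometric_value_group_cyclic]).

    Sufficiency.  Let m = d + 1 be prime to p, let a be an element of K which is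
    not a p-th power, alpha its p-th root in L, and T = L(s).  The field
    F = K(t, z) with t = s^p and z = s^m + alpha, in other words the function
    field of z^p = t^m + a, is a regular extension of K with F (x) L = T, and the
    place s = 0 of T lies over a prime of F with residue field K(alpha).  Here O1
    is the local ring of K(t) at t = 0, so delta1 = 0, z - alpha = s^m has value
    m, and 2 delta = (p - 1)(m - 1) = (p - 1) d
    ([construction_singularity_degree]). *)

(** * Subrings, subfields and purely inseparable extensions *)

Definition subring_pred (R : nzRingType) (A : R -> Prop) : Prop :=
  [/\ A 1, forall x y, A x -> A y -> A (x - y)
    & forall x y, A x -> A y -> A (x * y)].

Section SubringPred.

Variables (R : nzRingType) (A : R -> Prop).
Hypothesis sA : subring_pred A.

Lemma subring1 : A 1. Proof. by case: sA. Qed.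
Lemma subringB x y : A x -> A y -> A (x - y). Proof. by case: sA => _ + _; apply. Qed.
Lemma subringM x y : A x -> A y -> A (x * y). Proof. by case: sA => _ _; apply. Qed.
Lemma subring0 : A 0. Proof. by rewrite -(subrr 1); apply: subringB subring1 subring1. Qed.
Lemma subringN x : A x -> A (- x).
Proof. by move=> Ax; rewrite -sub0r; apply: subringB subring0 Ax. Qed.
Lemma subringD x y : A x -> A y -> A (x + y).
Proof. by move=> Ax /subringN Ay; rewrite -[y]opprK; apply: subringB. Qed.
Lemma subringX n x : A x -> A (x ^+ n).
Proof.
move=> Ax; elim: n => [|n IHn]; first by rewrite expr0; apply: subring1.
by rewrite exprS; apply: subringM.
Qed.
Lemma subring_nat n : A n%:R.
Proof.
elim: n => [|n IHn]; first exact: subring0.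
by rewrite -natr1; apply: subringD subring1.
Qed.
Lemma subring_sum (I : Type) (r : seq I) (P : pred I) (E : I -> R) :
  (forall i, P i -> A (E i)) -> A (\sum_(i <- r | P i) E i).
Proof. by move=> AE; apply: big_ind => //; [apply: subring0 | apply: subringD]. Qed.
Lemma subring_prod (I : Type) (r : seq I) (P : pred I) (E : I -> R) :
  (forall i, P i -> A (E i)) -> A (\prod_(i <- r | P i) E i).
Proof. by move=> AE; apply: big_ind => //; [apply: subring1 | apply: subringM]. Qed.

Lemma subring_horner (P : {poly R}) x : coefs_in A P -> A x -> A P.[x].
Proof.
move=> AP Ax; rewrite horner_coef; apply: subring_sum => i _.
by apply: subringM; [apply: AP | apply: subringX].
Qed.

Lemma coefs_in_subring : subring_pred (coefs_in A).
Proof.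
split=> [i|P Q AP AQ i|P Q AP AQ i].
- by rewrite coef1; case: eqP => _; [apply: subring1 | apply: subring0].
- by rewrite coefB; apply: subringB.
by rewrite coefM; apply: subring_sum => k _; apply: subringM.
Qed.

Lemma coefs_inC c : A c -> coefs_in A c%:P.
Proof. by move=> Ac i; rewrite coefC; case: ifP => // _; apply: subring0. Qed.

Lemma coefs_inX : coefs_in A 'X.
Proof.
by move=> i; rewrite coefX; case: eqP => _; [apply: subring1 | apply: subring0].
Qed.

End SubringPred.

Definition subfield_pred (F : fieldType) (E : F -> Prop) : Prop :=
  subring_pred E /\ forall x, E x -> E x^-1.

Lemma subfield_subring (F : fieldType) (E : F -> Prop) :
  subfield_pred E -> subring_pred E.
Proof. by case. Qed.

Lemma subfield_div (F : fieldType) (E : F -> Prop) x y :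
  subfield_pred E -> E x -> E y -> E (x / y).
Proof. by case=> sE iE Ex Ey; apply: subringM => //; apply: iE. Qed.

(** A subfield given as a predicate is packed as a field type, so that gcds of
    polynomials over it make sense. *)
Section SubfieldType.

Variables (F : fieldType) (E : F -> Prop) (sE : subfield_pred E).

Definition in_subfield (_ : subfield_pred E) : {pred F} := fun x => `[< E x >].

Fact in_subfield_closed : divring_closed (in_subfield sE).
Proof.
split=> [|x y /asboolP Ex /asboolP Ey|x y /asboolP Ex /asboolP Ey]; apply/asboolP.
- by case: sE => sA _; apply: subring1.
- by case: sE => sA _; apply: subringB.
exact: subfield_div.
Qed.

HB.instance Definition _ :=
  GRing.isDivringClosed.Build F (in_subfield sE) in_subfield_closed.

Record subfield_type :=
  SubfieldElt { subfield_val :> F; _ : subfield_val \in in_subfield sE }.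
HB.instance Definition _ := [isSub for subfield_val].
HB.instance Definition _ := [Choice of subfield_type by <:].
HB.instance Definition _ := [SubChoice_isSubIntegralDomain of subfield_type by <:].
HB.instance Definition _ := [SubIntegralDomain_isSubField of subfield_type by <:].

Lemma subfield_valP (x : subfield_type) : E (val x).
Proof. exact/asboolP/(valP x). Qed.

Lemma subfield_lift x : E x -> {y : subfield_type | val y = x}.
Proof. by move=> /asboolP Ex; exists (SubfieldElt Ex). Qed.

Lemma subfield_lift_poly P : coefs_in E P ->
  {Q : {poly subfield_type} | map_poly val Q = P}.
Proof.
move=> EP; exists (\poly_(i < size P) sval (subfield_lift (EP i))).
apply/polyP => i; rewrite coef_map coef_poly; case: ltnP => [_|leP].
  by case: subfield_lift.
by rewrite raddf0 nth_default.
Qed.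

Lemma subfield_map_poly (P : {poly subfield_type}) :
  coefs_in E (map_poly val P).
Proof. by move=> i; rewrite coef_map; apply: subfield_valP. Qed.

End SubfieldType.

Section Frobenius.

Variables (R : comNzRingType) (p : nat).
Hypothesis pR : p \in [pchar R].

Lemma exprp_add n (x y : R) : (x + y) ^+ (p ^ n) = x ^+ (p ^ n) + y ^+ (p ^ n).
Proof.
rewrite exprDn_pchar // pnatX pnatE ?(pcharf_prime pR) //.
by rewrite pR.
Qed.

Lemma exprp_opp n (x : R) : (- x) ^+ (p ^ n) = - x ^+ (p ^ n).
Proof.
apply/eqP; rewrite -subr_eq0 opprK -exprp_add addNr expr0n.
by rewrite expn_eq0 -leqn0 leqNgt (prime_gt0 (pcharf_prime pR)).
Qed.

Lemma exprp_sub n (x y : R) : (x - y) ^+ (p ^ n) = x ^+ (p ^ n) - y ^+ (p ^ n).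
Proof. by rewrite exprp_add exprp_opp. Qed.

Lemma exprp_sum n (I : Type) (r : seq I) (P : pred I) (E : I -> R) :
  (\sum_(i <- r | P i) E i) ^+ (p ^ n) = \sum_(i <- r | P i) E i ^+ (p ^ n).
Proof.
apply: (big_morph (fun x => x ^+ (p ^ n))) => [x y|]; first exact: exprp_add.
by rewrite expr0n expn_eq0 -leqn0 leqNgt (prime_gt0 (pcharf_prime pR)).
Qed.

Lemma expr1p_add (x y : R) : (x + y) ^+ p = x ^+ p + y ^+ p.
Proof. by have := exprp_add 1 x y; rewrite expn1. Qed.
Lemma expr1p_sub (x y : R) : (x - y) ^+ p = x ^+ p - y ^+ p.
Proof. by have := exprp_sub 1 x y; rewrite expn1. Qed.
Lemma expr1p_sum (I : Type) (r : seq I) (P : pred I) (E : I -> R) :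
  (\sum_(i <- r | P i) E i) ^+ p = \sum_(i <- r | P i) E i ^+ p.
Proof. by have := exprp_sum 1 r P E; rewrite expn1. Qed.

End Frobenius.

Section PurelyInseparable.

Variables (F : fieldType) (p : nat) (pF : p \in [pchar F]).
Let p_pr := pcharf_prime pF.

Lemma expr1p_inj : injective (fun x : F => x ^+ p).
Proof. exact: (fmorph_inj (pFrobenius_aut pF)). Qed.

(** Over E the minimal polynomial of a p-th root x of an element of E divides
    X^p - x^p = (X - x)^p; it is a power (X - x)^k, and if p does not divide k
    its second coefficient - k x puts x into E. *)
Lemma purely_inseparable_root E x (P : {poly F}) : subfield_pred E ->
  E (x ^+ p) -> coefs_in E P -> root P x -> E x \/ ('X - x%:P) ^+ p %| P.
Proof.
move=> sE Exp EP Px0.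
have [Q QP] := subfield_lift_poly sE EP; have [y yE] := subfield_lift sE Exp.
pose g := gcdp Q ('X^p - y%:P).
have gE : map_poly val g = gcdp P (('X - x%:P) ^+ p).
  rewrite gcdp_map QP rmorphB [X in gcdp P (X - _)]map_polyXn [X in gcdp P (_ - X)]map_polyC.
  by rewrite (expr1p_sub (R := {poly F})) ?pchar_poly // -rmorphXn -yE.
have /dvdp_exp_XsubCP [k lekp gk] : map_poly val g %| ('X - x%:P) ^+ p.
  by rewrite gE dvdp_gcdr.
have := lekp; rewrite leq_eqVlt => /orP [/eqP kp|ltkp].
  by right; rewrite -kp -(eqp_dvdl _ gk) gE dvdp_gcdl.
left; have k_gt0 : (0 < k)%N.
  have : root (map_poly val g) x.
    rewrite gE root_gcd Px0 rootE horner_exp hornerXsubC subrr expr0n.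
    by rewrite gtn_eqF ?prime_gt0 ?eqxx.
  rewrite (eqp_root gk) lt0n; apply: contraTneq => ->.
  by rewrite expr0 root1.
have g0 : g != 0.
  apply: contraTneq gk => ->; rewrite rmorph0 eqp_sym eqp0.
  by rewrite expf_eq0 polyXsubC_eq0 andbF.
pose h := (lead_coef g)^-1 *: g.
have hE : map_poly val h = ('X - x%:P) ^+ k.
  apply/eqP; rewrite -eqp_monic ?monic_exp ?monicXsubC //.
    rewrite map_polyZ; apply: eqp_trans gk; rewrite eqp_scale //.
    by rewrite fmorph_eq0 invr_eq0 lead_coef_eq0.
  by rewrite map_monic monicE lead_coefZ mulVf ?lead_coef_eq0.
have := subfield_map_poly h k.-1; rewrite hE.
have -> : (('X - x%:P) ^+ k)`_k.-1 = - (x *+ k).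
  have := @coefPn_prod_XsubC F (nseq k x); rewrite size_nseq -lt0n => /(_ k_gt0).
  by rewrite !big_nseq iter_mulr_1 iter_addr_0.
move=> Ekx; have k0 : k%:R != 0 :> F.
  by rewrite -(dvdn_pcharf pF) gtnNdvd.
have sE' := subfield_subring sE.
rewrite -(mulfK k0 x) mulr_natr -[x *+ k]opprK; apply: subfield_div => //.
  exact: subringN.
exact: subring_nat.
Qed.

(** A relation is a polynomial of degree less than p which (X - x)^p divides. *)
Lemma purely_inseparable_free E x (c : 'I_p -> F) : subfield_pred E ->
    E (x ^+ p) -> ~ E x -> (forall i, E (c i)) ->
  \sum_i c i * x ^+ i = 0 -> forall i, c i = 0.
Proof.
move=> sE Exp nEx Ec sum0.
pose P := \poly_(i < p) (if insub i is Some i' then c i' else 0).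
have PE (i : 'I_p) : P`_i = c i by rewrite coef_poly ltn_ord valK.
have EP : coefs_in E P.
  move=> i; rewrite coef_poly; case: ifP => _; last exact: subring0 (proj1 sE).
  by case: insub => [j|]; [apply: Ec | apply: subring0 (proj1 sE)].
have Px0 : root P x.
  rewrite rootE (horner_coef_wide _ (size_poly _ _)); apply/eqP.
  by rewrite -[RHS]sum0; apply: eq_bigr => i _; rewrite PE.
have [//|] := purely_inseparable_root sE Exp EP Px0.
have [P0 _ i|P0 /dvdp_leq] := eqVneq P 0; first by rewrite -PE P0 coef0.
by rewrite size_exp_XsubC ltnNge size_poly => /(_ P0).
Qed.

(** A separable polynomial is not divisible by the square of X - x. *)
Lemma separable_purely_inseparable (E : F -> Prop) x : subfield_pred E ->
  E (x ^+ p) -> separable_over_sub E x -> E x.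
Proof.
move=> sE Exp [q [sep_q Eq qx0]].
have [//|] := purely_inseparable_root sE Exp Eq qx0.
by rewrite (separable_nosquare sep_q) ?prime_gt1 // size_XsubC.
Qed.

(** If all p-th powers belong to E then so does 1/x = x^(p-1) (1/x)^p. *)
Lemma subring_frobenius_subfield (E : F -> Prop) :
  subring_pred E -> (forall x, E (x ^+ p)) -> subfield_pred E.
Proof.
move=> sE Ep; split=> // x Ex; have [->|x0] := eqVneq x 0.
  by rewrite invr0; apply: subring0.
have -> : x^-1 = x ^+ p.-1 * x^-1 ^+ p.
  rewrite -[X in _ * _ ^+ X](prednK (prime_gt0 p_pr)) exprSr mulrA exprVn divff ?mul1r //.
  exact: expf_neq0.
by apply: subringM => //; apply: subringX.
Qed.

(** The ring E[t]; when E contains all p-th powers it is the field E(t). *)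
Definition adjoin_one (E : F -> Prop) t (x : F) : Prop :=
  exists2 P : {poly F}, coefs_in E P & x = P.[t].

Lemma adjoin_one_base (E : F -> Prop) t x : subring_pred E -> E x -> adjoin_one E t x.
Proof. by exists x%:P; rewrite ?hornerC //; apply: coefs_inC. Qed.

Lemma adjoin_one_gen (E : F -> Prop) t : subring_pred E -> adjoin_one E t t.
Proof. by exists 'X; rewrite ?hornerX //; apply: coefs_inX. Qed.

Lemma adjoin_one_subring (E : F -> Prop) t :
  subring_pred E -> subring_pred (adjoin_one E t).
Proof.
move=> sE; have sP := coefs_in_subring sE.
split=> [|x y [P EP ->] [Q EQ ->]|x y [P EP ->] [Q EQ ->]].
- by exists 1; rewrite ?hornerE //; apply: (subring1 sP).
- by exists (P - Q); rewrite ?hornerE //; apply: (subringB sP).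
by exists (P * Q); rewrite ?hornerE //; apply: (subringM sP).
Qed.

Lemma adjoin_one_sub (E E' : F -> Prop) t : subring_pred E' ->
  (forall x, E x -> E' x) -> E' t -> forall x, adjoin_one E t x -> E' x.
Proof.
by move=> sE' EE' E't x [P EP ->]; apply: subring_horner => // i; apply: EE'.
Qed.

Section FrobeniusSubfield.

Variable E : F -> Prop.
Hypotheses (sE : subring_pred E) (Ep : forall x, E (x ^+ p)).

Lemma adjoin_one_subfield t : subfield_pred (adjoin_one E t).
Proof.
apply: subring_frobenius_subfield; first exact: adjoin_one_subring.
by move=> x; apply: adjoin_one_base.
Qed.

(** t^n is the product of the p-th power (t^(n / p))^p and of t^(n mod p). *)
Lemma adjoin_one_span t x : adjoin_one E t x ->
  exists2 c : 'I_p -> F, forall i, E (c i) & x = \sum_i c i * t ^+ i.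
Proof.
case=> P EP ->; pose D y := exists2 c : 'I_p -> F, forall i, E (c i) &
  y = \sum_i c i * t ^+ i.
suff DX n : D (t ^+ n).
  rewrite horner_coef; apply: (big_ind D) => [|y z [c Ec ->] [d Ed ->]|i _].
  - exists (fun=> 0) => [i|]; first exact: subring0.
    by rewrite big1 // => i _; rewrite mul0r.
  - exists (fun i => c i + d i) => [i|]; first exact: subringD.
    by rewrite -big_split; apply: eq_bigr => i _; rewrite mulrDl.
  have [c Ec ->] := DX i; exists (fun j => P`_i * c j) => [j|].
    exact: subringM.
  by rewrite mulr_sumr; apply: eq_bigr => j _; rewrite mulrA.
have lt_np : (n %% p < p)%N by rewrite ltn_mod prime_gt0.
exists (fun i : 'I_p => if i == Ordinal lt_np then (t ^+ (n %/ p)) ^+ p else 0).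
  by move=> i; case: eqP => _ //; apply: subring0.
rewrite (bigD1 (Ordinal lt_np)) //= eqxx big1 => [|i /negPf ->]; last first.
  by rewrite mul0r.
by rewrite addr0 -exprM -exprD -divn_eq.
Qed.

(** Write z = sum_i c_i t^i.  If t were outside E[z], over which it is a root of
    sum_i c_i X^i - z, of degree less than p, then this polynomial would be zero
    by [purely_inseparable_root], and z = c_0 would be in E. *)
Lemma adjoin_one_exchange t z : (forall x, adjoin_one E t x) -> ~ E z ->
  forall x, adjoin_one E z x.
Proof.
move=> Ft nEz x; apply: (adjoin_one_sub _ _ _ (Ft x)).
- exact: adjoin_one_subring.
- by move=> y; apply: adjoin_one_base.
have [c Ec zE] := adjoin_one_span (Ft z).
have sKz := adjoin_one_subfield z; have sR := subfield_subring sKz.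
pose P := \poly_(i < p) (if insub i is Some i' then c i' else 0) - z%:P.
have bz y : E y -> adjoin_one E z y by apply: adjoin_one_base.
have EP : coefs_in (adjoin_one E z) P.
  apply: (subringB (coefs_in_subring sR)); last first.
    by apply: coefs_inC => //; apply: adjoin_one_gen.
  move=> i; rewrite coef_poly; case: ifP => _; last exact: subring0 sR.
  by case: insub => [j|]; [apply/bz/Ec | apply: subring0 sR].
have Pt0 : root P t.
  rewrite rootE hornerD hornerN hornerC (horner_coef_wide _ (size_poly _ _)).
  rewrite [z in _ - z]zE subr_eq0; apply/eqP; apply: eq_bigr => i _.
  by rewrite coef_poly ltn_ord valK.
have [|//|] := purely_inseparable_root sKz _ EP Pt0; first exact/bz.
have [P0|P0 /dvdp_leq] := eqVneq P 0; last first.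
  rewrite size_exp_XsubC ltnNge => /(_ P0); rewrite /P.
  rewrite (leq_trans (size_polyD _ _)) // geq_max size_poly size_polyN.
  by rewrite (leq_trans (size_polyC_leq1 _)) ?prime_gt0.
move/eqP: P0; rewrite subr_eq0 => /eqP /(congr1 (fun q : {poly F} => q`_0)).
rewrite coef_poly prime_gt0 // coefC /=; case: insub => [i|] zc; case: nEz.
  by rewrite -zc.
by rewrite -zc; apply: subring0.
Qed.

End FrobeniusSubfield.

End PurelyInseparable.

(** * Codimension of subspaces *)

Section Codimension.

Variables (L : fieldType) (T : comNzRingType) (g : {rmorphism L -> T}).
Implicit Types A B C : T -> Prop.

Definition subspace A : Prop :=
  [/\ A 0, forall x y, A x -> A y -> A (x + y) & forall c x, A x -> A (g c * x)].

Lemma subspace0 A : subspace A -> A 0. Proof. by case. Qed.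
Lemma subspaceD A x y : subspace A -> A x -> A y -> A (x + y).
Proof. by case=> _ + _; apply. Qed.
Lemma subspaceZ A c x : subspace A -> A x -> A (g c * x).
Proof. by case=> _ _; apply. Qed.
Lemma subspaceN A x : subspace A -> A x -> A (- x).
Proof. by move=> sA Ax; rewrite -mulN1r -(rmorphN1 g); apply: subspaceZ. Qed.
Lemma subspaceB A x y : subspace A -> A x -> A y -> A (x - y).
Proof. by move=> sA Ax Ay; apply: subspaceD => //; apply: subspaceN. Qed.
Lemma subspace_sum A (I : Type) (r : seq I) (P : pred I) (E : I -> T) :
  subspace A -> (forall i, P i -> A (E i)) -> A (\sum_(i <- r | P i) E i).
Proof.
by move=> sA AE; apply: big_ind => //; [apply: subspace0 | move=> x y; apply: subspaceD].
Qed.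

Let lincomb n (c : 'rV[L]_n) (b : 'I_n -> T) := \sum_(i < n) g (c 0 i) * b i.

Let lincombB n (c d : 'rV[L]_n) b : lincomb (c - d) b = lincomb c b - lincomb d b.
Proof.
rewrite /lincomb -sumrB; apply: eq_bigr => i _.
by rewrite !mxE rmorphB mulrBl.
Qed.

(** The matrices which express two bases of B / A in each other are inverse. *)
Lemma has_codim_le A B m n :
  subspace A -> has_codim g A B m -> has_codim g A B n -> (m <= n)%N.
Proof.
move=> sA [b [Bb b_basis]] [d [Bd d_basis]].
have [M MP] := choice (fun i => d_basis _ (Bb i)).
have [N NP] := choice (fun i => b_basis _ (Bd i)).
apply: (@mulmx1_min L _ _ (\matrix_i M i) (\matrix_i N i)).
apply/row_matrixP => i; have [c [_ c_uniq]] := b_basis _ (Bb i).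
have -> : row i (\matrix_i M i *m \matrix_i N i) = c; last first.
  apply: c_uniq.
  rewrite (bigD1 i) //= !mxE eqxx rmorph1 mul1r big1 => [|k /negPf ki].
    by rewrite addr0 subrr; apply: subspace0.
  by rewrite !mxE eq_sym ki rmorph0 mul0r.
symmetry; apply: c_uniq.
have -> : b i - \sum_j g (row i (\matrix_i M i *m \matrix_i N i) 0 j) * b j =
    (b i - lincomb (M i) d) + \sum_k g (M i 0 k) * (d k - lincomb (N k) b).
  under [X in _ = _ + X]eq_bigr do rewrite mulrBr.
  rewrite sumrB addrA subrK; congr (_ - _).
  under [RHS]eq_bigr do rewrite mulr_sumr.
  rewrite exchange_big /=; apply: eq_bigr => j _.
  rewrite !mxE rmorph_sum mulr_suml; apply: eq_bigr => k _.
  by rewrite !mxE rmorphM mulrA.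
apply: subspaceD => //; first by case: (MP i).
by apply: subspace_sum => // k _; apply: subspaceZ => //; case: (NP k).
Qed.

Lemma has_codim_uniq A B m n :
  subspace A -> has_codim g A B m -> has_codim g A B n -> m = n.
Proof.
move=> sA Am An; apply/eqP; rewrite eqn_leq.
by rewrite (has_codim_le sA Am An) (has_codim_le sA An Am).
Qed.

Lemma eq_has_codim A B A' B' n : (forall x, A x <-> A' x) ->
  (forall x, B x <-> B' x) -> has_codim g A B n -> has_codim g A' B' n.
Proof.
move=> eA eB [b [Bb b_basis]]; exists b; split=> [i|z /eB /b_basis]; first exact/eB.
by case=> c [Ac c_uniq]; exists c; split=> [|d /eA]; [apply/eA | apply: c_uniq].
Qed.

Lemma has_codim_id A : subspace A -> has_codim g A A 0.
Proof.
move=> sA; exists (fun=> 0); split=> [[] //|z Az]; exists 0; split=> [|c _].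
  by rewrite big_ord0 subr0.
by rewrite [c]thinmx0.
Qed.

Lemma has_codim_trans A C B m n : subspace A -> subspace C ->
  (forall x, A x -> C x) -> (forall x, C x -> B x) ->
  has_codim g A C m -> has_codim g C B n -> has_codim g A B (m + n).
Proof.
move=> sA sC AC CB [b [Cb b_basis]] [d [Bd d_basis]].
pose e i := match split i with inl j => b j | inr k => d k end.
have eE (c : 'rV_(m + n)) : \sum_i g (c 0 i) * e i =
    lincomb (lsubmx c) b + lincomb (rsubmx c) d.
  rewrite big_split_ord; congr (_ + _); apply: eq_bigr => i _; rewrite !mxE /e.
    by rewrite -[lshift n i]/(unsplit (inl i)) unsplitK.
  by rewrite -[rshift m i]/(unsplit (inr i)) unsplitK.
exists e; split=> [i|z Bz]; first by rewrite /e; case: split => j //; apply: CB.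
have [c2 [Cc2 c2_uniq]] := d_basis _ Bz.
have [c1 [Ac1 c1_uniq]] := b_basis _ Cc2.
exists (row_mx c1 c2); split=> [|c]; rewrite eE; first by rewrite row_mxKl row_mxKr [lincomb c1 b + _]addrC opprD addrA.
move=> Ac; have c2E : c2 = rsubmx c.
  apply: c2_uniq; rewrite -/(lincomb _ d).
  have -> : z - lincomb (rsubmx c) d =
      z - (lincomb (lsubmx c) b + lincomb (rsubmx c) d) + lincomb (lsubmx c) b.
    by ring.
  apply: subspaceD => //; first exact: AC.
  by apply: subspace_sum => // i _; apply: subspaceZ.
rewrite -[c]hsubmxK -c2E; congr row_mx; apply: c1_uniq; rewrite c2E.
rewrite -/(lincomb _ b) -/(lincomb _ d).
have -> : z - lincomb (rsubmx c) d - lincomb (lsubmx c) b =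
    z - (lincomb (lsubmx c) b + lincomb (rsubmx c) d) by ring.
by [].
Qed.

(** The least number of vectors of B which span B modulo C: by minimality they
    are independent modulo C. *)
Lemma has_codim_quotient A C B n : subspace C -> (forall x, A x -> C x) ->
  has_codim g A B n -> exists m, has_codim g C B m.
Proof.
move=> sC AC [b [Bb b_basis]].
pose spans m := exists d : 'I_m -> T, (forall i, B (d i)) /\
  forall z, B z -> exists c : 'rV_m, C (z - \sum_i g (c 0 i) * d i).
have ex_m : exists m, `[< spans m >].
  exists n; apply/asboolP; exists b; split=> // z Bz.
  by have [c [Ac _]] := b_basis _ Bz; exists c; apply: AC.
case: (ex_minnP ex_m) => m /asboolP [d [Bd d_span]] min_m; exists m, d.
split=> // z Bz; have [c Cc] := d_span _ Bz; exists c; split=> // c' Cc'.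
have /subspaceB /(_ Cc) := Cc'; move=> /(_ sC).
rewrite opprD addrACA subrr add0r opprK addrC -lincombB => Ccc.
apply/eqP; rewrite -subr_eq0; apply/eqP/rowP => i; rewrite [RHS]mxE.
apply/eqP/negPn/negP => ci0; move: (c - c') ci0 Ccc => e ei0 Ce.
have m_gt0 := leq_ltn_trans (leq0n i) (ltn_ord i).
suff /asboolP /min_m : spans m.-1 by rewrite leqNgt prednK // leqnn.
exists (fun k => d (lift i k)); split=> // y By.
have [{Cc}c Cc] := d_span _ By.
exists (\row_k (c 0 (lift i k) - c 0 i / e 0 i * e 0 (lift i k))).
have := subspaceD sC Cc (subspaceZ (c 0 i / e 0 i) sC Ce).
congr C; rewrite /lincomb !(bigD1_ord i) //= mulrDr mulrA -rmorphM divfK //.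
rewrite mulr_sumr [X in _ = y - X](eq_bigr (fun k => g (c 0 (lift i k)) * d (lift i k) -
                   g (c 0 i / e 0 i) * (g (e 0 (lift i k)) * d (lift i k)))).
  by rewrite sumrB; ring.
by move=> k _; rewrite !mxE rmorphB !rmorphM /=; ring.
Qed.

Section DirectSum.

Variables (n : nat) (e : 'I_n -> T).
Implicit Types X Y : 'I_n -> T -> Prop.

Definition direct_sum X z : Prop :=
  exists x : 'I_n -> T, (forall i, X i (x i)) /\ z = \sum_i x i * e i.

Definition sum_is_direct X : Prop := forall x y : 'I_n -> T,
  (forall i, X i (x i)) -> (forall i, X i (y i)) ->
  \sum_i x i * e i = \sum_i y i * e i -> forall i, x i = y i.

Lemma direct_sum_subspace X :
  (forall i, subspace (X i)) -> subspace (direct_sum X).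
Proof.
move=> sX; split=> [|x y [x' [Xx ->]] [y' [Xy ->]]|c x [x' [Xx ->]]].
- exists (fun=> 0); split=> [i|]; first exact: subspace0.
  by rewrite big1 // => i _; rewrite mul0r.
- exists (fun i => x' i + y' i); split=> [i|]; first exact: subspaceD.
  by rewrite -big_split; apply: eq_bigr => i _; rewrite mulrDl.
exists (fun i => g c * x' i); split=> [i|]; first exact: subspaceZ.
by rewrite mulr_sumr; apply: eq_bigr => i _; rewrite mulrA.
Qed.

Lemma direct_sumS X Y z :
  (forall i x, X i x -> Y i x) -> direct_sum X z -> direct_sum Y z.
Proof. by move=> XY [x [Xx ->]]; exists x; split=> // i; apply: XY. Qed.

(** Only one summand grows at a time; [has_codim_direct_sum] adds these steps
    up. *)
Lemma has_codim_coordinate X Y j k : sum_is_direct Y ->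
  (forall i, subspace (Y i)) -> (forall x, X j x -> Y j x) ->
  (forall i, i != j -> X i = Y i) -> has_codim g (X j) (Y j) k ->
  has_codim g (direct_sum X) (direct_sum Y) k.
Proof.
move=> dirY sY XYj XY [b [Yb b_basis]].
have XYi i x : X i x -> Y i x.
  by have [->|/XY ->] := eqVneq i j; first exact: XYj.
exists (fun l => b l * e j); split=> [l|z [x [Yx zE]]].
  exists (fun i => if i == j then b l else 0); split=> [i|].
    by case: eqP => [->|_] //; apply: subspace0.
  rewrite (bigD1 j) //= eqxx big1 ?addr0 // => i /negPf ->.
  by rewrite mul0r.
have shift (c : 'rV[L]_k) : z - \sum_l g (c 0 l) * (b l * e j) =
    \sum_i (if i == j then x j - \sum_l g (c 0 l) * b l else x i) * e i.
  rewrite zE (bigD1 j) //= [RHS](bigD1 j) //= eqxx mulrBl mulr_suml.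
  rewrite addrAC; congr (_ - _ + _).
    by apply: eq_bigr => l _; rewrite mulrA.
  by apply: eq_bigr => i /negPf ->.
have [c [Xc c_uniq]] := b_basis _ (Yx j); exists c; split=> [|c'].
  rewrite shift; eexists; split; last by [].
  by move=> i /=; case: eqVneq => [->//|ij]; rewrite XY.
rewrite shift => -[y [Xy /dirY yE]]; apply: c_uniq.
have := yE _ _ j; rewrite eqxx => -> // i; last exact: XYi.
case: eqVneq => [->|//]; apply: subspaceB => //.
by apply: subspace_sum => // l _; apply: subspaceZ.
Qed.

Lemma has_codim_direct_sum X Y (k : 'I_n -> nat) : sum_is_direct Y ->
  (forall i, subspace (X i)) -> (forall i, subspace (Y i)) ->
  (forall i x, X i x -> Y i x) -> (forall i, has_codim g (X i) (Y i) (k i)) ->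
  has_codim g (direct_sum X) (direct_sum Y) (\sum_i k i).
Proof.
move=> dirY sX sY XY kXY.
pose Z j (i : 'I_n) := if (i < j)%N then Y i else X i.
have sZ j i : subspace (Z j i) by rewrite /Z; case: ifP.
have XZ j i x : X i x -> Z j i x by rewrite /Z; case: ifP => // _; apply: XY.
have ZY j i x : Z j i x -> Y i x by rewrite /Z; case: ifP => // _; apply: XY.
have ZS j i x : Z j i x -> Z j.+1 i x.
  by rewrite /Z ltnS; case: ltngtP => // _; apply: XY.
suff codZ j : (j <= n)%N ->
    has_codim g (direct_sum X) (direct_sum (Z j)) (\sum_(i < n | (i < j)%N) k i).
  have -> : \sum_i k i = \sum_(i < n | (i < n)%N) k i.
    by apply: eq_bigl => i; rewrite ltn_ord.
  have := codZ n (leqnn n).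
  by apply: eq_has_codim => z //; split; apply: direct_sumS => i x;
    rewrite /Z ltn_ord.
elim: j => [_|j IHj ltjn].
  rewrite big1 //; apply: (eq_has_codim _ _ (has_codim_id (direct_sum_subspace sX))).
    by [].
  by move=> z; split; apply: direct_sumS => i x; rewrite /Z ltn0.
pose i0 := Ordinal ltjn.
rewrite (bigD1 i0) //= addnC (eq_bigl (fun i : 'I_n => (i < j)%N)); last first.
  by move=> i; rewrite -val_eqE /= ltnS ltn_neqAle andbC.
apply: (has_codim_trans (C := direct_sum (Z j))).
- exact: direct_sum_subspace.
- exact: direct_sum_subspace.
- by move=> z; apply: direct_sumS => i x; apply: XZ.
- by move=> z; apply: direct_sumS => i x; apply: ZS.
- exact/IHj/ltnW.
apply: (has_codim_coordinate (j := i0)) => //.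
- by move=> x y Zx Zy; apply: dirY => i; apply: ZY.
- by move=> x; apply: ZS.
- by move=> i; rewrite -val_eqE /= /Z ltnS; case: ltngtP.
by rewrite /Z ltnn ltnSn.
Qed.

End DirectSum.

End Codimension.

(** * Valuations *)

Section Valuation.

Variables (F : fieldType) (R : realDomainType).

(** The value group is Z or Q below: the value group of the geometric field is
    at first only known to lie in Z[1/p]. *)
Definition valuation (v : F -> R) : Prop :=
  (forall x y, x != 0 -> y != 0 -> v (x * y) = v x + v y) /\
  (forall x y, x != 0 -> y != 0 -> x + y != 0 ->
     Num.min (v x) (v y) <= v (x + y)).

(** The value of 0 is infinite, whatever v 0 is. *)
Definition val_ge (v : F -> R) (n : R) (x : F) : Prop := x = 0 \/ n <= v x.

Variables (v : F -> R) (vv : valuation v).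

Lemma valM x y : x != 0 -> y != 0 -> v (x * y) = v x + v y.
Proof. by case: vv => + _; apply. Qed.

Lemma val1 : v 1 = 0.
Proof.
have := valM (oner_neq0 F) (oner_neq0 F); rewrite mulr1 => e.
by apply: (addrI (v 1)); rewrite addr0 -e.
Qed.

Lemma valV x : x != 0 -> v x^-1 = - v x.
Proof.
move=> x0; apply/eqP; rewrite -subr_eq0 opprK -valM ?invr_eq0 //.
by rewrite mulVf // val1.
Qed.

Lemma valX x n : x != 0 -> v (x ^+ n) = v x *+ n.
Proof.
move=> x0; elim: n => [|n IHn]; first by rewrite expr0 val1 mulr0n.
by rewrite exprS valM ?expf_neq0 // IHn mulrS.
Qed.

Lemma valXz x (k : int) : x != 0 -> v (x ^ k) = v x *~ k.
Proof.
move=> x0; case: k => n; first by rewrite -exprnP valX.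
by rewrite NegzE -exprnN valV ?expf_neq0 // valX // mulrNz pmulrn.
Qed.

Lemma valN x : v (- x) = v x.
Proof.
have [->|x0] := eqVneq x 0; first by rewrite oppr0.
have n1 : -1 != 0 :> F by rewrite oppr_eq0 oner_eq0.
have v1 : v (-1) = 0.
  have := valM n1 n1; rewrite mulrNN mulr1 val1 => /esym/eqP.
  by rewrite -mulr2n mulrn_eq0 => /eqP.
by rewrite -mulN1r valM // v1 add0r.
Qed.

Lemma val_ge0 n : val_ge v n 0. Proof. by left. Qed.

Lemma val_geP n x : x != 0 -> val_ge v n x <-> n <= v x.
Proof. by move=> /eqP x0; split=> [[]|]; [|by []|right]. Qed.

Lemma val_geW m n x : n <= m -> val_ge v m x -> val_ge v n x.
Proof. by move=> nm [->|mx]; [left | right; apply: le_trans mx]. Qed.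

Lemma val_geD n x y : val_ge v n x -> val_ge v n y -> val_ge v n (x + y).
Proof.
have [->|x0] := eqVneq x 0; first by rewrite add0r.
have [->|y0] := eqVneq y 0; first by rewrite addr0.
have [->|xy0] := eqVneq (x + y) 0; first by left.
move=> /val_geP -/(_ x0) nx /val_geP -/(_ y0) ny; apply/val_geP => //.
case: vv => _ /(_ x y x0 y0 xy0); apply: le_trans.
by rewrite le_min nx ny.
Qed.

Lemma val_geN n x : val_ge v n x -> val_ge v n (- x).
Proof. by case=> [->|nx]; [rewrite oppr0; left | right; rewrite valN]. Qed.

Lemma val_geB n x y : val_ge v n x -> val_ge v n y -> val_ge v n (x - y).
Proof. by move=> nx /val_geN; apply: val_geD. Qed.

Lemma val_geM m n x y : val_ge v m x -> val_ge v n y -> val_ge v (m + n) (x * y).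
Proof.
case=> [->|mx]; first by rewrite mul0r; left.
case=> [->|ny]; first by rewrite mulr0; left.
have [->|x0] := eqVneq x 0; first by rewrite mul0r; left.
have [->|y0] := eqVneq y 0; first by rewrite mulr0; left.
by right; rewrite valM // lerD.
Qed.

Lemma val_geX n x k : val_ge v n x -> val_ge v (n *+ k) (x ^+ k).
Proof.
move=> nx; elim: k => [|k IHk]; first by right; rewrite expr0 val1.
by rewrite exprS mulrS; apply: val_geM.
Qed.

Lemma val_ge_sum n (I : Type) (r : seq I) (P : pred I) (E : I -> F) :
  (forall i, P i -> val_ge v n (E i)) -> val_ge v n (\sum_(i <- r | P i) E i).
Proof. by move=> nE; apply: big_ind => //; [left | apply: val_geD]. Qed.

Lemma val_ge_subring : subring_pred (val_ge v 0).
Proof.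
split=> [|x y x0 y0|x y x0 y0]; first by right; rewrite val1.
  exact: val_geB.
by have := val_geM x0 y0; rewrite addr0.
Qed.

Lemma val_gt_unit x : x != 0 -> val_ge v 0 x -> val_ge v 0 x^-1 -> v x = 0.
Proof.
move=> x0 /(val_geP _ x0) vx /val_geP; rewrite invr_eq0 => /(_ x0).
by rewrite valV // oppr_ge0 => vx'; apply/eqP; rewrite eq_le vx vx'.
Qed.

Lemma val_dominant x y : x != 0 -> y = 0 \/ v x < v y ->
  x + y != 0 /\ v (x + y) = v x.
Proof.
move=> x0; have [->|y0 [/eqP|vxy]] := eqVneq y 0; first by rewrite addr0.
  by rewrite (negPf y0).
have xy0 : x + y != 0.
  by apply: contraTneq vxy => /eqP; rewrite addr_eq0 => /eqP ->; rewrite valN ltxx.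
split=> //; apply/eqP; rewrite eq_le; apply/andP; split; last first.
  by case: vv => _ /(_ x y x0 y0 xy0); rewrite min_l // ltW.
rewrite leNgt; apply/negP => vlt; case: vv => _ /(_ (x + y) (- y) xy0).
rewrite oppr_eq0 addrK => /(_ y0 x0); rewrite valN leNgt.
by rewrite lt_min vlt vxy.
Qed.

(** The term of smallest value is unique and dominates the sum of the others. *)
Lemma val_sum_distinct (I : finType) (x : I -> F) i1 :
    (forall i j, x i != 0 -> x j != 0 -> v (x i) = v (x j) -> i = j) ->
    x i1 != 0 ->
  exists i0, [/\ x i0 != 0, \sum_i x i != 0, v (\sum_i x i) = v (x i0)
    & forall i, val_ge v (v (x i0)) (x i)].
Proof.
move=> x_inj xi1.
case: (@Order.TotalTheory.arg_minP _ _ _ i1 (fun i => x i != 0) (fun i => v (x i)) xi1).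
move=> i0 xi0 min_i0; exists i0.
have [sum0 vsum] : \sum_i x i != 0 /\ v (\sum_i x i) = v (x i0).
  rewrite (bigD1 i0) //=; apply: val_dominant => //.
  apply: (big_ind (fun y => y = 0 \/ v (x i0) < v y)); first by left.
    move=> y z [->|vy]; first by rewrite add0r.
    case=> [->|vz]; first by rewrite addr0; right.
    have [->|y0] := eqVneq y 0; first by rewrite add0r; right.
    have [->|z0] := eqVneq z 0; first by rewrite addr0; right.
    have [->|yz0] := eqVneq (y + z) 0; first by left.
    right; case: vv => _ /(_ y z y0 z0 yz0); apply: lt_le_trans.
    by rewrite lt_min vy vz.
  move=> i ii0; have [|xi] := eqVneq (x i) 0; first by left.
  right; rewrite lt_neqAle min_i0 // andbT; apply: contra ii0 => /eqP vi.
  by apply/eqP; apply: x_inj.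
by split=> // i; have [|xi] := eqVneq (x i) 0; [left | right; apply: min_i0].
Qed.

Lemma val_ge_distinct (I : finType) (x : I -> F) n :
    (forall i j, x i != 0 -> x j != 0 -> v (x i) = v (x j) -> i = j) ->
  val_ge v n (\sum_i x i) -> forall i, val_ge v n (x i).
Proof.
move=> x_inj nx i1; have [->|xi1] := eqVneq (x i1) 0; first by left.
have [i0 [xi0 sum0 vsum min_i0]] := val_sum_distinct x_inj xi1.
apply: val_geW (min_i0 i1); rewrite -vsum.
by case: nx => // /eqP; rewrite (negPf sum0).
Qed.

Lemma sum_distinct_eq0 (I : finType) (x : I -> F) :
    (forall i j, x i != 0 -> x j != 0 -> v (x i) = v (x j) -> i = j) ->
  \sum_i x i = 0 -> forall i, x i = 0.
Proof.
move=> x_inj sum0 i; apply/eqP/negPn/negP => xi.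
have [i0 []] := val_sum_distinct x_inj xi.
by rewrite sum0 eqxx.
Qed.

End Valuation.

(** The ultrametric inequality, divided by the smaller value. *)
Lemma valuation_of_add1 (F : fieldType) (R : realDomainType) (v : F -> R) :
    (forall x y, x != 0 -> y != 0 -> v (x * y) = v x + v y) ->
    (forall z, val_ge v 0 z -> val_ge v 0 (1 + z)) ->
  valuation v.
Proof.
move=> vM add1; split=> // x y.
have v1 : v 1 = 0.
  have := vM 1 1 (oner_neq0 F) (oner_neq0 F); rewrite mulr1 => e.
  by apply: (addrI (v 1)); rewrite addr0 -e.
have vV z : z != 0 -> v z^-1 = - v z.
  by move=> z0; apply/eqP; rewrite -addr_eq0 -vM ?invr_eq0 // mulVf // v1.
wlog le_xy : x y / v x <= v y => [IH|] x0 y0 xy0.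
  case/orP: (le_total (v x) (v y)) => [le_xy|le_yx]; first exact: IH.
  by rewrite minC [x + y]addrC; apply: IH; rewrite // addrC.
rewrite (min_idPl le_xy); have : val_ge v 0 (1 + y / x).
  by apply: add1; right; rewrite vM ?invr_eq0 // vV // subr_ge0.
have -> : 1 + y / x = (x + y) / x by rewrite mulrDl mulfV.
case=> [/eqP|]; first by rewrite mulf_eq0 invr_eq0 (negPf x0) (negPf xy0).
by rewrite vM ?invr_eq0 // vV // subr_ge0.
Qed.

Lemma discrete_valuation_valuation (F : fieldType) (v : F -> int) :
  discrete_valuation v -> valuation v.
Proof. by case. Qed.

(** The lattice points below the line of slope m/p: as p does not divide m i,
    floor (m i / p) + floor (m (p - i) / p) = m - 1 for 0 < i < p. *)
Lemma sum_floor_multiples p m : (0 < m)%N -> prime p -> ~~ (p %| m)%N ->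
  (2 * \sum_(i < p) (m * i %/ p) = (p - 1) * (m - 1))%N.
Proof.
move=> m_gt0 p_pr pm; case: p p_pr pm => // q p_pr pm.
rewrite big_ord_recl muln0 div0n add0n mul2n -addnn.
rewrite [X in (X + _)%N](reindex_inj rev_ord_inj) -big_split /=.
rewrite (eq_bigr (fun=> (m - 1)%N)) ?sum_nat_const ?card_ord ?subn1 //.
move=> i _; rewrite /bump /= !add1n; set a := i.+1.
have -> : (q - a).+1 = (q.+1 - a)%N by rewrite subSn // /a ltn_ord.
have a_lt : (a < q.+1)%N by rewrite /a ltnS ltn_ord.
have r_gt0 : (0 < m * a %% q.+1)%N.
  rewrite lt0n; apply: contra pm; rewrite -/(q.+1 %| m * a)%N.
  by rewrite Euclid_dvdM // (gtnNdvd _ a_lt) // orbF.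
have r_lt : (m * a %% q.+1 < q.+1)%N by rewrite ltn_mod.
have e : (m * (q.+1 - a) = (m - 1 - m * a %/ q.+1) * q.+1 + (q.+1 - m * a %% q.+1))%N.
  have lek : (m * a %/ q.+1 <= m - 1)%N.
    rewrite -ltnS subn1 prednK // ltn_divLR // ltn_mul2l m_gt0 //.
  have := divn_eq (m * a) q.+1; move: lek r_gt0 r_lt.
  move: (m * a %/ q.+1)%N (m * a %% q.+1)%N => k r lek r_gt0 r_lt e.
  rewrite mulnBr e !mulnBl mul1n.
  have : (k * q.+1 <= (m - 1) * q.+1)%N by rewrite leq_mul2r lek orbT.
  by rewrite mulnBl mul1n; nia.
have lek : (m * a %/ q.+1 <= m - 1)%N.
  by rewrite -ltnS subn1 prednK // ltn_divLR // ltn_mul2l m_gt0.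
rewrite {}e; move: lek r_gt0 r_lt.
move: (m * a %/ q.+1)%N (m * a %% q.+1)%N => k r lek r_gt0 r_lt.
rewrite divnMDl // divn_small ?addn0; first by lia.
by rewrite ltnS leq_subLR; case: (r) r_gt0 => // r' _; rewrite addSn ltnS leq_addl.
Qed.

Lemma eq_mod_small p (a b : nat) (l : int) : (a < p)%N -> (b < p)%N ->
  a%:Z = b%:Z + l * p%:Z -> a = b.
Proof.
move=> lta ltb ab; have p_gt0 : 0 < p%:Z by rewrite ltz_nat (leq_ltn_trans _ lta).
have l0 : l = 0.
  case: (ltrgtP l 0) => // l0.
    have : (l + 1) * p%:Z <= 0 by rewrite pmulr_lle0 //; lia.
    by rewrite mulrDl mul1r; lia.
  have : 0 <= (l - 1) * p%:Z by rewrite pmulr_lge0 //; lia.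
  by rewrite mulrBl mul1r; lia.
by move: ab; rewrite l0 mul0r addr0 => -[].
Qed.

(** * Frobenius images and codimensions over a rational place *)

Section FrobeniusImage.

Variables (T : comNzRingType) (p : nat).

Definition frob_image (A : T -> Prop) (x : T) : Prop :=
  exists2 y, A y & x = y ^+ p.

Lemma frob_imageS (A A' : T -> Prop) x :
  (forall y, A y -> A' y) -> frob_image A x -> frob_image A' x.
Proof. by move=> AA' [y /AA' Ay ->]; exists y. Qed.

Hypothesis pT : p \in [pchar T].

Lemma frob_image_subring (A : T -> Prop) :
  subring_pred A -> subring_pred (frob_image A).
Proof.
move=> sA; split=> [|x y [x' Ax ->] [y' Ay ->]|x y [x' Ax ->] [y' Ay ->]].
- by exists 1; rewrite ?expr1n //; apply: subring1.
- by exists (x' - y'); rewrite ?expr1p_sub //; apply: subringB.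
by exists (x' * y'); rewrite ?exprMn //; apply: subringM.
Qed.

End FrobeniusImage.

Lemma closed_field_root (L : closedFieldType) n (c : L) :
  (0 < n)%N -> exists d, d ^+ n = c.
Proof.
case: n => // n _; have [d] := @solve_monicpoly L n.+1 (fun i => if i == 0%N then c else 0) isT.
move=> e; exists d; rewrite e big_ord_recl /= expr0 mulr1 big1 ?addr0 // => i _.
by rewrite mul0r.
Qed.

Section PerfectCoefficients.

Variables (L : closedFieldType) (T : fieldType) (g : {rmorphism L -> T}).
Variables (p : nat) (pT : p \in [pchar T]).
Let p_gt0 := prime_gt0 (pcharf_prime pT).

Lemma frob_image_subspace A : subspace g A -> subspace g (frob_image p A).
Proof.
move=> sA; split=> [|x y [x' Ax ->] [y' Ay ->]|c x [x' Ax ->]].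
- by exists 0; rewrite ?expr0n ?gtn_eqF //; apply: subspace0 sA.
- by exists (x' + y'); rewrite ?expr1p_add //; apply: (subspaceD sA).
have [d <-] := closed_field_root c p_gt0.
by exists (g d * x'); rewrite ?exprMn ?rmorphXn //; apply: (subspaceZ d sA).
Qed.

(** Since L is perfect, the Frobenius map is a semilinear bijection from B / A
    to B^p / A^p. *)
Lemma has_codim_frob_image A B n :
  has_codim g A B n -> has_codim g (frob_image p A) (frob_image p B) n.
Proof.
case=> b [Bb b_basis].
have lincombX (c : 'rV[L]_n) z : z ^+ p - \sum_i g (c 0 i ^+ p) * b i ^+ p =
    (z - \sum_i g (c 0 i) * b i) ^+ p.
  rewrite expr1p_sub // expr1p_sum //; congr (_ - _); apply: eq_bigr => i _.
  by rewrite exprMn rmorphXn.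
exists (fun i => b i ^+ p); split=> [i|_ [z Bz ->]]; first by exists (b i).
have [c [Ac c_uniq]] := b_basis _ Bz; exists (\row_i c 0 i ^+ p); split.
  exists (z - \sum_i g (c 0 i) * b i) => //; rewrite -lincombX.
  by congr (_ - _); apply: eq_bigr => i _; rewrite mxE.
move=> d [y Ay yE].
have [r rP] := choice (fun i => closed_field_root (d 0 i) p_gt0).
have cE : c = \row_i r i.
  apply: c_uniq; suff -> : z - \sum_i g ((\row_i r i) 0 i) * b i = y by [].
  apply: (expr1p_inj pT); rewrite -lincombX -yE; congr (_ - _).
  by apply: eq_bigr => i _; rewrite mxE rP.
by apply/rowP => i; rewrite !mxE cE mxE rP.
Qed.

End PerfectCoefficients.

Section RationalValuation.

Variables (L : closedFieldType) (T : fieldType) (g : {rmorphism L -> T}).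

(** A rational place of T over L. *)
Definition rational_valuation (W : T -> int) : Prop :=
  [/\ discrete_valuation W, forall c, c != 0 -> W (g c) = 0
    & forall x, val_ge W 0 x -> exists c, val_ge W 1 (x - g c)].

Variables (W : T -> int) (rW : rational_valuation W).
Let dW : discrete_valuation W. Proof. by case: rW. Qed.
Let vW : valuation W := discrete_valuation_valuation dW.

Lemma rational_valC n c : n <= 0 -> val_ge W n (g c).
Proof.
move=> n0; have [->|c0] := eqVneq c 0; first by rewrite rmorph0; left.
by right; case: rW => _ -> //.
Qed.

Lemma rational_valC_eq0 n c : 0 < n -> val_ge W n (g c) -> c = 0.
Proof.
move=> n0 [/eqP|]; first by rewrite fmorph_eq0 => /eqP.
have [//|c0] := eqVneq c 0; case: rW => _ -> // _.
by rewrite leNgt n0.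
Qed.

Lemma val_ge_subspace n : subspace g (val_ge W n).
Proof.
split=> [|x y|c x nx]; [by left | exact: val_geD|].
by have := val_geM vW (rational_valC c (lexx 0)) nx; rewrite add0r.
Qed.

Variable s : T.
Hypotheses (s0 : s != 0) (Ws : W s = 1).

Lemma val_uniformizer n : W (s ^+ n) = n%:Z.
Proof. by rewrite valX // Ws natz. Qed.

(** The classes of 1, s, ..., s^(n-1) are a basis of B / s^n B. *)
Lemma has_codim_val_ge n : has_codim g (val_ge W n%:Z) (val_ge W 0) n.
Proof.
elim: n => [|n IHn]; first exact: (has_codim_id (val_ge_subspace 0)).
have sub k l : (k <= l)%N -> forall x, val_ge W l%:Z x -> val_ge W k%:Z x.
  by move=> kl x; apply: val_geW; rewrite lez_nat.
rewrite -add1n; apply: has_codim_trans (val_ge_subspace _) (val_ge_subspace _) _ _ _ IHn.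
- exact: sub.
- exact: (sub 0%N).
have sn0 : s ^+ n != 0 by rewrite expf_neq0.
have WsV : val_ge W (- n%:Z) (s ^+ n)^-1 by right; rewrite valV // val_uniformizer.
have Wsn : val_ge W n%:Z (s ^+ n) by right; rewrite val_uniformizer.
exists (fun=> s ^+ n); split=> // z nz.
have [c zc] : exists c, val_ge W 1 (z / s ^+ n - g c).
  by case: rW => _ _; apply; have := val_geM vW nz WsV; rewrite subrr.
exists (const_mx c); split=> [|d]; rewrite big_ord1 ?mxE.
  by have := val_geM vW zc Wsn; rewrite mulrBl divfK.
move=> /val_geM -/(_ vW _ _ WsV); rewrite PoszD addrK.
rewrite mulrBl mulfK // => zd; have := val_geB vW zd zc.
have -> : z / s ^+ n - g (d 0 ord0) - (z / s ^+ n - g c) = g (c - d 0 ord0).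
  by rewrite rmorphB; ring.
move=> /rational_valC_eq0 -/(_ isT)/eqP; rewrite subr_eq0 => /eqP cd.
by apply/rowP => i; rewrite mxE [i]ord1.
Qed.

Variables (p : nat) (pT : p \in [pchar T]).
Let p_pr := pcharf_prime pT.
Let p_gt0 := prime_gt0 p_pr.

Definition ppower : T -> Prop := frob_image p (fun=> True).

Lemma ppower_subring : subring_pred ppower.
Proof. by apply: frob_image_subring. Qed.

Lemma ppower_expp x : ppower (x ^+ p). Proof. by exists x. Qed.

Lemma ppower_const c : ppower (g c).
Proof.
by have [d <-] := closed_field_root c p_gt0; exists (g d); rewrite ?rmorphXn.
Qed.

Lemma ppower_val x : ppower x -> x != 0 -> exists n : int, W x = n * p%:Z.
Proof.
case=> y _ ->; rewrite expf_eq0 p_gt0 => /= y0; exists (W y).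
by rewrite valX // -mulr_natr natz.
Qed.

(** A value above - p which is divisible by p is not negative. *)
Lemma ppower_val_ge0 x : ppower x -> val_ge W (1 - p%:Z) x ->
  frob_image p (val_ge W 0) x.
Proof.
case=> y _ -> Wy; exists y => //; have [->|y0] := eqVneq y 0; first by left.
move/val_geP: Wy; rewrite expf_neq0 // => /(_ isT); rewrite valX // => Wy.
by right; move: Wy; rewrite -mulr_natr natz; move: (W y) p_gt0; clear; nia.
Qed.

(** A family with values distinct modulo p is free over T^p: the terms of any
    combination have distinct values. *)
Section DistinctModp.

Variables (n : nat) (e : 'I_n -> T).
Hypothesis e_distinct : forall i j (k : int), W (e i) = W (e j) + k * p%:Z -> i = j.

Lemma distinct_modp_inj (x : 'I_n -> T) : (forall i, ppower (x i)) ->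
  forall i j, x i * e i != 0 -> x j * e j != 0 ->
    W (x i * e i) = W (x j * e j) -> i = j.
Proof.
move=> px i j; rewrite !mulf_eq0 !negb_or => /andP [xi ei] /andP [xj ej].
rewrite !valM //; have [k ->] := ppower_val (px i) xi.
have [l ->] := ppower_val (px j) xj => e_ij; apply: (e_distinct (k := l - k)).
by rewrite mulrBl; move: e_ij; clear; lia.
Qed.

Hypothesis e0 : forall i, e i != 0.

Lemma distinct_modp_direct (Y : 'I_n -> T -> Prop) :
  (forall i x, Y i x -> ppower x) -> sum_is_direct e Y.
Proof.
move=> Yp x y Yx Yy exy i; apply/eqP; rewrite -subr_eq0.
have px j : ppower (x j - y j).
  by apply: (subringB ppower_subring); apply: Yp.
have sum0 : \sum_j (x j - y j) * e j = 0.
  under eq_bigr do rewrite mulrBl.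
  by rewrite sumrB exy subrr.
have /eqP := sum_distinct_eq0 vW (distinct_modp_inj px) sum0 i.
by rewrite mulf_eq0 (negPf (e0 i)) orbF.
Qed.

End DistinctModp.

Lemma ppower_gen_free z : ~ ppower z ->
  sum_is_direct (fun i : 'I_p => z ^+ i) (fun=> ppower).
Proof.
move=> pz x y px py exy i; apply/eqP; rewrite -subr_eq0; apply/eqP.
have sub : subfield_pred ppower.
  by apply: (subring_frobenius_subfield pT ppower_subring); apply: ppower_expp.
apply: (purely_inseparable_free (c := fun j => x j - y j) pT sub (ppower_expp z) pz).
  by move=> j; apply: (subringB ppower_subring).
by under eq_bigr do rewrite mulrBl; rewrite sumrB exy subrr.
Qed.

Section PowerBasis.

Variables (y : T) (m : nat).
Hypotheses (y0 : y != 0) (Wy : W y = m%:Z) (m_gt0 : (0 < m)%N).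
Hypotheses (pm : ~~ (p %| m)%N) (T_gen : forall x, adjoin_one ppower y x).

Let k (i : nat) := (m * i %/ p)%N.
Let e (i : 'I_p) := y ^+ i / (s ^+ k i) ^+ p.

Let sk0 i : s ^+ k i != 0. Proof. by rewrite expf_neq0. Qed.
Let e0 i : e i != 0.
Proof. by rewrite mulf_neq0 ?invr_eq0 ?expf_neq0. Qed.

Let We i : W (e i) = (m * i %% p)%:Z.
Proof.
rewrite valM ?invr_eq0 ?expf_neq0 // valV ?expf_neq0 // !valX ?expf_neq0 //.
have mulnz (a : int) n : a *+ n = a * n%:Z by rewrite -mulr_natr natz.
rewrite Wy Ws !mulnz mul1r -!PoszM.
by rewrite {1}(divn_eq (m * i) p) PoszD addrAC subrr add0r.
Qed.

Let e_distinct i j (l : int) : W (e i) = W (e j) + l * p%:Z -> i = j.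
Proof.
rewrite !We => eij; have lt_r (a : nat) : (a %% p < p)%N by rewrite ltn_mod.
have r_eq : (m * i = m * j %[mod p])%N.
  exact: eq_mod_small eij.
apply/eqP; move: r_eq {eij}; wlog le_ij : i j / (i <= j)%N => [IH r_eq|r_eq].
  case: (leqP i j) => [|/ltnW] le_ij; first exact: IH.
  by rewrite eq_sym; apply: IH.
rewrite -val_eqE eqn_leq le_ij /= leqNgt; apply/negP => lt_ij.
have /eqP := r_eq; rewrite eq_sym eqn_mod_dvd ?leq_mul2l ?le_ij ?orbT //.
rewrite -mulnBr Euclid_dvdM // (negPf pm) /= gtnNdvd ?subn_gt0 //.
by rewrite (leq_ltn_trans (leq_subr _ _)).
Qed.

(** With W y = m prime to p, B is the direct sum of the B^p e_i, where
    e_i = y^i / s^(p floor(m i / p)) has value m i mod p in [0, p), whereas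
    B^p[y] is the direct sum of the (s^floor(m i / p) B)^p e_i. *)
Lemma has_codim_power_basis :
  has_codim g (direct_sum (fun i : 'I_p => y ^+ i)
                 (fun=> frob_image p (val_ge W 0)))
    (val_ge W 0) (\sum_(i < p) m * i %/ p).
Proof.
pose X (i : 'I_p) := frob_image p (val_ge W (k i)%:Z).
pose Y (i : 'I_p) := frob_image p (val_ge W 0).
have XY i x : X i x -> Y i x.
  by apply: frob_imageS => z; apply: val_geW.
have dirY : sum_is_direct e Y.
  apply: distinct_modp_direct e_distinct e0 _ _ => i x.
  exact: frob_imageS.
apply: (eq_has_codim (A := direct_sum e X) (B := direct_sum e Y)); last first.
- apply: has_codim_direct_sum => // i.
  + exact/frob_image_subspace/val_ge_subspace.
  + exact/frob_image_subspace/val_ge_subspace.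
  exact/has_codim_frob_image/has_codim_val_ge.
- move=> x; split=> [[c [Yc ->]]|Bx].
    apply: (val_ge_sum vW) => i _; have [d Bd ->] := Yc i.
    have We0 : val_ge W 0 (e i) by right; rewrite We lez_nat.
    by have := val_geM vW (val_geX vW p Bd) We0; rewrite mul0rn add0r.
  have [c pc xE] := adjoin_one_span pT ppower_subring ppower_expp (T_gen x).
  pose d i := c i * (s ^+ k i) ^+ p.
  have pd i : ppower (d i).
    by apply: (subringM ppower_subring) => //; apply: ppower_expp.
  have xE' : x = \sum_i d i * e i.
    rewrite xE; apply: eq_bigr => i _.
    by rewrite /d /e mulrACA -mulrA mulfV ?expf_neq0 // mulr1.
  exists d; split=> // i; apply: ppower_val_ge0 => //.
  have := Bx; rewrite xE' => /(val_ge_distinct vW (distinct_modp_inj e_distinct pd)).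
  move=> /(_ i) Wde; have [->|d0] := eqVneq (d i) 0; first by left.
  right; case: Wde => [/eqP|]; first by rewrite mulf_eq0 (negPf d0) (negPf (e0 i)).
  rewrite valM // We; have : (m * i %% p < p)%N by rewrite ltn_mod.
  lia.
move=> x; split=> [[c [Xc ->]]|[c [Yc ->]]].
  have [d dP] := choice (fun i => let: ex_intro2 z Wz cz := Xc i in
    ex_intro (fun z => val_ge W (k i)%:Z z /\ c i = z ^+ p) z (conj Wz cz)).
  exists (fun i => (d i / s ^+ k i) ^+ p); split=> [i|].
    exists (d i / s ^+ k i) => //; have [Wd _] := dP i.
    have : val_ge W (- (k i)%:Z) (s ^+ k i)^-1.
      by right; rewrite valV // val_uniformizer.
    by move=> /(val_geM vW Wd); rewrite subrr.
  apply: eq_bigr => i _; have [_ ->] := dP i.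
  by rewrite /e exprMn exprVn; ring.
have [d dP] := choice (fun i => let: ex_intro2 z Wz cz := Yc i in
  ex_intro (fun z => val_ge W 0 z /\ c i = z ^+ p) z (conj Wz cz)).
exists (fun i => (d i * s ^+ k i) ^+ p); split=> [i|].
  exists (d i * s ^+ k i) => //; have [Wd _] := dP i.
  have : val_ge W (k i)%:Z (s ^+ k i) by right; rewrite val_uniformizer.
  by move=> /(val_geM vW Wd); rewrite add0r.
apply: eq_bigr => i _; have [_ ->] := dP i.
by rewrite /e exprMn mulrACA -mulrA mulfV ?expf_neq0 // mulr1.
Qed.

End PowerBasis.

(** Both sides are the A-span of the polynomials of degree less than p in z. *)
Lemma direct_sum_shift (A : T -> Prop) z a x : subring_pred A -> A a ->
  direct_sum (fun i : 'I_p => z ^+ i) (fun=> A) x ->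
  direct_sum (fun i : 'I_p => (z - a) ^+ i) (fun=> A) x.
Proof.
move=> sA Aa [c [Ac ->]].
pose P := \sum_(i < p) c i *: ('X + a%:P) ^+ i.
exists (fun i => P`_i); split=> [i|].
  apply: (subring_sum (coefs_in_subring sA)) => j _ l.
  rewrite coefZ; apply: subringM => //; apply: (subringX (coefs_in_subring sA)).
  apply: (subringD (coefs_in_subring sA)); first exact: coefs_inX.
  exact: coefs_inC.
rewrite -(horner_coef_wide (n := p)); last first.
  apply/(leq_trans (size_sum _ _ _))/bigmax_leqP => i _.
  apply: leq_trans (size_scale_leq _ _) _.
  by rewrite -[a]opprK polyCN size_exp_XsubC.
rewrite horner_sum; apply: eq_bigr => i _.
by rewrite hornerZ horner_exp !hornerE subrK.
Qed.

(** Write z = sum_i z_i^p s^i; then y = z - z_0^p has value m prime to p, and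
    B^p[z] = B^p[y] has codimension sum_i floor(m i / p) in B. *)
Lemma codim_simple_extension (O1 : T -> Prop) z delta1 n :
    ~ ppower z -> (forall x, adjoin_one ppower z x) -> val_ge W 0 z ->
    subspace g O1 -> (forall x, O1 x -> frob_image p (val_ge W 0) x) ->
    has_codim g O1 (frob_image p (val_ge W 0)) delta1 ->
    has_codim g (direct_sum (fun i : 'I_p => z ^+ i) (fun=> O1)) (val_ge W 0) n ->
  exists2 m, ~~ (p %| m)%N &
    (2 * n = 2 * (p * delta1) + (p - 1) * (m - 1))%N.
Proof.
move=> pz T_gen Bz sO1 O1B cod1 codn.
have ppower_sub : subring_pred ppower := ppower_subring.
have sB : subspace g (val_ge W 0) := val_ge_subspace 0.
have rB : subring_pred (val_ge W 0) := val_ge_subring vW.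
have s_gen x : adjoin_one ppower s x.
  apply: (adjoin_one_exchange pT ppower_sub ppower_expp T_gen).
  move=> /ppower_val /(_ s0) [l]; rewrite Ws; have := prime_gt1 p_pr.
  case: (ltrgtP l 0) => [l0||->] p1; last by rewrite mul0r.
    by have : l * p%:Z <= 0 by [rewrite pmulr_lle0 ?ltz_nat // ltW]; lia.
  by move=> l0; have : 0 <= (l - 1) * p%:Z by [rewrite pmulr_lge0 ?ltz_nat //; lia]; lia.
have [c pc zE] := adjoin_one_span pT ppower_sub ppower_expp (s_gen z).
have e_distinct (i j : 'I_p) (l : int) : W (s ^+ i) = W (s ^+ j) + l * p%:Z -> i = j.
  by rewrite !val_uniformizer => ij; apply/val_inj/(eq_mod_small _ _ ij).
pose i0 := Ordinal p_gt0.
have Bc0 : frob_image p (val_ge W 0) (c i0).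
  apply: ppower_val_ge0 => //; have := Bz; rewrite zE.
  move=> /(val_ge_distinct vW (distinct_modp_inj e_distinct pc)) /(_ i0).
  by rewrite /= expr0 mulr1; apply: val_geW; lia.
pose y := z - c i0.
have pB x : frob_image p (val_ge W 0) x -> val_ge W 0 x.
  by case=> d Bd ->; have := val_geX vW p Bd; rewrite mul0rn.
have py : ~ ppower y.
  by move=> py; apply: pz; rewrite -[z](subrK (c i0)); apply: subringD.
have yn0 : y != 0 by apply: contra_not_neq py => ->; apply: subring0.
have y_gen x : adjoin_one ppower y x by apply: (adjoin_one_exchange pT ppower_sub ppower_expp T_gen).
pose c' i := if i == i0 then 0 else c i.
have pc' i : ppower (c' i) by rewrite /c'; case: eqP => _ //; apply: subring0.
have yE : y = \sum_i c' i * s ^+ i.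
  rewrite /y zE (bigD1 i0) //= [RHS](bigD1 i0) //= /c' eqxx expr0 mulr1 mul0r add0r.
  by rewrite addrAC subrr add0r; apply: eq_bigr => i /negPf ->.
have [m Wy] : exists m : nat, W y = m%:Z.
  have : val_ge W 0 y by apply: (val_geB vW Bz); apply: pB.
  by move=> /(val_geP _ _ yn0); case: (W y) => // m _; exists m.
have pm : ~~ (p %| m)%N.
  have [i1 ci1] : exists i, c' i * s ^+ i != 0.
    apply/existsP; apply: contraNT yn0 => /existsPn c'0.
    by rewrite yE big1 // => i _; apply/eqP; have := c'0 i; rewrite negbK.
  have [i [ci _ Wi _]] := val_sum_distinct vW (distinct_modp_inj e_distinct pc') ci1.
  have i_n0 : i != i0 by apply: contraNneq ci => ->; rewrite /c' eqxx mul0r.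
  move: ci; rewrite mulf_eq0 negb_or => /andP [ci si].
  move: Wi; rewrite -yE Wy valM // val_uniformizer; have [l ->] := ppower_val (pc' i) ci.
  move=> ml; apply/negP => /dvdnP [q mq]; case/eqP: i_n0; apply: (e_distinct _ _ (q%:Z - l)).
  by rewrite !val_uniformizer /= mulrBl; move: ml; rewrite mq PoszM; lia.
have m_gt0 : (0 < m)%N by case: (m) pm; rewrite ?dvdn0.
have rpB := frob_image_subring pT rB.
have spB : subspace g (frob_image p (val_ge W 0)) by apply: frob_image_subspace.
have codC := has_codim_power_basis yn0 Wy m_gt0 pm y_gen.
have codO : has_codim g (direct_sum (fun i : 'I_p => z ^+ i) (fun=> O1))
    (direct_sum (fun i : 'I_p => z ^+ i) (fun=> frob_image p (val_ge W 0)))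
    (\sum_(i < p) delta1).
  apply: has_codim_direct_sum => //; move=> u v pu pv.
  by apply: (ppower_gen_free pz) => i; apply: frob_imageS.
have {}codC : has_codim g
    (direct_sum (fun i : 'I_p => z ^+ i) (fun=> frob_image p (val_ge W 0)))
    (val_ge W 0) (\sum_(i < p) m * i %/ p).
  apply: eq_has_codim codC => // x; split; last exact: direct_sum_shift.
  move=> /(direct_sum_shift rpB (subringN rpB Bc0)).
  by rewrite /y opprK subrK.
exists m => //; rewrite -(sum_floor_multiples m_gt0 p_pr pm) -mulnDr; congr (2 * _)%N.
have := has_codim_trans _ _ _ _ codO codC; rewrite sum_nat_const card_ord.
move=> H; apply: has_codim_uniq codn (H _ _ _ _).
- exact: direct_sum_subspace.
- exact: direct_sum_subspace.
- exact: direct_sum_subspace.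
- by move=> x; apply: direct_sumS.
move=> x [u [pu ->]]; apply: (val_ge_sum vW) => i _.
have := val_geM vW (pB _ (pu i)) (val_geX vW i Bz).
by rewrite mul0rn addr0.
Qed.

End RationalValuation.

(** * The subring O (x) L of the tensor product *)

Section TensorSub.

Variables (A B T : comNzRingType) (f : {rmorphism A -> T}) (g : {rmorphism B -> T}).
Implicit Types O : {pred A}.

Lemma tensor_sub_ind O (P : T -> Prop) : P 0 ->
    (forall x y, P x -> P y -> P (x + y)) ->
    (forall a b, a \in O -> P (f a * g b)) ->
  forall x, tensor_sub f g O x -> P x.
Proof.
by move=> P0 PD PM x [n [a [b [Oa ->]]]]; apply: big_ind => // i _; apply: PM.
Qed.

Lemma tensor_sub0 O : tensor_sub f g O 0.
Proof. by exists 0, (fun=> 0), (fun=> 0); split=> [[]|] //; rewrite big_ord0. Qed.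

Lemma tensor_subD O x y :
  tensor_sub f g O x -> tensor_sub f g O y -> tensor_sub f g O (x + y).
Proof.
case=> n [a [b [Oa ->]]] [m [c [d [Oc ->]]]]; exists (n + m)%N.
exists (fun i => match split i with inl k => a k | inr k => c k end).
exists (fun i => match split i with inl k => b k | inr k => d k end).
split=> [i|]; first by case: split.
rewrite big_split_ord; congr (_ + _); apply: eq_bigr => i _.
  by rewrite -[lshift m i]/(unsplit (inl i)) unsplitK.
by rewrite -[rshift n i]/(unsplit (inr i)) unsplitK.
Qed.

Lemma tensor_sub_elt O a b : a \in O -> tensor_sub f g O (f a * g b).
Proof. by move=> Oa; exists 1, (fun=> a), (fun=> b); rewrite big_ord1. Qed.

Lemma tensor_sub_sum O (I : Type) (r : seq I) (P : pred I) (E : I -> T) :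
  (forall i, P i -> tensor_sub f g O (E i)) ->
  tensor_sub f g O (\sum_(i <- r | P i) E i).
Proof. by move=> OE; apply: big_ind => //; [apply: tensor_sub0 | apply: tensor_subD]. Qed.

Lemma tensor_subS O O' x : {subset O <= O'} -> tensor_sub f g O x -> tensor_sub f g O' x.
Proof. by move=> OO' [n [a [b [Oa ->]]]]; exists n, a, b; split=> // i; apply: OO'. Qed.

Lemma tensor_subM O x y : (forall a b, a \in O -> b \in O -> a * b \in O) ->
  tensor_sub f g O x -> tensor_sub f g O y -> tensor_sub f g O (x * y).
Proof.
move=> OM [n [a [b [Oa ->]]]] [m [c [d [Oc ->]]]].
rewrite mulr_suml; apply: tensor_sub_sum => i _.
rewrite mulr_sumr; apply: tensor_sub_sum => k _.
by rewrite mulrACA -!rmorphM; apply/tensor_sub_elt/OM.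
Qed.

Lemma tensor_sub_subring O :
  subring_pred (fun a => a \in O) -> subring_pred (tensor_sub f g O).
Proof.
move=> sO; have O1 := subring1 sO.
have sM x y : tensor_sub f g O x -> tensor_sub f g O y -> tensor_sub f g O (x * y).
  by apply: tensor_subM; case: sO.
split=> //; first by rewrite -[1]mul1r -{1}(rmorph1 f) -(rmorph1 g); apply: tensor_sub_elt.
move=> x y Ox Oy; apply: tensor_subD => //.
rewrite -mulN1r -(rmorphN1 f) -[f _]mulr1 -(rmorph1 g).
by apply: sM => //; apply/tensor_sub_elt/(subringN sO).
Qed.

Lemma tensor_sub_left O a : a \in O -> tensor_sub f g O (f a).
Proof. by move=> Oa; rewrite -[f a]mulr1 -(rmorph1 g); apply: tensor_sub_elt. Qed.

Lemma tensor_sub_right O b : 1 \in O -> tensor_sub f g O (g b).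
Proof. by move=> O1; rewrite -[g b]mul1r -(rmorph1 f); apply: tensor_sub_elt. Qed.

End TensorSub.

Lemma tensor_sub_subspace (A T : comNzRingType) (L : fieldType)
    (f : {rmorphism A -> T}) (g : {rmorphism L -> T}) (O : {pred A}) :
  subspace g (tensor_sub f g O).
Proof.
split=> [|x y|c x [n [a [b [Oa ->]]]]]; [exact: tensor_sub0 | exact: tensor_subD|].
rewrite mulr_sumr; apply: tensor_sub_sum => i _.
by rewrite mulrCA -rmorphM; apply: tensor_sub_elt.
Qed.

Section SubringType.

Variables (R : comNzRingType) (A : R -> Prop) (sA : subring_pred A).

Definition in_subring (_ : subring_pred A) : {pred R} := fun x => `[< A x >].

Fact in_subring_closed : subring_closed (in_subring sA).
Proof.
split=> [|x y /asboolP Ax /asboolP Ay|x y /asboolP Ax /asboolP Ay]; apply/asboolP.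
- exact: subring1.
- exact: subringB.
exact: subringM.
Qed.

HB.instance Definition _ :=
  GRing.isSubringClosed.Build R (in_subring sA) in_subring_closed.

Record subring_type :=
  SubringElt { subring_val :> R; _ : subring_val \in in_subring sA }.
HB.instance Definition _ := [isSub for subring_val].
HB.instance Definition _ := [Choice of subring_type by <:].
HB.instance Definition _ := [SubChoice_isSubComNzRing of subring_type by <:].

Lemma subring_lift_morphism (S : nzRingType) (u : {rmorphism S -> R}) :
    (forall x, A (u x)) ->
  exists u' : {rmorphism S -> subring_type}, forall x, val (u' x) = u x.
Proof.
move=> Au; pose u' x := SubringElt (introT (asboolP _) (Au x) : u x \in in_subring sA).
have u'B : zmod_morphism u' by move=> x y; apply: val_inj; rewrite /= rmorphB.
have u'M : monoid_morphism u'.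
  by split=> [|x y]; apply: val_inj; rewrite /= ?rmorph1 ?rmorphM.
pose Z := GRing.isZmodMorphism.Build S subring_type u' u'B.
pose M := GRing.isMonoidMorphism.Build S subring_type u' u'M.
by exists (HB.pack_for {rmorphism S -> subring_type} u' Z M).
Qed.

End SubringType.

(** The subring generated by A and B has two maps from T to T over A and B: the
    identity, and the one that the universal property factors through it. *)
Lemma tensor_product_span (R A B T : comNzRingType)
    (i : {rmorphism R -> A}) (j : {rmorphism R -> B})
    (f : {rmorphism A -> T}) (g : {rmorphism B -> T}) :
  is_tensor_product i j f g -> forall x, tensor_sub f g predT x.
Proof.
case=> comm univ x.
have sT : subring_pred (tensor_sub f g predT) by apply: tensor_sub_subring.
have [f' f'E] := subring_lift_morphism sT (fun a => tensor_sub_left f g (O := predT) (a := a) isT).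
have [g' g'E] := subring_lift_morphism sT (fun b => tensor_sub_right f g b (O := predT) isT).
have comm' r : f' (i r) = g' (j r) by apply: val_inj; rewrite f'E g'E comm.
have [h [hf hg _]] := univ _ f' g' comm'.
have [h0 [h0f h0g h0_uniq]] := univ _ f g comm.
have h0id y : h0 y = y by symmetry; apply: (h0_uniq idfun).
rewrite -(h0id x) -(h0_uniq (val \o h) _ _ x).
- exact/asboolP/(valP (h x)).
- by move=> a; rewrite /= hf f'E.
by move=> b; rewrite /= hg g'E.
Qed.

(** * The geometric function field as a quotient *)

(** Every factor X - z of Q divides a polynomial over K, which can be freed of
    its root 0 if z is not 0. *)
Lemma poly_dvd_base (K : fieldType) (L : closedFieldType) (j : {rmorphism K -> L})
    (Q : {poly L}) : algebraic_closure j -> Q.[0] != 0 ->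
  exists2 R : {poly K}, R.[0] != 0 & Q %| map_poly j R.
Proof.
move=> alg; have [rs ->] := closed_field_poly_normal Q.
rewrite hornerZ mulf_eq0 negb_or => /andP [lead0].
elim: rs => [_|z rs IHrs].
  by exists 1; rewrite ?hornerE ?oner_eq0 // big_nil rmorph1 alg_polyC dvdp1 size_polyC lead0.
rewrite big_cons hornerM mulf_eq0 negb_or => /andP [z0 /IHrs [R R0 QR]].
have [q q0 qz] := alg z.
have [n [q1 q10 qE]] := multiplicity_XsubC q 0.
exists (q1 * R).
  by rewrite hornerM mulf_neq0 //; apply: implyP q10 _.
rewrite rmorphM scalerAr; apply: dvdp_mul => //.
rewrite dvdp_XsubCl; move: qz; rewrite qE rmorphM rootM /= => /orP [//|].
rewrite rmorphXn /= rmorphB /= map_polyX map_polyC /= rmorph0 subr0 rootE.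
rewrite horner_exp hornerX expf_eq0 => /andP [_ /eqP z1].
by move: z0; rewrite hornerXsubC z1 subr0 eqxx.
Qed.

Lemma ideal_quotient_field (R : comNzRingType) (N : R -> Prop) :
    N 0 -> (forall x y, N x -> N y -> N (x + y)) ->
    (forall x y, N y -> N (x * y)) -> ~ N 1 ->
    (forall x, ~ N x -> exists y, N (x * y - 1)) ->
  exists (Q : fieldType) (q : {rmorphism R -> Q}),
    (forall z, exists x, q x = z) /\ forall x, q x = 0 <-> N x.
Proof.
move=> N0 ND NM N1 NV; pose I : {pred R} := fun x => `[< N x >].
have I_ideal : idealr_closed I.
  split=> [||a x y /asboolP Nx /asboolP Ny]; first exact/asboolP.
    by apply/asboolPn.
  by apply/asboolP/ND => //; apply: NM.
pose J : idealr R := HB.pack_for (idealr R) I (isIdealr.Build R I I_ideal).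
pose Q0 := {ideal_quot J}.
pose q0 : {rmorphism R -> Q0} := (\pi_Q0)%qT.
have q0P x : q0 x = 0 <-> N x.
  have e : (x - 0 \in J) = (q0 x == q0 0) := Quotient.idealrBE J x 0.
  rewrite subr0 rmorph0 in e; split=> [/eqP|Nx]; first by rewrite -e => /asboolP.
  by apply/eqP; rewrite -e; apply/asboolP.
have q0_surj z : exists x, q0 x = z by exists (repr z); rewrite /q0 /= reprK.
have inv_ex (z : Q0) : exists y : Q0, (z != 0 -> y * z = 1) /\ (z = 0 -> y = 0).
  have [x <-] := q0_surj z; have [/q0P x0|Nx] := pselect (N x).
    by exists 0; split=> // /eqP.
  have [y Ny] := NV x Nx; exists (q0 y); split=> [_|/q0P //].
  by apply/eqP; rewrite -subr_eq0 -rmorphM -(rmorph1 q0) -rmorphB mulrC; apply/eqP/q0P.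
have [inv invP] := choice inv_ex.
have mulVq (z : Q0) : z != 0 -> inv z * z = 1 by case: (invP z).
have inv0 : inv 0 = 0 by case: (invP 0) => _; apply.
pose Q : fieldType := HB.pack_for fieldType Q0 (GRing.ComNzRing_isField.Build Q0 mulVq inv0).
by exists Q, (q0 : {rmorphism R -> Q}).
Qed.

Section GeometricRing.

Variables (p : nat) (K F : fieldType) (iota : {rmorphism K -> F}).
Variables (L : closedFieldType) (j : {rmorphism K -> L}).
Variables (T : comNzRingType) (f : {rmorphism F -> T}) (g : {rmorphism L -> T}).
Hypotheses (pK : p \in [pchar K]) (comm : forall a, f (iota a) = g (j a)).
Hypotheses (span : forall x, tensor_sub f g predT x) (alg : algebraic_closure j).
Variables (O : {pred F}) (v : F -> int) (dv : discrete_valuation v).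
Hypotheses (OE : forall x, (x \in O) = (x == 0) || (0 <= v x)).
Hypotheses (iotaO : forall a, iota a \in O).
Hypothesis pins : purely_inseparable_prime p iota O.
Variable pi : F.
Hypotheses (pi0 : pi != 0) (vpi : v pi = 1).

Let vv : valuation v := discrete_valuation_valuation dv.
Let pF : p \in [pchar F]. Proof. exact: rmorph_pchar pK. Qed.
Let pT : p \in [pchar T]. Proof. exact: rmorph_pchar pF. Qed.
Let p_gt0 := prime_gt0 (pcharf_prime pK).

Lemma valuation_ringP x : x \in O <-> val_ge v 0 x.
Proof. by rewrite OE; split=> [/orP [/eqP|]|[->|->]]; [left|right|rewrite eqxx|rewrite orbT]. Qed.

Lemma valuation_ring_subring : subring_pred (fun x => x \in O).
Proof.
have [B1 BB BM] := val_ge_subring vv.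
by split=> [|x y /valuation_ringP Ox /valuation_ringP Oy|x y /valuation_ringP Ox /valuation_ringP Oy]; apply/valuation_ringP; auto.
Qed.

Lemma max_idealP x : max_ideal O x <-> val_ge v 1 x.
Proof.
rewrite /max_ideal; have [->|x0] /= := eqVneq x 0.
  by split=> [_|_]; [left | rewrite OE eqxx].
rewrite !OE (negPf x0) invr_eq0 (negPf x0) /= valV // oppr_ge0 -ltNge.
split=> [/andP [_]|[/eqP|]]; rewrite ?(negPf x0) -?gtz0_ge1 //; first by right; rewrite -gtz0_ge1.
  by move=> vx; rewrite vx ltW.
Qed.

Lemma val_const a : a != 0 -> v (iota a) = 0.
Proof.
move=> a0; apply: (val_gt_unit vv); rewrite ?fmorph_eq0 //; first exact/valuation_ringP.
by apply/valuation_ringP; rewrite -fmorphV.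
Qed.

Lemma val_pi (k : int) : v (pi ^ k) = k.
Proof.
case: k => n; first by rewrite -exprnP valX // vpi natz.
by rewrite NegzE -exprnN valV ?expf_neq0 // valX // vpi natz.
Qed.

Local Notation Ob := (tensor_sub f g O).

Let sOb : subring_pred Ob. Proof. exact/tensor_sub_subring/valuation_ring_subring. Qed.

Let Obf a : a \in O -> Ob (f a). Proof. exact: tensor_sub_left. Qed.
Let Obg c : Ob (g c). Proof. exact/tensor_sub_right/(subring1 valuation_ring_subring). Qed.
Let piO : pi \in O. Proof. by rewrite OE vpi orbT. Qed.
Let Obpi n : Ob (f pi ^+ n).
Proof. by apply: (subringX sOb); apply: Obf. Qed.

Let fpiK : f pi^-1 * f pi = 1. Proof. by rewrite -rmorphM mulVf ?rmorph1. Qed.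

(** T is a localization of Ob: a power of pi clears the denominators of the
    finitely many elements of F in a tensor. *)
Lemma denominators x : exists k, Ob (f pi ^+ k * x).
Proof.
apply: (@tensor_sub_ind _ _ _ f g predT (fun x => exists k, Ob (f pi ^+ k * x))) (span x).
- by exists 0; rewrite mulr0; apply: tensor_sub0.
- move=> y z [k Oy] [l Oz]; exists (k + l)%N; rewrite mulrDr.
  apply: tensor_subD; last by rewrite exprD -mulrA; apply: (subringM sOb).
  by rewrite addnC exprD -mulrA; apply: (subringM sOb).
move=> a b _; exists `|v a|%N; rewrite mulrA -rmorphXn -rmorphM.
apply: tensor_sub_elt; apply/valuation_ringP; have [->|a0] := eqVneq a 0.
  by rewrite mulr0; left.
right; rewrite valM ?expf_neq0 // valX // vpi natz; move: (v a) => z; clear.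
by lia.
Qed.

(** Q divides a polynomial R over K with R(0) nonzero, and R(pi) is a unit of O. *)
Lemma horner_pi_unit (Q : {poly L}) : Q.[0] != 0 ->
  exists2 y, Ob y & (map_poly g Q).[f pi] * y = 1.
Proof.
move=> /(poly_dvd_base alg) [R R0 /dvdpP [S RQS]].
pose r := (map_poly iota R).[pi].
have OR (P : {poly F}) : coefs_in (fun x => x \in O) P -> P.[pi] \in O.
  by move=> OPc; apply: (subring_horner valuation_ring_subring).
have [r0 vr] : r != 0 /\ v r = 0.
  have [R1 RE] : exists R1, R = R1 * 'X + R.[0]%:P.
    have /factor_theorem [R1] : root (R - R.[0]%:P) 0.
      by rewrite rootE !hornerE subrr.
    by rewrite subr0 => e; exists R1; rewrite -e subrK.
  have rE : r = iota R.[0] + (map_poly iota R1).[pi] * pi.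
    by rewrite /r {1}RE rmorphD rmorphM /= map_polyX map_polyC !hornerE addrC.
  have i0 : iota R.[0] != 0 by rewrite fmorph_eq0.
  have /valuation_ringP : (map_poly iota R1).[pi] \in O by apply: OR => i; rewrite coef_map; apply: iotaO.
  have Wpi : val_ge v 1 pi by right; rewrite vpi.
  move=> /(val_geM vv) /(_ Wpi) W1; have [|s1 s2] := val_dominant (y := (map_poly iota R1).[pi] * pi) vv i0.
    by case: W1 => [->|W1]; [left | right; rewrite val_const].
  by rewrite rE s2 val_const.
exists ((map_poly g S).[f pi] * f r^-1).
  apply: (subringM sOb); last by apply: Obf; apply/valuation_ringP; right; rewrite valV // vr.
  by apply: (subring_horner sOb) => [i|]; [rewrite coef_map; apply: Obg | apply: Obf].
rewrite mulrA -hornerM [_ * map_poly g S]mulrC -rmorphM -RQS /= -map_poly_comp.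
have -> : map_poly (g \o j) R = map_poly f (map_poly iota R).
  by rewrite -map_poly_comp; apply: eq_map_poly => a /=; rewrite comm.
by rewrite horner_map /= -rmorphM mulfV ?rmorph1.
Qed.

(** For delta > 0 this is the integral closure of Ob, see
    [integral_closure_frob]. *)
Definition frob_closure x : Prop := exists n, Ob (x ^+ (p ^ n)).

Lemma frob_closureW x m n : (m <= n)%N -> Ob (x ^+ (p ^ m)) -> Ob (x ^+ (p ^ n)).
Proof.
move=> /subnKC <- Ox; rewrite expnD exprM; exact: (subringX sOb).
Qed.

Lemma frob_closure_subring : subring_pred frob_closure.
Proof.
split=> [|x y [m Ox] [n Oy]|x y [m Ox] [n Oy]].
- by exists 0; rewrite expr1n; apply: (subring1 sOb).
- exists (maxn m n); rewrite (exprp_sub pT); apply: (subringB sOb).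
    by apply: frob_closureW Ox; rewrite leq_maxl.
  by apply: frob_closureW Oy; rewrite leq_maxr.
exists (maxn m n); rewrite exprMn; apply: (subringM sOb).
  by apply: frob_closureW Ox; rewrite leq_maxl.
by apply: frob_closureW Oy; rewrite leq_maxr.
Qed.

Lemma frob_closure_base x : Ob x -> frob_closure x.
Proof. by exists 0; rewrite expr1. Qed.

(** Modulo Ob the delta + 1 elements pi^i b are linearly dependent over L. The
    lowest term of a relation is pi^i b times a polynomial in pi with nonzero
    constant term, which is a unit of Ob. *)
Lemma conductor (B : T -> Prop) delta : has_codim g Ob B delta ->
  (forall b, frob_closure b -> B b) ->
  forall b, frob_closure b -> Ob (f pi ^+ delta * b).
Proof.
case=> d [_ d_basis] BB b Bb.
have Bpi (i : 'I_delta.+1) : B (f pi ^+ i * b).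
  by apply/BB/(subringM frob_closure_subring) => //; apply: frob_closure_base.
have [c cP] := choice (fun i => d_basis _ (Bpi i)).
pose M := \matrix_i c i; pose u := nz_row (kermx M).
have u0 : u != 0.
  rewrite nz_row_eq0 kermx_eq0 /row_free neq_ltn.
  by rewrite (leq_ltn_trans (rank_leq_col M)).
have uM : u *m M = 0 by apply/eqP; rewrite -sub_kermx nz_row_sub.
have sO : subspace g Ob by apply: tensor_sub_subspace.
have Ou : Ob (\sum_(i < delta.+1) g (u 0 i) * (f pi ^+ i * b)).
  have -> : \sum_i g (u 0 i) * (f pi ^+ i * b) =
      \sum_i g (u 0 i) * (f pi ^+ i * b - \sum_k g (c i 0 k) * d k).
    under [RHS]eq_bigr do rewrite mulrBr mulr_sumr.
    rewrite sumrB [X in _ - X](_ : _ = 0) ?subr0 // exchange_big /= big1 // => k _.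
    transitivity (g ((u *m M) 0 k) * d k); last by rewrite uM mxE rmorph0 mul0r.
    rewrite mxE rmorph_sum mulr_suml; apply: eq_bigr => i _.
    by rewrite [M i k]mxE rmorphM mulrA.
  apply: (subspace_sum (g := g)) => // i _; apply: subspaceZ => //.
  by case: (cP i).
have P0 : rVpoly u != 0.
  by apply: contra_neq u0 => u_eq0; rewrite -[u]rVpolyK u_eq0 raddf0.
have [m [Q Q0 PE]] := multiplicity_XsubC (rVpoly u) 0.
rewrite subr0 in PE; have {Q0} : Q.[0] != 0 by apply: implyP Q0 P0.
have le_m : (m <= delta)%N.
  rewrite -ltnS -(size_polyXn L m); apply: leq_trans (size_poly _ _ : size (rVpoly u) <= _)%N.
  by apply: dvdp_leq => //; rewrite PE dvdp_mull.
move=> /horner_pi_unit [y Oy Qy].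
have Qb : \sum_(i < delta.+1) g (u 0 i) * (f pi ^+ i * b) =
    (map_poly g Q).[f pi] * (f pi ^+ m * b).
  transitivity ((map_poly g (rVpoly u)).[f pi] * b).
    rewrite (horner_coef_wide (n := delta.+1)); last first.
      exact: leq_trans (size_poly _ _) (size_poly _ _).
    rewrite mulr_suml; apply: eq_bigr => i _.
    by rewrite coef_map coef_rVpoly_ord mulrA.
  by rewrite PE rmorphM rmorphXn /= map_polyX hornerM hornerXn mulrA.
have Om : Ob (f pi ^+ m * b).
  rewrite -[_ * b]mul1r -Qy [_ * y]mulrC -mulrA -Qb.
  exact: (subringM sOb).
by rewrite -(subnK le_m) exprD -mulrA; apply: (subringM sOb).
Qed.

(** The intersection of the pi^k Ob; the quotient by it is the geometric
    function field. *)
Definition infinitely_small x : Prop := forall k, Ob (f pi^-1 ^+ k * x).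

Lemma infinitely_small_base x : infinitely_small x -> Ob x.
Proof. by move=> /(_ 0%N); rewrite mul1r. Qed.

Lemma infinitely_small0 : infinitely_small 0.
Proof. by move=> k; rewrite mulr0; apply: (subring0 sOb). Qed.

Lemma infinitely_smallD x y :
  infinitely_small x -> infinitely_small y -> infinitely_small (x + y).
Proof. by move=> Nx Ny k; rewrite mulrDr; apply: (subringD sOb). Qed.

Lemma infinitely_smallM x y : infinitely_small y -> infinitely_small (x * y).
Proof.
move=> Ny k; have [l Ox] := denominators x.
have unit_l : f pi^-1 ^+ l * f pi ^+ l = 1 by rewrite -exprMn fpiK expr1n.
have -> : f pi^-1 ^+ k * (x * y) = (f pi ^+ l * x) * (f pi^-1 ^+ (k + l) * y).
  transitivity (f pi^-1 ^+ k * (x * y) * (f pi^-1 ^+ l * f pi ^+ l)).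
    by rewrite unit_l mulr1.
  by rewrite exprD; ring.
exact: (subringM sOb).
Qed.

(** If x^p is divisible by all powers of pi then all x / pi^l are in the Frobenius
    closure of Ob, which pi^delta maps into Ob. *)
Lemma infinitely_small_radical (B : T -> Prop) delta : has_codim g Ob B delta ->
    (forall b, frob_closure b -> B b) ->
  forall x, infinitely_small (x ^+ p) -> infinitely_small x.
Proof.
move=> codB BB x Nx k.
have : frob_closure (f pi^-1 ^+ (k + delta) * x).
  by exists 1; rewrite expn1 exprMn -exprM; apply: Nx.
move=> /(conductor codB BB); rewrite mulrA exprD mulrCA -exprMn.
by rewrite [f pi * _]mulrC fpiK expr1n mulr1.
Qed.

(** Elements whose leading coefficient with respect to pi is a nonzero constant;
    they are not divisible by pi in Ob unless pi is a unit of Ob. *)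
Definition principal_unit u : Prop :=
  exists c r, [/\ c != 0, Ob r & u = g c + f pi * r].

Lemma principal_unitW u : principal_unit u -> Ob u.
Proof.
by case=> c [r [_ Or ->]]; apply: (subringD sOb) => //; apply: (subringM sOb) => //; apply: Obf.
Qed.

Lemma principal_unitM u w :
  principal_unit u -> principal_unit w -> principal_unit (u * w).
Proof.
case=> c [r [c0 Or ->]] [d [t [d0 Ot ->]]].
exists (c * d), (g c * t + r * g d + f pi * r * t); split.
- by rewrite mulf_neq0.
- have Opi := Obf piO.
  by do !apply: (subringD sOb); do !apply: (subringM sOb).
by rewrite rmorphM; ring.
Qed.

Lemma principal_unit1 : principal_unit 1.
Proof.
exists 1, 0; rewrite oner_eq0 mulr0 addr0 rmorph1; split=> //.
exact: (subring0 sOb).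
Qed.

Lemma principal_unitX u n : principal_unit u -> principal_unit (u ^+ n).
Proof.
move=> Uu; elim: n => [|n IHn]; first by rewrite expr0; apply: principal_unit1.
by rewrite exprS; apply: principal_unitM.
Qed.

(** Take n and a representation x^(p^n) = sum_i f(a_i) g(b_i) with the fewest
    terms. The p^m-th powers of the b_i stay independent over K, or the p^m-th
    power of the representation could be shortened. After division by a power
    of pi all a_i are in O and one of them is a unit; for large m the a_i^(p^m)
    are congruent to constants k_i, not all zero, modulo pi, whence the value
    c = sum_i k_i b_i^(p^m), which is not zero. *)
Lemma frob_power_normal_form x : (forall n, x ^+ (p ^ n) != 0) ->
  exists n (k : int) u, principal_unit u /\ x ^+ (p ^ n) = f (pi ^ k) * u.
Proof.
move=> x_nil.
pose rep r := exists n (a : 'I_r -> F) b, x ^+ (p ^ n) = \sum_(i < r) f (a i) * g (b i).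
have ex_r : exists r, `[< rep r >].
  have [r [a [b [_ xE]]]] := span x.
  by exists r; apply/asboolP; exists 0, a, b; rewrite expr1.
case: (ex_minnP ex_r) => r /asboolP [n [a [b xE]]] min_r.
have [i1 ai1] : exists i, a i != 0.
  apply/existsP; apply: contraNT (x_nil n) => /existsPn a0; rewrite xE big1 // => i _.
  by have := a0 i; rewrite negbK => /eqP ->; rewrite rmorph0 mul0r.
case: (@Order.TotalTheory.arg_minP _ _ _ i1 (fun i => a i != 0) (fun i => v (a i)) ai1).
move=> i0 ai0 min_i0; pose k := v (a i0); pose a' i := pi ^ (- k) * a i.
have pik0 l : pi ^ l != 0 by rewrite expfz_neq0.
have a'E i : a i = pi ^ k * a' i.
  by rewrite mulrA -expfzDr // subrr mul1r.
have Oa' i : a' i \in O.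
  apply/valuation_ringP; have [ai|ai] := eqVneq (a i) 0; first by left; rewrite /a' ai mulr0.
  by right; rewrite valM // val_pi addrC subr_ge0 min_i0.
have [e eP] := choice (fun i => pins (Oa' i)).
pose m := \sum_i e i.
have /choice [c cP] : forall i, exists c, max_ideal O (a' i ^+ (p ^ m) - iota c).
  move=> i; have [c0 c0P] := eP i; exists (c0 ^+ (p ^ (m - e i))).
  have le_em : (e i <= m)%N by rewrite /m (bigD1 i) //= leq_addr.
  rewrite -{1}(subnKC le_em) expnD exprM rmorphXn -(exprp_sub pF).
  apply/max_idealP; move/max_idealP: c0P => /(val_geX vv (p ^ (m - e i))).
  by apply: val_geW; rewrite ler1n expn_gt0 p_gt0.
have ci0 : c i0 != 0.
  apply: contraPneq (cP i0) => ->; rewrite rmorph0 subr0 => /max_idealP.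
  have a'0 : a' i0 != 0 by rewrite mulf_neq0.
  move/(val_geP _ _ (expf_neq0 _ a'0)); rewrite valX // valM // val_pi addNr.
  by rewrite mul0rn.
pose d := \sum_i j (c i) * b i ^+ (p ^ m).
have xmE : x ^+ (p ^ (n + m)) = \sum_i f (a i ^+ (p ^ m)) * g (b i ^+ (p ^ m)).
  rewrite expnD exprM xE (exprp_sum pT); apply: eq_bigr => i _.
  by rewrite exprMn !rmorphXn.
have [d0|d0] := eqVneq d 0.
  have r_gt0 := leq_ltn_trans (leq0n i0) (ltn_ord i0).
  suff /asboolP /min_r : rep r.-1 by rewrite leqNgt prednK // leqnn.
  exists (n + m)%N, (fun i => a (lift i0 i) ^+ (p ^ m) -
                   a i0 ^+ (p ^ m) * iota (c (lift i0 i) / c i0)).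
  exists (fun i => b (lift i0 i) ^+ (p ^ m)).
  rewrite xmE (bigD1_ord i0) //=.
  have bi0 : b i0 ^+ (p ^ m) =
      - \sum_(i < r.-1) j (c (lift i0 i) / c i0) * b (lift i0 i) ^+ (p ^ m).
    have jci0 : j (c i0) != 0 by rewrite fmorph_eq0.
    apply: (mulfI jci0); apply/eqP; rewrite -subr_eq0 mulrN opprK -[X in _ == X]d0.
    rewrite /d (bigD1_ord i0) //= mulr_sumr; apply/eqP; congr (_ + _).
    by apply: eq_bigr => i _; rewrite mulrA -rmorphM mulrCA mulfV // mulr1.
  rewrite bi0 rmorphN mulrN rmorph_sum mulr_sumr addrC -sumrB.
  apply: eq_bigr => i _.
  rewrite rmorphB [f (_ * iota _)]rmorphM comm [g (j _ * _)]rmorphM /=; ring.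
exists (n + m)%N, (k * (p ^ m)%N%:Z).
have /choice [u uP] : forall i, exists u, u \in O /\ a' i ^+ (p ^ m) = iota (c i) + pi * u.
  move=> i; exists (pi^-1 * (a' i ^+ (p ^ m) - iota (c i))).
  split; last by rewrite mulVKf // addrC subrK.
  have Wpi : val_ge v (-1) pi^-1 by right; rewrite valV // vpi.
  by apply/valuation_ringP; have /max_idealP /(val_geM vv Wpi) := cP i; rewrite addNr.
exists (g d + f pi * \sum_i f (u i) * g (b i ^+ (p ^ m))); split.
  exists d, (\sum_i f (u i) * g (b i ^+ (p ^ m))); split=> //.
  by apply: tensor_sub_sum => i _; apply: tensor_sub_elt; case: (uP i).
rewrite xmE mulrDr !(mulr_sumr, rmorph_sum) /= -big_split; apply: eq_bigr => i _ /=.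
have [_ a'i] := uP i; rewrite a'E exprMn a'i rmorphM mulrDr rmorphD rmorphM.
rewrite -exprz_exp -[(pi ^ k) ^ _]/((pi ^ k) ^+ (p ^ m)) comm !(rmorphM f); ring.
Qed.

Lemma frob_closure_integral x : frob_closure x -> integral_closure Ob x.
Proof.
case=> n Ox; exists ('X^(p ^ n) - (x ^+ (p ^ n))%:P); split.
- by rewrite monicXnsubC // expn_gt0 p_gt0.
- apply: (subringB (coefs_in_subring sOb)); last exact: coefs_inC.
  by apply: (subringX (coefs_in_subring sOb)); apply: coefs_inX.
by rewrite rootE hornerD hornerN hornerC hornerXn subrr.
Qed.

Section NormalFormConsequences.

Hypothesis radical : forall x, infinitely_small (x ^+ p) -> infinitely_small x.
Hypothesis pi_not_unit : ~ Ob (f pi^-1).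

Lemma pi_multiple_cancel x : infinitely_small x -> exists2 y, Ob y & x = f pi * y.
Proof.
move=> /(_ 1%N); rewrite expr1 => Ox; exists (f pi^-1 * x) => //.
by rewrite mulrA [f pi * _]mulrC fpiK mul1r.
Qed.

Lemma principal_unit_not_multiple u y : principal_unit u -> Ob y -> u <> f pi * y.
Proof.
case=> c [r [c0 Or ->]] Oy e; apply: pi_not_unit.
have -> : f pi^-1 = (y - r) * g c^-1.
  have gc : g c = f pi * (y - r) by rewrite mulrBr -e addrK.
  rewrite -[LHS]mulr1 -(rmorph1 g) -(mulfV c0) rmorphM gc !mulrA fpiK mul1r.
  by [].
by apply: (subringM sOb) => //; apply: (subringB sOb).
Qed.

Lemma principal_unit_big (k : int) u : principal_unit u -> ~ infinitely_small (f (pi ^ k) * u).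
Proof.
move=> Uu Nu; have : infinitely_small u.
  rewrite -[u]mul1r -(rmorph1 f) -(mulVf (_ : pi ^ k != 0)) ?expfz_neq0 //.
  by rewrite rmorphM -mulrA; apply: infinitely_smallM.
by case/pi_multiple_cancel => y Oy /(principal_unit_not_multiple Uu Oy).
Qed.

Lemma frob_power_big x n : ~ infinitely_small x -> ~ infinitely_small (x ^+ (p ^ n)).
Proof.
move=> Nx; elim: n => [|n IHn]; first by rewrite expr1.
by rewrite expnSr exprM => /radical.
Qed.

Lemma normal_form x : ~ infinitely_small x ->
  exists n (k : int) u, principal_unit u /\ x ^+ (p ^ n) = f (pi ^ k) * u.
Proof.
move=> Nx; apply: frob_power_normal_form => n.
by apply: contra_not_neq (frob_power_big (n := n) Nx) => ->; apply: infinitely_small0.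
Qed.

Lemma normal_form_lift x n m (k : int) u : (n <= m)%N -> principal_unit u ->
    x ^+ (p ^ n) = f (pi ^ k) * u ->
  exists2 w, principal_unit w & x ^+ (p ^ m) = f (pi ^ (k * (p ^ (m - n))%N%:Z)) * w.
Proof.
move=> le_nm Uu xE; exists (u ^+ (p ^ (m - n))); first exact: principal_unitX.
by rewrite -{1}(subnKC le_nm) expnD exprM xE exprMn -rmorphXn -exprz_exp.
Qed.

(** Otherwise a p^n-th power of x y is a power of pi times a principal unit. *)
Lemma infinitely_small_prime x y :
  infinitely_small (x * y) -> infinitely_small x \/ infinitely_small y.
Proof.
move=> Nxy; have [|Nx] := pselect (infinitely_small x); first by left.
have [|Ny] := pselect (infinitely_small y); first by right.
have [n [k [u [Uu xE]]]] := normal_form Nx.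
have [m [l [w [Uw yE]]]] := normal_form Ny.
have [u' Uu' {}xE] := normal_form_lift (leq_maxl n m) Uu xE.
have [w' Uw' {}yE] := normal_form_lift (leq_maxr n m) Uw yE.
have : infinitely_small ((x * y) ^+ (p ^ (maxn n m))).
  have : (0 < p ^ maxn n m)%N by rewrite expn_gt0 p_gt0.
  by case: (p ^ _)%N => // q _; rewrite exprSr; apply: infinitely_smallM.
rewrite exprMn xE yE mulrACA -rmorphM -expfzDr // => Nz; exfalso.
by apply: principal_unit_big Nz; apply: principal_unitM.
Qed.

Lemma integral_over_F x : integralOver f x.
Proof.
apply: (@tensor_sub_ind _ _ _ f g predT (integralOver f)) (span x).
- exact: integral0.
- exact: integral_add.
move=> a b _; apply: integral_mul; first exact: integral_id.
have /integral_algebraic [q q_mon qb] := alg b.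
exists (map_poly iota q); first exact: monic_map.
have -> : map_poly f (map_poly iota q) = map_poly g (map_poly j q).
  by rewrite -!map_poly_comp; apply: eq_map_poly => a' /=; rewrite comm.
by rewrite rmorph_root.
Qed.

(** Modulo the infinitely small elements T is a domain which is algebraic over
    the field F, hence a field. *)
Lemma invertible_mod_small x : ~ infinitely_small x ->
  exists y, infinitely_small (x * y - 1).
Proof.
move=> Nx; have [q q_mon qx] := integral_over_F x.
have [n [q1 q10 qE]] := multiplicity_XsubC q 0.
have {q10} c0 : q1.[0] != 0 by apply: implyP q10 (monic_neq0 q_mon).
have Nq1 : infinitely_small (map_poly f q1).[x].
  have : infinitely_small (map_poly f q).[x] by rewrite (rootP qx); apply: infinitely_small0.
  rewrite qE subr0 rmorphM rmorphXn /= map_polyX hornerM hornerXn.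
  elim: n {qE} => [|n IHn]; first by rewrite mulr1.
  by rewrite exprSr mulrA => /infinitely_small_prime [].
have /factor_theorem [q2 q2E] : root (q1 - q1.[0]%:P) 0.
  by rewrite rootE !hornerE subrr.
exists (- (map_poly f q2).[x] * f q1.[0]^-1).
have fc : f q1.[0] * f q1.[0]^-1 = 1 by rewrite -rmorphM mulfV ?rmorph1.
have q1x : (map_poly f q1).[x] = (map_poly f q2).[x] * x + f q1.[0].
  rewrite -{1}[q1](subrK q1.[0]%:P) q2E subr0 rmorphD rmorphM /= map_polyX.
  by rewrite map_polyC !hornerE.
have -> : x * (- (map_poly f q2).[x] * f q1.[0]^-1) - 1 =
    - f q1.[0]^-1 * (map_poly f q1).[x].
  by rewrite q1x -{1}fc; ring.
exact: infinitely_smallM.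
Qed.

(** If x^(p^n) = pi^(-l) u with l > 0, an integral equation of x over Ob, raised
    to the p^n-th power and multiplied by a power of pi^l, puts a power of u
    into pi Ob. *)
Lemma integral_closure_frob x : integral_closure Ob x <-> frob_closure x.
Proof.
split=> [[q [q_mon Oq qx]]|]; last exact: frob_closure_integral.
have [Nx|Nx] := pselect (infinitely_small x).
  exact/frob_closure_base/infinitely_small_base.
have [n [k [u [Uu xE]]]] := normal_form Nx; case: k xE => [k|l] xE.
  exists n; rewrite xE -exprnP rmorphXn; apply: (subringM sOb) => //.
  exact: principal_unitW.
exfalso; pose d := (size q).-1; pose y := x ^+ (p ^ n).
have q_size : size q = d.+1 by rewrite prednK // size_poly_gt0 monic_neq0.
have sum0 : \sum_(i < d.+1) q`_i ^+ (p ^ n) * y ^+ i = 0.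
  transitivity (q.[x] ^+ (p ^ n)).
    rewrite horner_coef q_size (exprp_sum pT); apply: eq_bigr => i _.
    by rewrite exprMn -!exprM mulnC.
  by rewrite (rootP qx) expr0n expn_eq0 gtn_eqF.
have yu : f pi ^+ l.+1 * y = u.
  by rewrite /y xE NegzE -rmorphXn mulrA -rmorphM -exprnN mulfV ?expf_neq0 // rmorph1 mul1r.
have {}sum0 : u ^+ d + \sum_(i < d) q`_i ^+ (p ^ n) * u ^+ i * (f pi ^+ l.+1) ^+ (d - i) = 0.
  transitivity ((f pi ^+ l.+1) ^+ d * \sum_(i < d.+1) q`_i ^+ (p ^ n) * y ^+ i).
    rewrite big_ord_recr /= mulrDr addrC; congr (_ + _).
      rewrite mulr_sumr; apply: eq_bigr => i _.
      have -> : (f pi ^+ l.+1) ^+ d = (f pi ^+ l.+1) ^+ (d - i) * (f pi ^+ l.+1) ^+ i.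
        by rewrite -exprD subnK // ltnW.
      by rewrite -yu [(_ * y) ^+ i]exprMn; ring.
    have -> : q`_d = 1 by move: q_mon; rewrite monicE /lead_coef -/d => /eqP.
    by rewrite expr1n mul1r -exprMn yu.
  by rewrite sum0 mulr0.
apply: (@principal_unit_not_multiple (u ^+ d)
    (- \sum_(i < d) q`_i ^+ (p ^ n) * u ^+ i * (f pi ^+ (l.+1 * (d - i)).-1))).
- exact: principal_unitX.
- apply: (subringN sOb); apply: subring_sum => // i _; apply: (subringM sOb) => //.
  by apply: (subringM sOb); apply: (subringX sOb) => //; apply: principal_unitW.
apply/eqP; rewrite mulrN -addr_eq0 -[X in _ == X]sum0 mulr_sumr; apply/eqP; congr (_ + _).
apply: eq_bigr => i _; rewrite mulrCA -exprS prednK -?exprM //.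
by rewrite muln_gt0 /= subn_gt0.
Qed.

End NormalFormConsequences.

(** If 1 / pi is in Ob then Ob is all of T and has codimension 0. *)
Lemma pi_not_unit_of_codim (B : T -> Prop) delta :
  has_codim g Ob B delta -> B 0 -> (0 < delta)%N -> ~ Ob (f pi^-1).
Proof.
case: delta => // n [b [_ b_basis]] B0 _ Opi.
have Oall x : Ob x.
  have [k Ox] := denominators x.
  have -> : x = f pi^-1 ^+ k * (f pi ^+ k * x).
    by rewrite mulrA -exprMn fpiK expr1n mul1r.
  by apply: (subringM sOb) => //; apply: (subringX sOb).
have [c [_ c_uniq]] := b_basis _ B0.
have /rowP /(_ 0) : 0 = const_mx 1 :> 'rV[L]_n.+1.
  by rewrite -(c_uniq 0) // -(c_uniq (const_mx 1)).
by rewrite !mxE => /eqP; rewrite eq_sym oner_eq0.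
Qed.

(** T is divided by the infinitely small elements; these lie in Ob, so that
    codimensions above Ob do not change. *)
Lemma geometric_quotient_field delta :
    has_codim g Ob (integral_closure Ob) delta -> (0 < delta)%N ->
  exists (Q : fieldType) (q : {rmorphism T -> Q}),
    [/\ forall x, tensor_sub (q \o f) (q \o g) predT x,
        ~ tensor_sub (q \o f) (q \o g) O (q (f pi^-1))
      & has_codim (q \o g) (tensor_sub (q \o f) (q \o g) O)
          (fun x => exists n, tensor_sub (q \o f) (q \o g) O (x ^+ (p ^ n))) delta].
Proof.
move=> codB delta_gt0.
have B0 : integral_closure Ob 0.
  by apply/frob_closure_integral/frob_closure_base/(subring0 sOb).
have pi_not_unit := pi_not_unit_of_codim codB B0 delta_gt0.
have radical := infinitely_small_radical codB frob_closure_integral.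
have [|Q [q [q_surj q0]]] := ideal_quotient_field infinitely_small0
  infinitely_smallD infinitely_smallM _ (invertible_mod_small radical pi_not_unit).
  by move=> /(_ 1%N); rewrite expr1 mulr1.
have tensor_q (O' : {pred F}) x : tensor_sub f g O' x -> tensor_sub (q \o f) (q \o g) O' (q x).
  case=> n [a [b [Oa ->]]]; exists n, a, b; split=> //.
  by rewrite rmorph_sum; apply: eq_bigr => i _; rewrite rmorphM.
have Obq x : tensor_sub (q \o f) (q \o g) O (q x) <-> Ob x.
  split=> [[n [a [b [Oa qxE]]]]|]; last exact: tensor_q.
  rewrite -[x](subrK (\sum_(i < n) f (a i) * g (b i))); apply: (subringD sOb); last first.
    by exists n, a, b.
  apply/infinitely_small_base/q0; rewrite rmorphB qxE rmorph_sum; apply/eqP.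
  by rewrite subr_eq0; apply/eqP/eq_bigr => i _; rewrite rmorphM.
exists Q, q; split=> [z||].
- by have [x <-] := q_surj z; apply/tensor_q/span.
- by move/Obq.
have [b [Bb b_basis]] := codB.
have lincomb_q n (c : 'rV[L]_n) (d : 'I_n -> T) z : q z - \sum_i (q \o g) (c 0 i) * q (d i) =
    q (z - \sum_i g (c 0 i) * d i).
  by rewrite rmorphB rmorph_sum; congr (_ - _); apply: eq_bigr => i _; rewrite rmorphM.
exists (q \o b); split=> [i|z [n]].
  have [n On] := (integral_closure_frob radical pi_not_unit _).1 (Bb i).
  by exists n; rewrite /= -rmorphXn; apply/Obq.
have [x <-] := q_surj z; rewrite -rmorphXn => /Obq Ox.
have Bx : integral_closure Ob x by apply: frob_closure_integral; exists n.
have [c [Oc c_uniq]] := b_basis _ Bx; exists c; split=> [|d].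
  by rewrite lincomb_q; apply/Obq.
by rewrite lincomb_q => /Obq; apply: c_uniq.
Qed.

End GeometricRing.

(** * The valuation of the geometric function field *)

Section GeometricField.

Variables (p : nat) (K F : fieldType) (iota : {rmorphism K -> F}).
Variables (L : closedFieldType) (j : {rmorphism K -> L}).
Variables (T : fieldType) (f : {rmorphism F -> T}) (g : {rmorphism L -> T}).
Hypotheses (pK : p \in [pchar K]) (comm : forall a, f (iota a) = g (j a)).
Hypotheses (span : forall x, tensor_sub f g predT x) (alg : algebraic_closure j).
Variables (O : {pred F}) (v : F -> int) (dv : discrete_valuation v).
Hypotheses (OE : forall x, (x \in O) = (x == 0) || (0 <= v x)).
Hypotheses (iotaO : forall a, iota a \in O).
Hypothesis pins : purely_inseparable_prime p iota O.
Variable pi : F.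
Hypotheses (pi0 : pi != 0) (vpi : v pi = 1).

Local Notation Ob := (tensor_sub f g O).
Local Notation frob_closed := (frob_closure p f g O).
Local Notation Punit := (principal_unit f g O pi).

Hypothesis pi_not_unit : ~ Ob (f pi^-1).

Let vv : valuation v := discrete_valuation_valuation dv.
Let pF : p \in [pchar F]. Proof. exact: rmorph_pchar pK. Qed.
Let pT : p \in [pchar T]. Proof. exact: rmorph_pchar pF. Qed.
Let p_pr := pcharf_prime pK.
Let p_gt0 := prime_gt0 p_pr.
Let sOb : subring_pred Ob. Proof. exact/tensor_sub_subring/(valuation_ring_subring dv OE). Qed.
Let pik0 (k : int) : pi ^ k != 0. Proof. by rewrite expfz_neq0. Qed.
Let pn_gt0 n : (0 < p ^ n)%N. Proof. by rewrite expn_gt0 p_gt0. Qed.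
Let pn0 n : (p ^ n)%N%:R != 0 :> rat. Proof. by rewrite pnatr_eq0 -lt0n. Qed.

Let normal x n (k : int) : Prop :=
  exists2 u, Punit u & x ^+ (p ^ n) = f (pi ^ k) * u.

(** Here no nonzero element is nilpotent. *)
Let normal_ex x : x != 0 -> exists n k, normal x n k.
Proof.
move=> x0; have [|n [k [u [Uu xE]]]] := frob_power_normal_form pK comm span dv OE pins pi0 vpi (x := x).
  by move=> n; rewrite expf_neq0.
by exists n, k, u.
Qed.

Let normal_lift x n m k : normal x n k -> normal x (n + m) (k * (p ^ m)%N%:Z).
Proof.
case=> u Uu xE; have [|w Uw wE] := normal_form_lift dv OE vpi (m := n + m) _ Uu xE.
  exact: leq_addr.
by exists w => //; rewrite wE addKn.
Qed.

(** If k > l, the principal unit w would be a multiple of pi in Ob. *)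
Let unit_le (k l : int) u w : Punit u -> Punit w ->
  f (pi ^ k) * u = f (pi ^ l) * w -> k <= l.
Proof.
move=> Uu Uw e; rewrite leNgt; apply/negP => lt_lk.
have [m kE] : exists m : nat, k = l + m.+1%:Z by exists (absz (k - l - 1)%R); lia.
have wE : w = f pi * (f pi ^+ m * u).
  apply: (mulfI (_ : f (pi ^ l) != 0)); first by rewrite fmorph_eq0.
  by rewrite -e kE expfzDr // rmorphM -[pi ^ m.+1%:Z]/(pi ^+ m.+1) rmorphXn exprS !mulrA.
apply: (principal_unit_not_multiple dv OE pi0 pi_not_unit Uw _ wE).
apply: (subringM sOb); last exact: (principal_unitW dv OE vpi Uu).
by apply/(subringX sOb)/tensor_sub_left; rewrite OE vpi orbT.
Qed.

Let normal_uniq x n m k l : normal x n k -> normal x m l ->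
  k%:~R / (p ^ n)%N%:R = l%:~R / (p ^ m)%N%:R :> rat.
Proof.
move=> /(normal_lift m) [u Uu xE] /(normal_lift n) [w Uw].
rewrite addnC xE => e; have kl : k * (p ^ m)%N%:Z = l * (p ^ n)%N%:Z.
  by apply/eqP; rewrite eq_le (unit_le Uu Uw e) (unit_le Uw Uu (esym e)).
apply/eqP; rewrite eqr_div //; apply/eqP.
by have /(congr1 (fun z : int => z%:~R : rat)) := kl; rewrite !intrM.
Qed.

Let small_eq0 x : infinitely_small f g O pi x -> x = 0.
Proof.
move=> Nx; apply/eqP/negPn/negP => x0; apply: pi_not_unit.
have := infinitely_smallM span dv OE pi0 vpi x^-1 Nx 1%N.
by rewrite mulVf // mulr1.
Qed.

(** If x^(p^n) = pi^k u then x has value k / p^n. *)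
Lemma rational_value : exists w : T -> rat,
  [/\ valuation w, forall x, val_ge w 0 x <-> frob_closed x,
      forall a, a != 0 -> w (f a) = (v a)%:~R, forall c, c != 0 -> w (g c) = 0
    & forall x, val_ge w 0 x -> exists c, x = g c \/ 0 < w (x - g c)].
Proof.
have /choice [w wP] : forall x, exists q : rat, x != 0 ->
    exists n k, normal x n k /\ q = k%:~R / (p ^ n)%N%:R.
  move=> x; have [->|x0] := eqVneq x 0; first by exists 0.
  by have [n [k nk]] := normal_ex x0; exists (k%:~R / (p ^ n)%N%:R) => _; exists n, k.
have wE x n k : x != 0 -> normal x n k -> w x = k%:~R / (p ^ n)%N%:R.
  by move=> x0 nk; have [m [l [ml ->]]] := wP x x0; apply: normal_uniq nk.
have wM x y : x != 0 -> y != 0 -> w (x * y) = w x + w y.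
  move=> x0 y0; have [n [k [nk ->]]] := wP x x0; have [m [l [ml ->]]] := wP y y0.
  have [u Uu xE] := normal_lift m nk; have [t Ut yE] := normal_lift n ml.
  rewrite addnC in yE; rewrite (@wE _ (n + m)%N (k * (p ^ m)%N%:Z + l * (p ^ n)%N%:Z)) ?mulf_neq0 //.
    by rewrite expnD natrM intrD !intrM; field; rewrite !pn0.
  exists (u * t); first exact: (principal_unitM dv OE vpi).
  by rewrite exprMn xE yE mulrACA -rmorphM expfzDr.
have w_ge0 x : val_ge w 0 x <-> frob_closed x.
  split=> [|[m Ox]].
    have [->|x0] := eqVneq x 0.
      by move=> _; apply/frob_closure_base/(subring0 sOb).
    move/(val_geP _ _ x0); have [n [k [[u Uu xE] ->]]] := wP x x0.
    rewrite ler_pdivlMr ?mul0r ?ltr0n // ler0z => k0; exists n; rewrite xE.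
    apply: (subringM sOb); last exact: (principal_unitW dv OE vpi Uu).
    by apply: tensor_sub_left; rewrite OE (val_pi dv pi0 vpi) k0 orbT.
  have [->|x0] := eqVneq x 0; [by left | right].
  have [n [k [nk ->]]] := wP x x0; rewrite ler_pdivlMr ?mul0r ?ltr0n // ler0z.
  rewrite leNgt; apply/negP => k_lt0; have [u Uu xE] := normal_lift m nk.
  have [l kE] : exists l : nat, k * (p ^ m)%N%:Z = - l.+1%:Z.
    have : k * (p ^ m)%N%:Z < 0 by rewrite pmulr_llt0 // ltz_nat.
    by move: (k * _) => z z0; exists (absz (z + 1)%R); lia.
  have Oxn : Ob (x ^+ (p ^ (n + m))).
    by apply: (frob_closureW dv OE) Ox; rewrite leq_addl.
  apply: (principal_unit_not_multiple dv OE pi0 pi_not_unit Uu (y := f pi ^+ l * x ^+ (p ^ (n + m)))).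
    by apply: (subringM sOb) => //; apply/(subringX sOb)/tensor_sub_left; rewrite OE vpi orbT.
  rewrite xE kE !mulrA -exprS -rmorphXn -rmorphM.
  by rewrite -[pi ^+ l.+1]/(pi ^ l.+1%:Z) -expfzDr // subrr rmorph1 mul1r.
have vw : valuation w.
  have sB := frob_closure_subring iota f g pK dv OE.
  apply: valuation_of_add1 => // z /w_ge0 Bz; apply/w_ge0.
  exact: (subringD sB (subring1 sB)).
have wV := valV vw.
have wX x n := @valX _ _ _ vw x n.
have U1 : Punit 1 := principal_unit1 f g dv OE pi.
have wpi : w (f pi) = 1.
  rewrite (@wE _ 0 1) ?fmorph_eq0 ?divr1 //; exists 1 => //.
  by rewrite expr1 mulr1.
have wO a : a \in O -> val_ge w 0 (f a).
  by move=> Oa; apply/w_ge0/frob_closure_base/tensor_sub_left.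
have wu a : a != 0 -> v a = 0 -> w (f a) = 0.
  move=> a0 va; apply: (val_gt_unit vw); first by rewrite fmorph_eq0.
    by apply: wO; rewrite OE va orbT.
  by rewrite -fmorphV; apply: wO; rewrite OE valV // va orbT.
have wpik (k : int) : w (f (pi ^ k)) = k%:~R.
  by rewrite fmorphXz (valXz vw) ?fmorph_eq0 // wpi.
have wf a : a != 0 -> w (f a) = (v a)%:~R.
  move=> a0; have b0 : (pi ^ v a)^-1 * a != 0 by rewrite mulf_neq0 ?invr_eq0.
  rewrite -[X in f X](mulVKf (pik0 (v a))) rmorphM wM ?fmorph_eq0 // wpik.
  by rewrite wu ?addr0 // valM ?invr_eq0 // valV // (val_pi dv pi0 vpi) addNr.
have wg c : c != 0 -> w (g c) = 0.
  move=> c0; have O1 : 1 \in O := subring1 (valuation_ring_subring dv OE).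
  apply: (val_gt_unit vw); rewrite ?fmorph_eq0 //; last rewrite -fmorphV;
    by apply/w_ge0/frob_closure_base/tensor_sub_right.
exists w; split=> // x Bx; have [->|x0] := eqVneq x 0.
  by exists 0; left; rewrite rmorph0.
move: Bx => /(val_geP _ _ x0); rewrite le_eqVlt => /orP [/eqP wx0|wx]; last first.
  by exists 0; right; rewrite rmorph0 subr0.
have [n [k [[u Uu xE] wxE]]] := wP x x0.
have k0 : k = 0.
  apply/eqP; move/eqP: wxE; rewrite -wx0 eq_sym mulf_eq0 invr_eq0 (negPf (pn0 n)) orbF.
  by rewrite intr_eq0.
case: Uu => c [r [c0 Or uE]]; have [d dE] := closed_field_root c (pn_gt0 n).
exists d; have [e|xd0] := eqVneq x (g d); [by left | right].
rewrite -subr_eq0 in xd0; have e : (x - g d) ^+ (p ^ n) = f pi * r.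
  by rewrite (exprp_sub pT) xE k0 expr0z rmorph1 mul1r uE -dE rmorphXn addrC addKr.
have r0 : r != 0.
  by apply: contraNneq (expf_neq0 (p ^ n) xd0) => r0; rewrite e r0 mulr0.
have : 0 < w ((x - g d) ^+ (p ^ n)).
  rewrite e wM ?fmorph_eq0 // wpi.
  have /(val_geP _ _ r0) : val_ge w 0 r by apply/w_ge0/frob_closure_base.
  by lra.
by rewrite wX // pmulrn_lgt0.
Qed.

(** If the value group lies in Z gamma, the least positive value generates it. *)
Lemma integral_value (w : T -> rat) (gamma : rat) : valuation w ->
    (forall a, a != 0 -> w (f a) = (v a)%:~R) ->
    (forall x, x != 0 -> exists z : int, w x = z%:~R * gamma) ->
  exists (W : T -> int) (e : rat), [/\ 0 < e, forall x, x != 0 -> w x = (W x)%:~R * e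
    & exists2 s, s != 0 & W s = 1].
Proof.
move=> vw wf w_gamma.
have wpi : w (f pi) = 1 by rewrite wf // vpi.
wlog gamma_gt0 : gamma w_gamma / 0 < gamma => [IH|].
  case: (ltrgtP gamma 0) => [gamma_lt0|gamma_gt0|gamma0].
  - apply: (IH (- gamma)); last by rewrite oppr_gt0.
    move=> x /w_gamma [z ->]; exists (- z).
    by rewrite rmorphN mulrNN.
  - exact: IH gamma_gt0.
  have [|z] := w_gamma (f pi); first by rewrite fmorph_eq0.
  by rewrite gamma0 mulr0 wpi => /eqP; rewrite oner_eq0.
have ex_m : exists m, `[< (0 < m)%N /\ exists2 x, x != 0 & w x = m%:R * gamma >].
  have [|z] := w_gamma (f pi); first by rewrite fmorph_eq0.
  rewrite wpi => z1; have z_gt0 : 0 < z.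
    by rewrite -(ltr0z rat) -(pmulr_lgt0 _ gamma_gt0) -z1.
  exists `|z|%N; apply/asboolP; split; first by rewrite absz_gt0 gt_eqF.
  by exists (f pi); rewrite ?fmorph_eq0 // wpi pmulrn gtz0_abs.
case: (ex_minnP ex_m) => m /asboolP [m_gt0 [s s0 ws]] min_m.
have m_gt0z : 0 < m%:Z by rewrite ltz_nat.
have wV := valV vw.
have w_m x : x != 0 -> exists z : int, w x = z%:~R * (m%:R * gamma).
  move=> x0; have [z wx] := w_gamma x x0; exists (z %/ m)%Z.
  have wsk (k : int) : w (s ^ k) = k%:~R * (m%:R * gamma).
    by rewrite (valXz vw) // ws mulrzl.
  have z_mod := divz_eq z m; have [r0|r0] := eqVneq (z %% m)%Z 0.
    by rewrite wx {1}z_mod r0 addr0 intrM mulrA -pmulrn.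
  have r_ge0 : 0 <= (z %% m)%Z by rewrite modz_ge0 // gt_eqF.
  have : `[< (0 < `|(z %% m)%Z|)%N /\ exists2 x, x != 0 & w x = `|(z %% m)%Z|%N%:R * gamma >].
    apply/asboolP; rewrite absz_gt0 r0; split=> //.
    exists (x * s ^ (- (z %/ m)%Z)); first by rewrite mulf_neq0 ?expfz_neq0.
    rewrite valM ?expfz_neq0 // wx wsk {1}z_mod.
    rewrite [_%:R in RHS]pmulrn gez0_abs // intrD intrM mulrDl rmorphN /=.
    by rewrite -pmulrn; ring.
  move=> /min_m; rewrite leqNgt => /negP []; rewrite -ltz_nat gez0_abs //.
  by rewrite ltz_pmod.
have mg_gt0 : 0 < m%:R * gamma by rewrite mulr_gt0 ?ltr0n.
have /choice [W WP] : forall x, exists z : int, x != 0 -> w x = z%:~R * (m%:R * gamma).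
  move=> x; have [->|x0] := eqVneq x 0; first by exists 0.
  by have [z wx] := w_m x x0; exists z.
exists W, (m%:R * gamma); split=> //; exists s => //.
have := WP s s0; rewrite ws -[X in X = _]mul1r => /(mulIf (lt0r_neq0 mg_gt0)) /esym/eqP.
by rewrite -[1]/(1%:~R) eqr_int => /eqP.
Qed.

(** The value group of w being cyclic, its normalization is a discrete valuation
    with ring of integers the Frobenius closure of Ob and residue field L. *)
Lemma geometric_valuation :
    (forall w : T -> rat, valuation w -> (forall c, c != 0 -> w (g c) = 0) ->
       exists gamma, forall x, x != 0 -> exists z : int, w x = z%:~R * gamma) ->
  exists W : T -> int, [/\ rational_valuation g W,
    forall x, val_ge W 0 x <-> frob_closed x
    & exists2 e, 0 < e & forall a, a != 0 -> W (f a) = e * v a].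
Proof.
move=> cyclic; have [w [vw w_ge0 wf wg w_res]] := rational_value.
have [gamma w_gamma] := cyclic w vw wg.
have [W [e [e_gt0 WE [s s0 Ws]]]] := integral_value vw wf w_gamma.
have W_ge x : val_ge W 0 x <-> val_ge w 0 x.
  have [->|x0] := eqVneq x 0; first by split; left.
  split=> /(val_geP _ _ x0) Wx; apply/val_geP => //.
    by rewrite WE // mulr_ge0 ?ler0z // ltW.
  by move: Wx; rewrite WE // pmulr_lge0 // ler0z.
have W_inj x (n : int) : x != 0 -> w x = n%:~R * e -> W x = n.
  move=> x0; rewrite WE // => /(mulIf (lt0r_neq0 e_gt0)) /eqP.
  by rewrite eqr_int => /eqP.
have WM x y : x != 0 -> y != 0 -> W (x * y) = W x + W y.
  move=> x0 y0; apply: W_inj; first by rewrite mulf_neq0.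
  by rewrite (valM vw) // intrD mulrDl -!WE.
exists W; split=> [||].
- split; last first.
  + move=> x /W_ge /w_res [c [->|wxc]]; exists c; first by left; rewrite subrr.
    have [xc0|xc0] := eqVneq (x - g c) 0; [by left | right].
    by move: wxc; rewrite WE // pmulr_lgt0 // ltr0z gtz0_ge1.
  + by move=> c c0; apply: W_inj; rewrite ?fmorph_eq0 // wg // mul0r.
  split=> // [x y x0 y0 xy0|n].
    have le_W u t : u != 0 -> t != 0 -> (w u <= w t) = (W u <= W t).
      by move=> u0 t0; rewrite !WE // ler_pM2r // ler_int.
    case: vw => _ /(_ x y x0 y0 xy0).
    case/orP: (le_total (W x) (W y)) => le_xy.
      by rewrite !min_l ?le_W.
    by rewrite !min_r ?le_W.
  exists (s ^ n); first by rewrite expfz_neq0.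
  by apply: W_inj; rewrite ?expfz_neq0 // (valXz vw) // WE // Ws mulr1z mul1r mulrzl.
- by move=> x; rewrite W_ge.
have fpi0 : f pi != 0 by rewrite fmorph_eq0.
have e_inv : (W (f pi))%:~R * e = 1 by rewrite -WE // wf // vpi.
exists (W (f pi)) => [|a a0].
  by rewrite -(ltr0z rat) -(pmulr_lgt0 _ e_gt0) e_inv.
apply: W_inj; first by rewrite fmorph_eq0.
by rewrite wf // intrM mulrAC e_inv mul1r.
Qed.

End GeometricField.

(** * Finite generation and the value group *)

Section Adjoin.

Variables (K F : fieldType) (iota : {rmorphism K -> F}).

Lemma adjoin_subfield s : subfield_pred (adjoin iota s).
Proof.
have A1 : adjoin iota s 1 by rewrite -(rmorph1 iota); apply: adjoin_const.
have AV x : adjoin iota s x -> adjoin iota s x^-1.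
  by move=> Ax; rewrite -[x^-1]mul1r; apply: adjoin_div.
split=> //; split=> // [x y|x y Ax Ay]; first exact: adjoin_sub.
by rewrite -[y]invrK; apply/adjoin_div/AV.
Qed.

Lemma adjoin_min (E : F -> Prop) s : subfield_pred E -> (forall a, E (iota a)) ->
  (forall x, x \in s -> E x) -> forall x, adjoin iota s x -> E x.
Proof.
move=> sE EK Es x; elim=> {x} [a|x xs|x y _ Ex _ Ey|x y _ Ex _ Ey] //; first exact: Es.
  exact: subringB (subfield_subring sE) _ _ Ex Ey.
exact: subfield_div.
Qed.

Lemma adjoin_one_frac t x : adjoin iota [:: t] x ->
  exists P Q : {poly K}, (map_poly iota Q).[t] != 0 /\
    x = (map_poly iota P).[t] / (map_poly iota Q).[t].
Proof.
elim=> {x} [a|x|x y _ [P [Q [Q0 ->]]] _ [R [S [S0 ->]]]|x y _ [P [Q [Q0 ->]]] _ [R [S [S0 ->]]]].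
- by exists a%:P, 1; rewrite rmorph1 map_polyC !hornerE oner_eq0 invr1 mulr1.
- rewrite inE => /eqP ->; exists 'X, 1.
  by rewrite rmorph1 map_polyX !hornerE oner_eq0 invr1 mulr1.
- exists (P * S - R * Q), (Q * S); rewrite rmorphB !rmorphM /= !hornerE mulf_neq0 //.
  by split=> //; field; rewrite Q0 S0.
have [R0|R0] := eqVneq (map_poly iota R).[t] 0.
  by exists 0, 1; rewrite R0 rmorph0 rmorph1 !hornerE oner_eq0 ?invr0 ?mulr0 ?mul0r.
exists (P * S), (Q * R); rewrite !rmorphM /= !hornerE mulf_neq0 //.
by split=> //; field; rewrite Q0 R0 S0.
Qed.

End Adjoin.

Section FiniteExtension.

Variables (F : fieldType) (E : F -> Prop) (sE : subfield_pred E).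
Let rE : subring_pred E := subfield_subring sE.

Definition spanned (R : F -> Prop) : Prop := exists (I : finType) (e : I -> F),
  forall x, R x -> exists2 c : I -> F, forall i, E (c i) & x = \sum_i c i * e i.

(** By the equation of x every power of x is an R-combination of the powers of
    x below its degree. *)
Lemma adjoin_algebraic_spanned (R : F -> Prop) x : subring_pred R ->
    (forall y, E y -> R y) -> spanned R -> algebraic_over_sub E x ->
  spanned (adjoin_one R x).
Proof.
move=> sR ER [I [e eR]] [q [q0 Eq qx]].
pose d := (size q).-1; pose D y := exists2 r : 'I_d -> F, forall i, R (r i) &
  y = \sum_i r i * x ^+ i.
have lead0 : q`_d != 0 by rewrite -/(lead_coef q) lead_coef_eq0.
have D0 : D 0.
  exists (fun=> 0) => [i|]; first exact: subring0.
  by rewrite big1 // => i _; rewrite mul0r.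
have DD y z : D y -> D z -> D (y + z).
  move=> [r Rr ->] [r' Rr' ->]; exists (fun i => r i + r' i) => [i|].
    exact: subringD.
  by rewrite -big_split; apply: eq_bigr => i _; rewrite mulrDl.
have DM a y : R a -> D y -> D (a * y).
  move=> Ra [r Rr ->]; exists (fun i => a * r i) => [i|]; first exact: subringM.
  by rewrite mulr_sumr; apply: eq_bigr => i _; rewrite mulrA.
have DX_lt i : (i < d)%N -> D (x ^+ i).
  move=> lt_id; exists (fun k => (k == Ordinal lt_id)%:R) => [k|].
    exact: subring_nat.
  rewrite (bigD1 (Ordinal lt_id)) //= eqxx mul1r big1 ?addr0 // => k /negPf ->.
  by rewrite mul0r.
have DX_d : D (x ^+ d).
  exists (fun i => - (q`_i / q`_d)) => [i|].
    by apply/(subringN sR)/ER/(subfield_div sE); apply: Eq.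
  have q_size : size q = d.+1 by rewrite prednK // size_poly_gt0.
  have := rootP qx; rewrite horner_coef q_size big_ord_recr /= => /eqP.
  rewrite addrC addr_eq0 => /eqP e1; apply: (mulfI lead0); rewrite e1 mulr_sumr -sumrN.
  by apply: eq_bigr => i _; rewrite mulNr mulrN mulrA mulrCA mulfV // mulr1.
have Dsum (J : finType) (u : J -> F) : (forall i, D (u i)) -> D (\sum_i u i).
  by move=> Du; apply: big_ind.
have DX i : D (x ^+ i).
  elim: i => [|i [r Rr IHi]].
    have [d_gt0|d_eq0] := ltnP 0 d; first exact: DX_lt.
    by have := DX_d; move: d_eq0; rewrite leqn0 => /eqP ->.
  rewrite exprSr IHi mulr_suml; apply: Dsum => k.
  rewrite -mulrA -exprSr; apply: DM => //.
  by have := ltn_ord k; rewrite leq_eqVlt => /orP [/eqP -> //|]; apply: DX_lt.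
exists (I * 'I_d)%type, (fun ik : I * 'I_d => e ik.1 * x ^+ ik.2) => y [P RP ->].
have [r Rr ->] : D P.[x].
  by rewrite horner_coef; apply: Dsum => i; apply: DM.
have /choice [c cP] : forall k, exists c : I -> F, (forall i, E (c i)) /\ r k = \sum_i c i * e i.
  by move=> k; have [c Ec rE'] := eR _ (Rr k); exists c.
exists (fun ik : I * 'I_d => c ik.2 ik.1) => [ik|]; first by case: (cP ik.2).
rewrite -(pair_bigA _ (fun i k => c k i * (e i * x ^+ k))) exchange_big /=.
apply: eq_bigr => k _; have [_ ->] := cP k.
by rewrite mulr_suml; apply: eq_bigr => i _; rewrite mulrA.
Qed.

(** Divide the equation of y by the largest possible power of X: the constant
    term c is nonzero, and c / y is a polynomial in y. *)
Lemma algebraic_inverse (R : F -> Prop) y : subring_pred R ->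
    (forall z, E z -> R z) -> algebraic_over_sub E y -> R y -> R y^-1.
Proof.
move=> sR ER [q [q0 Eq qy]] Ry; have [->|y0] := eqVneq y 0.
  by rewrite invr0; apply: subring0.
have [n [q1 q10 qE]] := multiplicity_XsubC q 0.
have {q10} c0 : q1.[0] != 0 by apply: implyP q10 q0.
have Eq1 i : E q1`_i.
  by have := Eq (i + n)%N; rewrite qE subr0 coefMXn ltnNge leq_addl /= addnK.
have q1y : q1.[y] = 0.
  move/rootP: qy; rewrite qE subr0 hornerM hornerXn => /eqP.
  by rewrite mulf_eq0 expf_eq0 (negPf y0) andbF orbF => /eqP.
have /factor_theorem [q2 q2E] : root (q1 - q1.[0]%:P) 0.
  by rewrite rootE !hornerE subrr.
have Rq2 : R q2.[y].
  apply: subring_horner => // i; apply: ER; have := Eq1 i.+1.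
  rewrite -[q1 in X in X -> _](subrK q1.[0]%:P) q2E subr0 coefD coefMX coefC /= addr0.
  by [].
have -> : y^-1 = - (q2.[y] / q1.[0]).
  have : (q1 - q1.[0]%:P).[y] = q2.[y] * y by rewrite q2E subr0 hornerM hornerX.
  rewrite hornerD hornerN hornerC q1y sub0r => e1.
  by apply: (mulfI y0); rewrite mulfV // mulrN mulrA [y * _]mulrC -e1 mulNr opprK mulfV.
apply: (subringN sR); apply: subringM => //; apply: ER.
by apply: (proj2 sE); rewrite horner_coef0.
Qed.

Lemma spanned_seq (s : seq F) : (forall x, algebraic_over_sub E x) ->
  exists R : F -> Prop, [/\ subring_pred R, forall y, E y -> R y,
    forall x, x \in s -> R x & spanned R].
Proof.
move=> algE; elim: s => [|x s [R [sR ER Rs fR]]].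
  exists E; split=> //; exists unit, (fun=> 1) => x Ex; exists (fun=> x) => //.
  by rewrite big_const card_unit /= addr0 mulr1.
exists (adjoin_one R x); split.
- exact: adjoin_one_subring.
- by move=> y Ey; apply/adjoin_one_base/ER.
- move=> y; rewrite inE => /orP [/eqP ->|/Rs]; first exact: adjoin_one_gen.
  exact: adjoin_one_base.
exact: adjoin_algebraic_spanned.
Qed.

End FiniteExtension.

(** The ring generated over E by finitely many algebraic elements is spanned by
    finitely many elements and is a field. *)
Lemma finitely_generated_spanned (K F : fieldType) (iota : {rmorphism K -> F})
    (E : F -> Prop) : finitely_generated iota -> subfield_pred E ->
    (forall a, E (iota a)) -> (forall x, algebraic_over_sub E x) ->
  spanned E (fun=> True).
Proof.
case=> s s_gen sE EK algE; have [R [sR ER Rs [I [e eR]]]] := spanned_seq sE s algE.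
exists I, e => x _; apply: eR; apply: adjoin_min (s_gen x) => //.
  by split=> // y; apply: (algebraic_inverse sE).
by move=> a; apply: ER.
Qed.

Section BoundedDegree.

(** Multiplication by x in a basis: the characteristic polynomial. *)
Lemma spanned_integral (T : fieldType) (M : T -> Prop) (n : nat) (e : 'I_n -> T) :
    subring_pred M ->
    (forall x, exists c : 'I_n -> T, (forall i, M (c i)) /\ x = \sum_i c i * e i) ->
  forall x, exists P : {poly T}, [/\ P \is monic, size P = n.+1, coefs_in M P & root P x].
Proof.
move=> sM e_span x.
have /choice [c cP] : forall i, exists c : 'I_n -> T,
    (forall k, M (c k)) /\ x * e i = \sum_k c k * e k by move=> i; apply: e_span.
pose B : 'M[T]_n := \matrix_(k, i) c i k.
exists (char_poly B); split.
- exact: char_poly_monic.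
- exact: size_char_poly.
- have sMX := coefs_in_subring sM.
  apply: (subring_sum sMX) => s _; apply: (subringM sMX).
    by apply: (subringX sMX); apply: (subringN sMX); apply: (subring1 sMX).
  apply: (subring_prod sMX) => i _; rewrite !mxE; apply: (subringB sMX).
    by case: (_ == _); [apply: coefs_inX | apply: (subring0 sMX)].
  by apply: coefs_inC => //; apply: (proj1 (cP _)).
rewrite -eigenvalue_root_char; apply/eigenvalueP; exists (\row_k e k).
  apply/rowP => i; rewrite !mxE; have [_ ->] := cP i.
  by apply: eq_bigr => k _; rewrite !mxE mulrC.
have [d [_ one]] := e_span 1; apply: contraTneq (oner_neq0 T) => /rowP e0.
by rewrite one big1 ?eqxx // => k _; have := e0 k; rewrite !mxE => ->; rewrite mulr0.
Qed.

(** Two terms of the equation of x must have the same value. *)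
Lemma value_of_algebraic (T : fieldType) (w : T -> rat) (M : T -> Prop) (n : nat)
    (gamma : rat) (x : T) (P : {poly T}) : valuation w ->
    (forall c, M c -> c != 0 -> exists z : int, w c = z%:~R * gamma) ->
    P \is monic -> size P = n.+1 -> coefs_in M P -> root P x -> x != 0 ->
  exists z : int, w x * n`!%:R = z%:~R * gamma.
Proof.
move=> vw Mgamma P_mon P_size MP Px x0.
pose u (i : 'I_n.+1) := P`_i * x ^+ i.
have [i [k [lt_ik Pi Pk wik]]] : exists i k : 'I_n.+1, [/\ (i < k)%N, P`_i != 0, P`_k != 0 & w (u i) = w (u k)].
  apply: contrapT => no_ik.
  have u_inj i k : u i != 0 -> u k != 0 -> w (u i) = w (u k) -> i = k.
    rewrite !mulf_eq0 !negb_or => /andP [Pi _] /andP [Pk _] wik; apply/val_inj => /=.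
    case: (ltngtP i k) => // lt_ik; case: no_ik; first by exists i, k.
    by exists k, i.
  have sum0 : \sum_i u i = 0.
    by have := rootP Px; rewrite horner_coef P_size.
  have := sum_distinct_eq0 vw u_inj sum0 ord_max.
  move/eqP; rewrite mulf_eq0 expf_eq0 (negPf x0) andbF orbF /=.
  have -> : P`_n = 1 by move: P_mon; rewrite monicE /lead_coef P_size => /eqP.
  by rewrite oner_eq0.
have [a wPi] := Mgamma _ (MP i) Pi; have [b wPk] := Mgamma _ (MP k) Pk.
have e1 : w x * (k - i)%N%:R = (a - b)%:~R * gamma.
  have wX m : w (x ^+ m) = w x * m%:R by rewrite (valX vw) // mulr_natr.
  move: wik; rewrite /u !(valM vw) ?expf_neq0 // !wX wPi wPk natrB; last exact: ltnW.
  rewrite intrB => wik; rewrite mulrBr mulrBl; move: wik.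
  move: (w x * _) (w x * _) (_ * gamma) (_ * gamma) => *; lra.
have /dvdnP [m nE] : (k - i %| n`!)%N.
  rewrite dvdn_fact // subn_gt0 lt_ik (leq_trans (leq_subr _ _)) //.
  by rewrite -ltnS ltn_ord.
exists ((a - b) * m%:Z); rewrite nE natrM mulrCA e1 intrM.
by rewrite -pmulrn; ring.
Qed.

Variables (L : closedFieldType) (T : fieldType) (g : {rmorphism L -> T}) (t : T).
Variables (w : T -> rat) (vw : valuation w).
Hypothesis wg : forall c, c != 0 -> w (g c) = 0.

(** At most one value other than 0 occurs: t - b has value 0 for all b but at
    most one if t is integral, and all t - b have the same value as t if it is not. *)
Lemma linear_values : exists gamma, forall b, t - g b != 0 ->
  exists z : int, w (t - g b) = z%:~R * gamma.
Proof.
have [[c [tc wc]]|all0] := pselect (exists c, t - g c != 0 /\ w (t - g c) != 0); last first.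
  exists 0 => b tb; exists 0; rewrite mul0r; apply: contrapT => /eqP wb.
  by apply: all0; exists b.
exists (w (t - g c)) => b tb; have [->|bc] := eqVneq c b; first by exists 1; rewrite mul1r.
have gcb : g (c - b) != 0 by rewrite fmorph_eq0 subr_eq0.
have tE : t - g b = (t - g c) + g (c - b) by rewrite rmorphB; ring.
have wcb : w (g (c - b)) = 0 by rewrite wg // subr_eq0.
case: (ltrgtP (w (t - g c)) 0) => [wc_lt0|wc_gt0|/eqP]; last by rewrite (negPf wc).
  exists 1; rewrite mul1r tE.
  by have [|_ ->] := val_dominant vw tc (y := g (c - b)); first by right; rewrite wcb.
exists 0; rewrite mul0r tE addrC.
by have [|_ ->] := val_dominant vw gcb (y := t - g c); first by right; rewrite wcb.
Qed.

(** The elements of L(t) are quotients of products of constants and linear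
    factors t - b. *)
Lemma rational_function_values : exists gamma, forall c, adjoin g [:: t] c ->
  c != 0 -> exists z : int, w c = z%:~R * gamma.
Proof.
have [gamma lin] := linear_values; exists gamma => c /adjoin_one_frac [P [Q [Q0 ->]]].
rewrite mulf_eq0 invr_eq0 negb_or => /andP [P0 _].
suff poly_val (R : {poly L}) : (map_poly g R).[t] != 0 ->
    exists z : int, w (map_poly g R).[t] = z%:~R * gamma.
  have [a wP] := poly_val P P0; have [b wQ] := poly_val Q Q0.
  exists (a - b); rewrite (valM vw) ?invr_eq0 // (valV vw) // wP wQ.
  by rewrite intrB mulrBl.
have [rs ->] := closed_field_poly_normal R.
rewrite map_polyZ hornerZ /= mulf_eq0 negb_or => /andP [lead0 prod0].
have wlead : w (g (lead_coef R)) = 0 by rewrite wg // -(fmorph_eq0 g).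
rewrite (valM vw) // wlead add0r; move: prod0; elim: rs => [|b rs IHrs].
  by rewrite big_nil rmorph1 hornerC (val1 vw) => _; exists 0; rewrite mul0r.
rewrite big_cons rmorphM rmorphB /= map_polyX map_polyC /= hornerM hornerXsubC.
rewrite mulf_eq0 negb_or => /andP [tb rs0]; have [z1 w1] := lin b tb.
have [z2 w2] := IHrs rs0; exists (z1 + z2).
by rewrite (valM vw) // w1 w2 intrD mulrDl.
Qed.

End BoundedDegree.

(** The geometric field is finite over L(t), whose value group is cyclic. *)
Lemma geometric_value_group_cyclic (K F : fieldType) (iota : {rmorphism K -> F})
    (L : closedFieldType) (j : {rmorphism K -> L}) (T : fieldType)
    (f : {rmorphism F -> T}) (g : {rmorphism L -> T}) (t : F) (w : T -> rat) :
    (forall a, f (iota a) = g (j a)) -> (forall x, tensor_sub f g predT x) ->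
    finitely_generated iota ->
    (forall x, algebraic_over_sub (adjoin iota [:: t]) x) ->
    valuation w -> (forall c, c != 0 -> w (g c) = 0) ->
  exists gamma, forall x, x != 0 -> exists z : int, w x = z%:~R * gamma.
Proof.
move=> comm span fg alg vw wg; pose M := adjoin g [:: f t].
have sM : subfield_pred M := adjoin_subfield g [:: f t].
have rM := subfield_subring sM.
have fM x : adjoin iota [:: t] x -> M (f x).
  elim=> {x} [a|x|x y _ Mx _ My|x y _ Mx _ My].
  - by rewrite comm; apply: adjoin_const.
  - by rewrite inE => /eqP ->; apply/adjoin_gen; rewrite inE.
  - by rewrite rmorphB; apply: adjoin_sub.
  by rewrite fmorph_div; apply: adjoin_div.
have [I [e eF]] := finitely_generated_spanned fg (adjoin_subfield iota [:: t])
  (adjoin_const _ _) alg.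
pose n := #|I|; pose e' (i : 'I_n) := f (e (enum_val i)).
have e'_span x : exists c : 'I_n -> T, (forall i, M (c i)) /\ x = \sum_i c i * e' i.
  apply: (@tensor_sub_ind _ _ _ f g predT (fun x => exists c : 'I_n -> T,
    (forall i, M (c i)) /\ x = \sum_i c i * e' i)) (span x).
  - exists (fun=> 0); split=> [i|]; first exact: subring0.
    by rewrite big1 // => i _; rewrite mul0r.
  - move=> y z [c [Mc ->]] [d [Md ->]]; exists (fun i => c i + d i).
    split=> [i|]; first exact: subringD.
    by rewrite -big_split; apply: eq_bigr => i _; rewrite mulrDl.
  move=> a b _; have [c Ec ->] := eF a Logic.I.
  exists (fun i => f (c (enum_val i)) * g b); split=> [i|].
    by apply: subringM => //; [apply: fM | apply: adjoin_const].
  rewrite rmorph_sum mulr_suml (reindex_onto enum_val enum_rank) /=; last first.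
    by move=> i _; rewrite enum_rankK.
  rewrite (eq_bigl xpredT) => [|i]; last by rewrite enum_valK eqxx.
  by apply: eq_bigr => i _; rewrite rmorphM mulrAC.
have [gamma Mgamma] := rational_function_values (f t) vw wg.
exists (gamma / n`!%:R) => x x0.
have [P [P_mon P_size MP Px]] := spanned_integral rM e'_span x.
have [z wx] := value_of_algebraic vw Mgamma P_mon P_size MP Px x0.
by exists z; rewrite mulrA -wx mulfK // pnatr_eq0 -lt0n fact_gt0.
Qed.

(** * The extension F of K F^p *)

(** If the residues of the powers of z are independent over the residue field
    kappa of E, a combination of the powers of z has the least of the values of
    its coefficients. *)
Lemma residue_independent_value (L : closedFieldType) (T : fieldType)
    (g : {rmorphism L -> T}) (W : T -> int) (E : T -> Prop) (kappa : L -> Prop)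
    (u z : T) (r : L) (n : nat) (c : 'I_n -> T) :
    rational_valuation g W -> u != 0 -> 0 < W u -> kappa 0 ->
    (forall x, E x -> x != 0 -> exists (k : int) (l : L),
       [/\ kappa l, l != 0 & val_ge W 1 (x * u ^ (- k) - g l)]) ->
    val_ge W 1 (z - g r) ->
    (forall k : 'I_n -> L, (forall i, kappa (k i)) -> \sum_i k i * r ^+ i = 0 ->
       forall i, k i = 0) ->
    (forall i, E (c i)) -> (exists i, c i != 0) ->
  exists k : int, [/\ \sum_i c i * z ^+ i != 0, W (\sum_i c i * z ^+ i) = k * W u
    & forall i, val_ge W (k * W u) (c i)].
Proof.
move=> rW u0 Wu kappa0 E_res z_res indep Ec [i1 ci1].
have vW := discrete_valuation_valuation (let: And3 dW _ _ := rW in dW).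
have Wuk (k : int) : W (u ^ k) = k * W u by rewrite (valXz vW) // mulrzz mulrC.
have uk0 (k : int) : u ^ k != 0 by rewrite expfz_neq0.
have /choice [k kP] : forall i, exists k : int, c i != 0 -> exists l : L,
    [/\ kappa l, l != 0 & val_ge W 1 (c i * u ^ (- k) - g l)].
  move=> i; have [->|ci0] := eqVneq (c i) 0; first by exists 0.
  by have [k [l klP]] := E_res _ (Ec i) ci0; exists k => _; exists l.
case: (@Order.TotalTheory.arg_minP _ _ _ i1 (fun i => c i != 0) (fun i => k i) ci1).
move=> i0 ci0 min_i0; pose k0 := k i0.
have Wc i : c i != 0 -> W (c i) = k i * W u.
  move=> ci; have [l [_ l0 Wl]] := kP i ci.
  have cu : c i * u ^ (- k i) = g l + (c i * u ^ (- k i) - g l) by rewrite addrC subrK.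
  have gl0 : g l != 0 by rewrite fmorph_eq0.
  have Wgl : W (g l) = 0 by case: rW => _ ->.
  have [|_] := val_dominant vW gl0 (y := c i * u ^ (- k i) - g l).
    by case: Wl => [->|Wl]; [left | right; rewrite Wgl -gtz0_ge1 in Wl *].
  by rewrite -cu Wgl (valM vW) // Wuk mulNr => /eqP; rewrite subr_eq0 => /eqP.
have Wc_min i : val_ge W (k0 * W u) (c i).
  have [->|ci] := eqVneq (c i) 0; first by left.
  by right; rewrite Wc // ler_pM2r // min_i0.
have /choice [l lP] : forall i, exists l : L, [/\ kappa l, i = i0 -> l != 0 &
    val_ge W 1 (c i * u ^ (- k0) - g l)].
  move=> i; have [ci|ci] := eqVneq (c i) 0.
    exists 0; split=> // [e|]; first by move: ci0; rewrite -e ci eqxx.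
    by rewrite ci mul0r rmorph0 subr0; left.
  have [l [kl l0 Wl]] := kP i ci; have [e|ne] := eqVneq (k i) k0.
    by exists l; rewrite -e; split.
  exists 0; split=> // [e|]; first by move: ne; rewrite e /k0 eqxx.
  rewrite rmorph0 subr0; right; rewrite (valM vW) // Wuk Wc // mulNr -mulrBl.
  have : k0 < k i by rewrite lt_neqAle eq_sym ne min_i0.
  by rewrite -subr_gt0 => lt_k; rewrite -gtz0_ge1 mulr_gt0.
pose y := \sum_i l i * r ^+ i.
have y0 : y != 0.
  apply/eqP => /(indep l (fun i => let: And3 kl _ _ := lP i in kl)) /(_ i0) li0.
  by have [_ /(_ erefl)] := lP i0; rewrite li0 eqxx.
have gy0 : g y != 0 by rewrite fmorph_eq0.
have B1 : subring_pred (val_ge W 0) := val_ge_subring vW.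
have g_ge a : val_ge W 0 (g a) := rational_valC rW a (lexx 0).
have z_ge : val_ge W 0 z.
  by rewrite -[z](subrK (g r)); apply: (subringD B1) => //; apply: val_geW z_res.
have zX_res i : val_ge W 1 (z ^+ i - g (r ^+ i)).
  elim: i => [|i IHi]; first by rewrite !expr0 rmorph1 subrr; left.
  have -> : z ^+ i.+1 - g (r ^+ i.+1) = (z - g r) * z ^+ i + (z ^+ i - g (r ^+ i)) * g r.
    by rewrite !exprS rmorphM; ring.
  apply: (val_geD vW).
    by have := val_geM vW z_res (val_geX vW i z_ge); rewrite mul0rn addr0.
  by have := val_geM vW IHi (g_ge r); rewrite addr0.
have sum_res : val_ge W 1 ((\sum_i c i * z ^+ i) * u ^ (- k0) - g y).
  rewrite rmorph_sum mulr_suml -sumrB; apply: (val_ge_sum vW) => i _.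
  have [_ _ ci] := lP i.
  have -> : c i * z ^+ i * u ^ (- k0) - g (l i * r ^+ i) =
      (c i * u ^ (- k0) - g (l i)) * z ^+ i + (z ^+ i - g (r ^+ i)) * g (l i).
    by rewrite rmorphM; ring.
  apply: (val_geD vW).
    by have := val_geM vW ci (val_geX vW i z_ge); rewrite mul0rn addr0.
  by have := val_geM vW (zX_res i) (g_ge (l i)); rewrite addr0.
have Wgy : W (g y) = 0 by case: rW => _ ->.
have [|sum0 Wsum] := val_dominant vW gy0 (y := (\sum_i c i * z ^+ i) * u ^ (- k0) - g y).
  by case: sum_res => [->|W1]; [left | right; rewrite Wgy gtz0_ge1].
rewrite addrC subrK Wgy in sum0 Wsum.
move: sum0; rewrite mulf_eq0 negb_or => /andP [sum0 _].
exists k0; split=> //; move: Wsum; rewrite (valM vW) // Wuk mulNr => /eqP.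
by rewrite subr_eq0 => /eqP.
Qed.

Lemma subfield_expz (F : fieldType) (E : F -> Prop) x (k : int) :
  subfield_pred E -> E x -> E (x ^ k).
Proof.
case=> sE EV Ex; case: k => n; first exact: subringX.
by rewrite NegzE -exprnN; apply: EV; apply: subringX.
Qed.

Section SimpleGenerator.

Variables (p : nat) (K F : fieldType) (iota : {rmorphism K -> F}).
Variables (L : closedFieldType) (j : {rmorphism K -> L}).
Variables (T : fieldType) (f : {rmorphism F -> T}) (g : {rmorphism L -> T}).
Hypotheses (pK : p \in [pchar K]) (comm : forall a, f (iota a) = g (j a)).
Variables (O : {pred F}) (v : F -> int) (dv : discrete_valuation v).
Hypotheses (OE : forall x, (x \in O) = (x == 0) || (0 <= v x)).
Variables (W : T -> int) (rW : rational_valuation g W) (e : int).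
Hypotheses (e_gt0 : 0 < e) (Wf : forall a, a != 0 -> W (f a) = e * v a).
Variable (delta : nat).
Local Notation Ob := (tensor_sub f g O).
Variable pi : F.
Hypotheses (pi0 : pi != 0) (vpi : v pi = 1).
Hypothesis cond : forall b, val_ge W 0 b -> Ob (f pi ^+ delta * b).

Let vv : valuation v := discrete_valuation_valuation dv.
Let dW : discrete_valuation W. Proof. by case: rW. Qed.
Let vW : valuation W := discrete_valuation_valuation dW.
Let pF : p \in [pchar F]. Proof. exact: rmorph_pchar pK. Qed.
Let pT : p \in [pchar T]. Proof. exact: rmorph_pchar pF. Qed.
Let pL : p \in [pchar L]. Proof. exact: rmorph_pchar pK. Qed.
Let p_pr := pcharf_prime pK.
Let p_gt0 := prime_gt0 p_pr.

(** The subfield K F^p of F. *)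
Definition frob_subfield : F -> Prop := tensor_sub (pFrobenius_aut pF) iota predT.
Local Notation F1 := frob_subfield.

Lemma frob_subfield_expp x : F1 (x ^+ p).
Proof. by have := tensor_sub_left (pFrobenius_aut pF) iota (O := predT) (a := x) isT. Qed.

Lemma frob_subfield_subring : subring_pred F1.
Proof. exact: tensor_sub_subring. Qed.

Lemma frob_subfield_subfield : subfield_pred F1.
Proof.
exact: (subring_frobenius_subfield pF frob_subfield_subring frob_subfield_expp).
Qed.

Lemma frob_subfield_ppower a : F1 a -> ppower p (f a).
Proof.
have sP := ppower_subring pT.
apply: (@tensor_sub_ind _ _ _ (pFrobenius_aut pF) iota predT (fun a => ppower p (f a))).
- by rewrite rmorph0; apply: subring0.
- by move=> x y Px Py; rewrite rmorphD; apply: subringD.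
move=> x c _; rewrite rmorphM comm; apply: subringM => //; last exact: ppower_const.
by exists (f x); rewrite ?pFrobenius_autE ?rmorphXn.
Qed.

Variable t : F.
Hypothesis F_gen : forall x, adjoin_one F1 t x.

Let f_ge n a : val_ge v n a -> val_ge W (e * n) (f a).
Proof.
case=> [->|na]; first by rewrite rmorph0; left.
have [->|a0] := eqVneq a 0; first by rewrite rmorph0; left.
by right; rewrite Wf // ler_pM2l.
Qed.

Let O_ge a : a \in O <-> val_ge v 0 a. Proof. exact: valuation_ringP. Qed.

Let f_O a : a \in O -> val_ge W 0 (f a).
Proof. by move=> /O_ge/f_ge; rewrite mulr0. Qed.

Let f_gt a : val_ge v 1 a -> val_ge W 1 (f a).
Proof. by move=> /f_ge; rewrite mulr1; apply: val_geW; rewrite -gtz0_ge1. Qed.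

Let s_ex : exists2 s, s != 0 & W s = 1.
Proof. by case: dW => _ _; apply. Qed.

(** The value group and the residue field of F1 = K F^p cannot both be those of
    F: else each element of Ob is congruent to an element of T^p modulo any
    power of pi; but if s is a uniformizer of T then pi^delta s is in Ob, and
    its value is prime to p. *)
Lemma not_immediate w : F1 w -> w != 0 -> v w = 1 ->
  exists2 z, z \in O & forall a, F1 a -> a \in O -> ~ val_ge v 1 (z - a).
Proof.
move=> F1w w0 vw; apply: contrapT => no_z.
have imm z : z \in O -> exists a, [/\ F1 a, a \in O & val_ge v 1 (z - a)].
  move=> Oz; apply: contrapT => no_a; apply: no_z; exists z => // a F1a Oa za.
  by apply: no_a; exists a.
have sF1 := frob_subfield_subring.
have approx (k : nat) z : z \in O -> exists a, [/\ F1 a, a \in O & val_ge v k%:Z (z - a)].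
  elim: k => [|k IHk] in z * => Oz.
    exists 0; split; [exact: subring0 | exact/O_ge/val_ge0|].
    by rewrite subr0; apply/O_ge.
  have [a [F1a Oa za]] := IHk z Oz.
  have wk0 : w ^+ k != 0 by rewrite expf_neq0.
  have Wwk : v (w ^+ k) = k by rewrite (valX vv) // vw natz.
  have [|a' [F1a' Oa' za']] := imm ((z - a) / w ^+ k).
    apply/O_ge; have WV : val_ge v (- k%:Z) (w ^+ k)^-1 by right; rewrite (valV vv) // Wwk.
    by have := val_geM vv za WV; rewrite subrr.
  exists (a + w ^+ k * a'); split.
  - by apply: subringD => //; apply: subringM => //; apply: subringX.
  - have [B1 BB BM] := valuation_ring_subring dv OE.
    apply: (subringD (valuation_ring_subring dv OE)) => //; apply: BM => //.
    by apply/O_ge; right; rewrite Wwk.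
  have Wk : val_ge v k (w ^+ k) by right; rewrite Wwk.
  have := val_geM vv za' Wk; rewrite mulrBl divfK // intS.
  have -> : z - (a + w ^+ k * a') = z - a - a' * w ^+ k by ring.
  by [].
have approxT (k : nat) x : Ob x -> exists2 y, ppower p y & val_ge W k (x - y).
  apply: (@tensor_sub_ind _ _ _ f g O (fun x => exists2 y, ppower p y & val_ge W k (x - y))).
  - exists 0; last by rewrite subrr; left.
    exact: (subring0 (ppower_subring pT)).
  - move=> x1 x2 [y1 P1 xy1] [y2 P2 xy2]; exists (y1 + y2).
      exact: (subringD (ppower_subring pT)).
    by rewrite opprD addrACA; apply: (val_geD vW).
  move=> a b Oa; have [a1 [F1a1 _ aa1]] := approx k a Oa; exists (f a1 * g b).
    apply: (subringM (ppower_subring pT)); last exact: ppower_const.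
    exact: frob_subfield_ppower.
  rewrite -mulrBl -rmorphB; have := val_geM vW (f_ge aa1) (rational_valC rW b (lexx 0)).
  by rewrite addr0; apply: val_geW; rewrite ler_peMl // -gtz0_ge1.
have [s s0 Ws] := s_ex.
have fpi0 : f pi != 0 by rewrite fmorph_eq0.
have x0 : f pi ^+ delta * s != 0 by rewrite mulf_neq0 ?expf_neq0.
have [l eE] : exists l : int, e = l * p%:Z.
  have fw0 : f w != 0 by rewrite fmorph_eq0.
  have [l wl] := ppower_val rW pT (frob_subfield_ppower F1w) fw0.
  by exists l; rewrite -wl Wf // vw mulr1.
have Wx : W (f pi ^+ delta * s) = e * delta%:Z + 1.
  rewrite (valM vW) ?expf_neq0 // Ws (valX vW) // Wf // vpi mulr1.
  by rewrite -mulr_natr natz.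
have Ox : Ob (f pi ^+ delta * s) by apply: cond; right; rewrite Ws.
have [y Py xy] := approxT (absz (e * delta%:Z + 2)%R) _ Ox.
have [y0 Wy] : y != 0 /\ W y = e * delta%:Z + 1.
  have -> : y = f pi ^+ delta * s + - (f pi ^+ delta * s - y) by ring.
  rewrite -Wx; apply: val_dominant => //.
  case: (val_geN vW xy) => [|Wxy]; [by left | right].
  apply: lt_le_trans Wxy; rewrite Wx gez0_abs ?ltrD2l //.
  by rewrite addr_ge0 // mulr_ge0 // ltW.
have [m Wym] := ppower_val rW pT Py y0.
have : (p%:Z %| 1)%Z.
  apply/dvdzP; exists (m - l * delta%:Z).
  by rewrite mulrBl -Wym Wy eE; ring.
by rewrite dvdz1 /= => /eqP p1; have := prime_gt1 p_pr; rewrite p1.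
Qed.

Let F1_gen z : ~ F1 z -> forall x, exists c : 'I_p -> F,
  (forall i, F1 (c i)) /\ x = \sum_i c i * z ^+ i.
Proof.
move=> F1z x; have [|c F1c ->] := adjoin_one_span pF frob_subfield_subring frob_subfield_expp (t := z) (x := x).
  exact: (adjoin_one_exchange pF frob_subfield_subring frob_subfield_expp F_gen F1z).
by exists c.
Qed.

(** O = O1[z]: either the value group of F1 is p Z, and z is a uniformizer, or F1
    contains a uniformizer, and the residue of z is not in the residue field of
    F1. *)
Lemma simple_generator : exists z, [/\ z \in O, ~ F1 z
  & forall x, x \in O -> exists c : 'I_p -> F,
      (forall i, F1 (c i) /\ c i \in O) /\ x = \sum_i c i * z ^+ i].
Proof.
have sF1 := frob_subfield_subfield; have rF1 := frob_subfield_subring.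
have O_pi : pi \in O by apply/O_ge; right; rewrite vpi.
have [ram|unram] := pselect (forall x, F1 x -> x != 0 -> exists m : int, v x = m * p%:Z).
  have F1pi : ~ F1 pi.
    move=> /ram /(_ pi0) [m]; rewrite vpi => m1.
    have : (p%:Z %| 1)%Z by apply/dvdzP; exists m.
    by rewrite dvdz1 /= => /eqP p1; have := prime_gt1 p_pr; rewrite p1.
  exists pi; split=> // x Ox; have [c [F1c xE]] := F1_gen F1pi x.
  exists c; split=> // i; split=> //; apply/O_ge.
  have vpiX k : v (pi ^+ k) = k%:Z by rewrite (valX vv) // vpi natz.
  have c_inj (i1 i2 : 'I_p) : c i1 * pi ^+ i1 != 0 -> c i2 * pi ^+ i2 != 0 ->
      v (c i1 * pi ^+ i1) = v (c i2 * pi ^+ i2) -> i1 = i2.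
    rewrite !mulf_eq0 !negb_or => /andP [c1 _] /andP [c2 _].
    rewrite !(valM vv) ?expf_neq0 // !vpiX.
    have [m1 ->] := ram _ (F1c i1) c1; have [m2 ->] := ram _ (F1c i2) c2 => v12.
    by apply/val_inj; apply: (@eq_mod_small p i1 i2 (m2 - m1)); rewrite ?ltn_ord //; rewrite mulrBl; lia.
  have := Ox; rewrite xE => /O_ge /(val_ge_distinct vv c_inj) /(_ i).
  have [->|ci0] := eqVneq (c i) 0; first by left.
  case=> [/eqP|]; first by rewrite mulf_eq0 (negPf ci0) expf_eq0 (negPf pi0) andbF.
  rewrite (valM vv) ?expf_neq0 // vpiX; have [m vc] := ram _ (F1c i) ci0.
  move=> v_ge; right; rewrite vc mulr_ge0 // leNgt; apply/negP => m0.
  have : (m + 1) * p%:Z <= 0 by rewrite pmulr_lle0 ?ltz_nat //; lia.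
  by rewrite mulrDl mul1r; have := ltn_ord i; lia.
have [w [F1w w0 vw]] : exists w, [/\ F1 w, w != 0 & v w = 1].
  have [x [F1x x0 vx]] : exists x, [/\ F1 x, x != 0 & ~~ (p%:Z %| v x)%Z].
    apply: contrapT => no_x; apply: unram => x F1x x0; apply/dvdzP.
    by apply/negPn/negP => vx; apply: no_x; exists x.
  have [a [b ab]] := Bezoutz (v x) p.
  have g1 : gcdz (v x) p = 1.
    rewrite /gcdz absz_nat gcdnC; congr Posz; apply/eqP.
    by rewrite -/(coprime _ _) prime_coprime.
  exists (x ^ a * (pi ^+ p) ^ b); split.
  - by apply: subringM => //; apply: subfield_expz => //; apply: frob_subfield_expp.
  - by rewrite mulf_neq0 ?expfz_neq0 ?expf_neq0.
  rewrite (valM vv) ?expfz_neq0 ?expf_neq0 // !(valXz vv) ?expf_neq0 //.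
  by rewrite (valX vv) // vpi natz !mulrzz -g1 -ab; ring.
have [z Oz z_res] := not_immediate F1w w0 vw.
have F1z : ~ F1 z by move=> F1z; apply: (z_res z) => //; rewrite subrr; left.
exists z; split=> // x Ox; have [c [F1c xE]] := F1_gen F1z x.
exists c; split=> // i; split=> //; apply/O_ge.
pose kappa (l : L) := exists a, [/\ F1 a, a \in O & val_ge W 1 (f a - g l)].
have fW1 a : a != 0 -> val_ge W 1 (f a) -> val_ge v 1 a.
  move=> a0 /val_geP; rewrite fmorph_eq0 => /(_ a0); rewrite Wf // => Wa; right.
  by rewrite -gtz0_ge1 -(pmulr_rgt0 _ e_gt0) gtz0_ge1.
have O_sub := valuation_ring_subring dv OE.
have g_ge a : val_ge W 0 (g a) := rational_valC rW a (lexx 0).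
have kappa_sub : subring_pred kappa.
  split=> [|l1 l2 [a1 [F1 O1 al1]] [a2 [F2 O2 al2]]|l1 l2 [a1 [F1 O1 al1]] [a2 [F2 O2 al2]]].
  - by exists 1; split; [apply: subring1|apply: (subring1 O_sub)|rewrite !rmorph1 subrr; left].
  - exists (a1 - a2); split; [exact: subringB | exact: (subringB O_sub)|].
    rewrite !rmorphB; have -> : f a1 - f a2 - (g l1 - g l2) = (f a1 - g l1) - (f a2 - g l2) by ring.
    exact: (val_geB vW).
  exists (a1 * a2); split; [exact: subringM | exact: (subringM O_sub)|].
  rewrite !rmorphM; have -> : f a1 * f a2 - g l1 * g l2 = (f a1 - g l1) * f a2 + (f a2 - g l2) * g l1 by ring.
  apply: (val_geD vW); first by have := val_geM vW al1 (f_O O2); rewrite addr0.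
  by have := val_geM vW al2 (g_ge l1); rewrite addr0.
have kappa_fld : subfield_pred kappa.
  split=> // l [a [Fa Oa al]]; have [->|l0] := eqVneq l 0.
    by rewrite invr0; apply: subring0.
  have a0 : a != 0.
    apply: contraNneq l0 => a0; move: al; rewrite a0 rmorph0 sub0r => /(val_geN vW).
    by rewrite opprK => /(rational_valC_eq0 rW) ->.
  have va : v a = 0.
    move/O_ge: (Oa) => /(val_geP _ _ a0); rewrite le_eqVlt => /orP [/eqP //|va].
    have /f_gt Wa : val_ge v 1 a by right; rewrite -gtz0_ge1.
    have := val_geB vW Wa al; rewrite opprB addrC subrK => /(rational_valC_eq0 rW) l1.
    by rewrite l1 // eqxx in l0.
  exists a^-1; split; first exact: (proj2 sF1).
    by apply/O_ge; right; rewrite (valV vv) // va.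
  have fa0 : f a != 0 by rewrite fmorph_eq0.
  have gl0 : g l != 0 by rewrite fmorph_eq0.
  rewrite !fmorphV; have -> : (f a)^-1 - (g l)^-1 = - (f a - g l) * (f a * g l)^-1.
    by field; rewrite fa0 gl0.
  have Wfg : val_ge W 0 (f a * g l)^-1.
    right; rewrite (valV vW) ?mulf_neq0 // (valM vW) // Wf // va mulr0.
    by case: rW => _ -> //.
  by have := val_geM vW (val_geN vW al) Wfg; rewrite addr0.
have [r zr] : exists r, val_ge W 1 (f z - g r).
  by case: rW => _ _; apply; apply: f_O.
have kappa_r : ~ kappa r.
  case=> a [F1a Oa ar]; apply: (z_res a) => //.
  have [za|za] := eqVneq (z - a) 0; first by rewrite za; left.
  apply: fW1 => //; rewrite rmorphB.
  have -> : f z - f a = (f z - g r) - (f a - g r) by ring.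
  exact: (val_geB vW).
have kappa_rp : kappa (r ^+ p).
  exists (z ^+ p); split; [exact: frob_subfield_expp | exact: (subringX O_sub)|].
  rewrite !rmorphXn -(expr1p_sub pT).
  by apply: val_geW (val_geX vW p zr); rewrite ler1n.
have indep := purely_inseparable_free pL kappa_fld kappa_rp kappa_r.
have [ci|ci0] := eqVneq (c i) 0; first by left.
pose E x := exists2 a, F1 a & x = f a.
have fw0 : f w != 0 by rewrite fmorph_eq0.
have E_res x' : E x' -> x' != 0 -> exists (k : int) (l : L),
    [/\ kappa l, l != 0 & val_ge W 1 (x' * f w ^ (- k) - g l)].
  case=> a F1a ->; rewrite fmorph_eq0 => a0; exists (v a).
  have wk0 : w ^ (- v a) != 0 by rewrite expfz_neq0.
  have vb : v (a * w ^ (- v a)) = 0.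
    by rewrite (valM vv) // (valXz vv) // vw mulrzz mul1r subrr.
  have b0 : a * w ^ (- v a) != 0 by rewrite mulf_neq0.
  have O_b : a * w ^ (- v a) \in O by apply/O_ge; right; rewrite vb.
  have [l bl] : exists l, val_ge W 1 (f (a * w ^ (- v a)) - g l).
    by case: rW => _ _; apply; apply: f_O.
  exists l; split; last by rewrite -fmorphXz -rmorphM.
    exists (a * w ^ (- v a)); split=> //.
    by apply: subringM => //; apply: subfield_expz.
  apply/eqP => l0; move: bl; rewrite l0 rmorph0 subr0 => /(fW1 _ b0) /(val_geP _ _ b0).
  by rewrite vb.
have Wfw : 0 < W (f w) by rewrite Wf // vw mulr1.
have Efc i' : E (f (c i')) by exists (c i').
have fc0 : exists i', f (c i') != 0 by exists i; rewrite fmorph_eq0.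
have indep' (k : 'I_p -> L) : (forall i, kappa (k i)) -> \sum_i k i * r ^+ i = 0 ->
    forall i, k i = 0 by move=> kk; apply: indep.
have [k [sum0 Wsum Wc]] := residue_independent_value rW fw0 Wfw
  (subring0 kappa_sub) E_res zr indep' Efc fc0.
have fx : f x = \sum_i f (c i) * f z ^+ i.
  by rewrite xE rmorph_sum; apply: eq_bigr => i' _; rewrite rmorphM rmorphXn.
have Wfx : 0 <= W (f x).
  have /f_O /val_geP := Ox; apply; rewrite fx; exact: sum0.
move: Wfx; rewrite fx Wsum Wf // vw mulr1 => k_ge0.
have := Wc i; move/val_geP; rewrite fmorph_eq0 => /(_ ci0).
rewrite !Wf // vw mulr1 => le_k; right.
by rewrite -(pmulr_rge0 _ e_gt0) (le_trans k_ge0).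
Qed.

End SimpleGenerator.

(** Each x is separable over K F^p [t], which contains x^p. *)
Lemma separable_frob_generator (p : nat) (K F : fieldType) (iota : {rmorphism K -> F})
    (pK : p \in [pchar K]) (t : F) :
    (forall x, separable_over_sub (adjoin iota [:: t]) x) ->
  forall x, adjoin_one (frob_subfield iota pK) t x.
Proof.
move=> sep x; have pF : p \in [pchar F] := rmorph_pchar iota pK.
have rF1 := frob_subfield_subring iota pK.
have expF1 := frob_subfield_expp iota pK.
have sE := adjoin_one_subfield pF rF1 expF1 t.
apply: (separable_purely_inseparable pF sE); first exact: adjoin_one_base.
have [q [sep_q Eq qx]] := sep x; exists q; split=> // i.
apply: adjoin_min (Eq i) => // [a|y].
  apply: adjoin_one_base => //.
  exact: (@tensor_sub_right _ _ _ _ iota predT a isT).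
by rewrite inE => /eqP ->; apply: adjoin_one_gen.
Qed.

(** The genus drop from F to K F^p: if O = O1[z] and z - z_0^p has value m at
    the geometric prime, 2 delta = 2 p delta1 + (p - 1) (m - 1). *)
Lemma singularity_degree_formula (p : nat) (K F : fieldType)
    (iota : {rmorphism K -> F}) (O : {pred F}) (delta : nat) :
    p \in [pchar K] -> separable_function_field iota ->
    function_field_prime iota O -> purely_inseparable_prime p iota O ->
    geometric_singularity_degree iota O delta -> (0 < delta)%N ->
  exists m delta1, ~~ (p %| m)%N /\
    (2 * delta = 2 * (p * delta1) + (p - 1) * (m - 1))%N.
Proof.
move=> pK [fg _ [t [_ sep]] _] [[v dv OE] iotaO] pins [L [j [T0 [f0 [g0 [alg tens cod]]]]]] delta_gt0.
have span0 := tensor_product_span tens; have comm0 := proj1 tens.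
have [pi pi0 vpi] : exists2 pi, pi != 0 & v pi = 1 by case: dv => _ _; apply.
have [T [q [span pi_not_unit codT]]] := geometric_quotient_field pK comm0 span0
  alg dv OE iotaO pins pi0 vpi cod delta_gt0.
pose f : {rmorphism F -> T} := q \o f0; pose g : {rmorphism L -> T} := q \o g0.
rewrite -/f -/g in span pi_not_unit codT.
have comm a : f (iota a) = g (j a) by rewrite /= comm0.
have algF x : algebraic_over_sub (adjoin iota [:: t]) x.
  by have [r [sep_r Er rx]] := sep x; exists r; rewrite separable_poly_neq0.
have cyclic w := geometric_value_group_cyclic (w := w) comm span fg algF.
have [W [rW W_ge [e e_gt0 Wf]]] := geometric_valuation pK comm span dv OE pins pi0
  vpi pi_not_unit cyclic.
have codW : has_codim g (tensor_sub f g O) (val_ge W 0) delta.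
  by apply: eq_has_codim codT => x //; rewrite W_ge.
have cond b : val_ge W 0 b -> tensor_sub f g O (f pi ^+ delta * b).
  move=> /W_ge; apply: (conductor pK comm alg dv OE iotaO vpi codW).
  by move=> x /W_ge.
have F_gen := separable_frob_generator pK sep.
have [z [Oz F1z O_span]] := simple_generator comm dv OE rW e_gt0 Wf pi0 vpi cond F_gen.
have pF : p \in [pchar F] := rmorph_pchar iota pK.
have pT : p \in [pchar T] := rmorph_pchar f pF.
have vW := discrete_valuation_valuation (let: And3 dW _ _ := rW in dW).
have pP := ppower_subring pT.
have rF1 := frob_subfield_subring iota pK; have expF1 := frob_subfield_expp iota pK.
have F1P := frob_subfield_ppower (pK := pK) comm.
pose O1 : {pred F} := fun x => `[< frob_subfield iota pK x >] && (x \in O).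
have O1P x : (x \in O1) <-> frob_subfield iota pK x /\ x \in O.
  by rewrite /O1 unfold_in; split=> [/andP [/asboolP]|[/asboolP -> ->]].
have B_f a : a \in O -> val_ge W 0 (f a).
  by move=> Oa; apply/W_ge/frob_closure_base/tensor_sub_left.
have T_gen x : adjoin_one (ppower p) (f z) x.
  have zP := adjoin_one_subring (f z) pP.
  apply: (tensor_sub_ind _ _ _ (span x)) => [|y1 y2|a b _]; first exact: (subring0 zP).
    exact: (subringD zP).
  apply: (subringM zP); last by apply: adjoin_one_base => //; apply: ppower_const.
  have [P F1P' ->] := adjoin_one_exchange pF rF1 expF1 F_gen F1z a.
  exists (map_poly f P); last by rewrite horner_map.
  by move=> i; rewrite coef_map; apply/F1P/F1P'.
have [s s0 Ws] : exists2 s, s != 0 & W s = 1 by case: rW => [[_ _ +] _ _]; apply.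
have fz_notP : ~ ppower p (f z).
  move=> Pz; have Ps : ppower p s by apply: (adjoin_one_sub _ _ Pz (T_gen s)).
  have [m] := ppower_val rW pT Ps s0; rewrite Ws => m1.
  have : (p%:Z %| 1)%Z by apply/dvdzP; exists m.
  by rewrite dvdz1 /= => /eqP p1; have := prime_gt1 (pcharf_prime pK); rewrite p1.
have frobO1 x : frob_image p (tensor_sub f g O) x -> tensor_sub f g O1 x.
  case=> _ [n [a [b [Oa ->]]] ->]; rewrite (expr1p_sum pT).
  apply: tensor_sub_sum => i _; rewrite exprMn -!rmorphXn; apply: tensor_sub_elt.
  by apply/O1P; split; [apply: expF1 | apply: (subringX (valuation_ring_subring dv OE))].
have O1B x : tensor_sub f g O1 x -> frob_image p (val_ge W 0) x.
  have pB := frob_image_subring pT (val_ge_subring vW).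
  apply: tensor_sub_ind => [|y1 y2|a b /O1P [F1a Oa]]; first exact: (subring0 pB).
    exact: (subringD pB).
  apply: (ppower_val_ge0 rW pT); first by apply: (subringM pP); [apply: F1P | apply: ppower_const].
  have p_gt0 := prime_gt0 (pcharf_prime pK).
  have := val_geM vW (B_f _ Oa) (rational_valC rW b (lexx 0)); rewrite addr0.
  by apply: val_geW; rewrite subr_le0 lez_nat.
have subO1 : subspace g (tensor_sub f g O1) by apply: tensor_sub_subspace.
have [delta1 cod1] := has_codim_quotient subO1 frobO1 (has_codim_frob_image pT codW).
have codz : has_codim g (direct_sum (fun i : 'I_p => f z ^+ i) (fun=> tensor_sub f g O1))
    (val_ge W 0) delta.
  apply: eq_has_codim codW => // x; split.
    have sD : subspace g (direct_sum (fun i : 'I_p => f z ^+ i) (fun=> tensor_sub f g O1)).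
      exact: direct_sum_subspace.
    apply: tensor_sub_ind => [|y1 y2|a b Oa]; first exact: (subspace0 sD).
      exact: (subspaceD sD).
    have [c [cP ->]] := O_span a Oa; exists (fun i => f (c i) * g b); split=> [i|].
      by apply: tensor_sub_elt; apply/O1P.
    rewrite rmorph_sum mulr_suml; apply: eq_bigr => i _.
    by rewrite rmorphM rmorphXn mulrAC.
  case=> c [O1c ->]; apply: tensor_sub_sum => i _.
  have sOb : subring_pred (tensor_sub f g O) by apply/tensor_sub_subring/(valuation_ring_subring dv OE).
  apply: (subringM sOb); last by apply/(subringX sOb)/tensor_sub_left.
  by apply: tensor_subS (O1c i) => y /O1P [].
have [m pm formula] := codim_simple_extension rW s0 Ws pT fz_notP T_gen (B_f z Oz)
  subO1 O1B cod1 codz.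
by exists m, delta1.
Qed.

(** The degree formula with 2 delta = (p - 1) d, read modulo p, says that
    m = d + 1. *)
Lemma admissible_necessary (p d : nat) : prime p -> (0 < d)%N -> admissible p d ->
  ~ (d%:Z = -1 %[mod p%:Z])%Z.
Proof.
move=> p_pr d_gt0 [K [F [iota [O [delta [pK sff [ffp pins] gsd delta_d]]]]]] dm.
have p_gt1 := prime_gt1 p_pr.
have delta_gt0 : (0 < delta)%N.
  have : (0 < 2 * delta)%N by rewrite delta_d muln_gt0 subn_gt0 p_gt1.
  by rewrite muln_gt0.
have [m [delta1 [pm formula]]] := singularity_degree_formula pK sff ffp pins gsd delta_gt0.
have m_gt0 : (0 < m)%N by case: (m) pm; rewrite ?dvdn0.
case/negP: pm; have /dvdzP [k dk] : (p%:Z %| d%:Z + 1)%Z.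
  by have /eqP := dm; rewrite eqz_mod_dvd opprK.
have eqZ : (p%:Z - 1) * d%:Z = 2 * (p%:Z * delta1%:Z) + (p%:Z - 1) * (m%:Z - 1).
  have := congr1 Posz formula; rewrite delta_d PoszD !PoszM.
  by rewrite -!subzn // ltnW.
have : (p%:Z %| m%:Z)%Z.
  apply/dvdzP; exists (m%:Z - 1 - d%:Z + 2 * delta1%:Z + k).
  rewrite mulrDl -dk; apply/eqP; rewrite -subr_eq0.
  by move/eqP: eqZ; rewrite -subr_eq0; congr (_ == 0); ring.
by [].
Qed.

(** * Rational function fields *)

(** The fields of fractions are handled through this property of the embedding
    of R rather than through their construction as quotients. *)
Definition fraction_map (R : idomainType) (T : fieldType)
    (tofrac : {rmorphism R -> T}) : Prop :=
  (forall r, (tofrac r == 0) = (r == 0)) /\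
  forall x, exists nd : R * R, nd.2 != 0 /\ x = tofrac nd.1 / tofrac nd.2.

Lemma fraction_mapP (R : idomainType) : fraction_map (@FracField.tofrac R).
Proof.
split=> [r|x]; first exact: tofrac_eq0.
pose r := generic_quotient.repr x; exists (\n_r, \d_r).
have d0 : \d_r != 0 by apply: denom_ratioP.
have td0 : FracField.tofrac \d_r != 0 by rewrite tofrac_eq0.
split=> //=; apply: (mulIf td0); rewrite divfK //.
rewrite -{1}[x]generic_quotient.reprK -/r.
unlock FracField.tofrac; rewrite -[LHS]FracField.pi_mul.
apply/eqP; rewrite FracField.equivf_def /FracField.mulf !numden_Ratio ?mulf_neq0 ?oner_eq0 //.
by rewrite !mulr1 mulrC.
Qed.

Section Fractions.

Variables (R : idomainType) (T : fieldType) (tofrac : {rmorphism R -> T}).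
Hypothesis fracT : fraction_map tofrac.

Let tofrac0 r : (tofrac r == 0) = (r == 0). Proof. by case: fracT. Qed.

Lemma fraction_eq (n d n' d' : R) : d != 0 -> d' != 0 ->
  tofrac n / tofrac d = tofrac n' / tofrac d' -> n * d' = n' * d.
Proof.
move=> d0 d0' /eqP; rewrite eqr_div ?tofrac0 // => e.
by apply/eqP; rewrite -subr_eq0 -tofrac0 rmorphB !rmorphM subr_eq0.
Qed.

(** The value phi(n) / phi(d) at n / d does not depend on the choice of n and d. *)
Lemma fraction_lift (S : comNzRingType) (phi : {rmorphism R -> S}) :
    (forall r, r != 0 -> exists y, phi r * y = 1) ->
  exists h : {rmorphism T -> S}, forall r, h (tofrac r) = phi r.
Proof.
move=> phi_unit.
have /choice [inv invP] : forall r, exists y, r != 0 -> phi r * y = 1.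
  move=> r; have [->|r0] := eqVneq r 0; first by exists 0.
  by have [y ry] := phi_unit r r0; exists y.
have /choice [nd ndP] := proj2 fracT.
pose h x := phi (nd x).1 * inv (nd x).2.
have hP x n d : d != 0 -> x = tofrac n / tofrac d -> h x = phi n * inv d.
  move=> d0 xE; have [e0 xE'] := ndP x.
  have ne := fraction_eq d0 e0 (etrans (esym xE) xE').
  have := congr1 phi ne; rewrite !rmorphM /h.
  have := invP _ d0; have := invP _ e0.
  move: (phi (nd x).1) (phi (nd x).2) (phi n) (phi d) (inv (nd x).2) (inv d).
  move=> a b c r u w bu1 rw1 e1; rewrite -[LHS]mulr1 -rw1.
  transitivity (a * r * u * w); first by ring.
  by rewrite -e1 -[RHS]mulr1 -bu1; ring.
have invM d e : d != 0 -> e != 0 -> inv (d * e) = inv d * inv e.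
  move=> d0 e0; have := invP _ (mulf_neq0 d0 e0); rewrite rmorphM => de1.
  have := invP d d0; have := invP e e0; move: de1.
  move: (phi d) (phi e) (inv d) (inv e) (inv (d * e)) => a b x y z abz by1 ax1.
  transitivity (z * (a * x) * (b * y)); first by rewrite ax1 by1 !mulr1.
  by rewrite -[RHS]mulr1 -abz; ring.
have hB : zmod_morphism h.
  move=> x y; have [dx0 xE] := ndP x; have [dy0 yE] := ndP y.
  have tx0 : tofrac (nd x).2 != 0 by rewrite tofrac0.
  have ty0 : tofrac (nd y).2 != 0 by rewrite tofrac0.
  rewrite (hP _ ((nd x).1 * (nd y).2 - (nd y).1 * (nd x).2) ((nd x).2 * (nd y).2)) ?mulf_neq0 //.
    rewrite invM // rmorphB !rmorphM /h.
    have := invP _ dx0; have := invP _ dy0.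
    move: (phi (nd x).2) (phi (nd y).2) (inv (nd x).2) (inv (nd y).2).
    move: (phi (nd x).1) (phi (nd y).1) => a b c d u w dw1 cu1.
    transitivity (a * u * (d * w) - b * w * (c * u)); first by ring.
    by rewrite dw1 cu1 !mulr1.
  by rewrite {1}xE {1}yE -mulNr addf_div // rmorphB !rmorphM mulNr.
have hM : monoid_morphism h.
  split=> [|x y].
    rewrite (hP _ 1 1) ?oner_eq0 ?rmorph1 ?divr1 //.
    by have := invP 1 (oner_neq0 R); rewrite rmorph1.
  have [dx0 xE] := ndP x; have [dy0 yE] := ndP y.
  have tx0 : tofrac (nd x).2 != 0 by rewrite tofrac0.
  have ty0 : tofrac (nd y).2 != 0 by rewrite tofrac0.
  rewrite (hP _ ((nd x).1 * (nd y).1) ((nd x).2 * (nd y).2)) ?mulf_neq0 //.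
    by rewrite invM // rmorphM /h mulrACA.
  by rewrite {1}xE {1}yE mulf_div !rmorphM.
pose Z := GRing.isZmodMorphism.Build T S h hB.
pose M := GRing.isMonoidMorphism.Build T S h hM.
exists (HB.pack_for {rmorphism T -> S} h Z M) => r /=.
rewrite (hP _ r 1) ?oner_eq0 ?rmorph1 ?divr1 //.
by have := invP 1 (oner_neq0 R); rewrite rmorph1 mul1r => ->; rewrite mulr1.
Qed.

End Fractions.

Lemma rmorphism_adjoin (K F : fieldType) (iota : {rmorphism K -> F}) (s : seq F)
    (S : nzRingType) (u w : {rmorphism F -> S}) :
    (forall a, u (iota a) = w (iota a)) -> (forall x, x \in s -> u x = w x) ->
  forall x, adjoin iota s x -> u x = w x.
Proof.
move=> uK us x; elim=> {x} [a|x xs|x y _ ux _ uy|x y _ ux _ uy] //; first exact: us.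
  by rewrite !rmorphB ux uy.
have [->|y0] := eqVneq y 0; first by rewrite invr0 mulr0 !rmorph0.
have uV : u y^-1 = w y^-1.
  have uy1 : u y^-1 * u y = 1 by rewrite -rmorphM mulVf ?rmorph1.
  have wy1 : w y * w y^-1 = 1 by rewrite -rmorphM mulfV ?rmorph1.
  by rewrite -[LHS]mulr1 -wy1 -uy mulrA uy1 mul1r.
by rewrite !rmorphM ux uV.
Qed.

Section RationalFunctions.

Variables (L : closedFieldType) (T : fieldType) (tofrac : {rmorphism {poly L} -> T}).
Hypothesis fracT : fraction_map tofrac.
Variable g : {rmorphism L -> T}.
Hypothesis gE : forall c, g c = tofrac c%:P.
Local Notation s := (tofrac 'X).

Let tofrac0 P : (tofrac P == 0) = (P == 0). Proof. by case: fracT. Qed.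

Lemma rat_horner (P : {poly L}) : tofrac P = (map_poly g P).[s].
Proof.
rewrite -{1}[P]coefK poly_def rmorph_sum horner_coef size_map_poly.
by apply: eq_bigr => i _; rewrite -mul_polyC rmorphM rmorphXn coef_map /= gE.
Qed.

Lemma rat_var_neq0 : s != 0.
Proof. by rewrite tofrac0 polyX_eq0. Qed.

Lemma rat_adjoin x : adjoin g [:: s] x.
Proof.
have [nd [_ ->]] := proj2 fracT x.
have sM := adjoin_subfield g [:: s]; have rM := subfield_subring sM.
have tofrac_adj P : adjoin g [:: s] (tofrac P).
  rewrite [tofrac P]rat_horner; apply: (subring_horner rM).
    by move=> i; rewrite coef_map; apply: adjoin_const.
  by apply: adjoin_gen; rewrite inE.
exact: (subfield_div sM).
Qed.

Lemma rat_mulXn (P : {poly L}) n : tofrac (P * 'X^n) = tofrac P * s ^+ n.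
Proof. by rewrite rmorphM rmorphXn. Qed.

Lemma horner0_neq0 (P : {poly L}) : P.[0] != 0 -> P != 0.
Proof. by apply: contraNneq => ->; rewrite horner0. Qed.

(** The exponent k is the order of the rational function x at 0. *)
Lemma rat_normal_form x : x != 0 -> exists (k : int) (P Q : {poly L}),
  [/\ P.[0] != 0, Q.[0] != 0 & x = s ^ k * (tofrac P / tofrac Q)].
Proof.
have [[n d] /= [d0 ->]] := proj2 fracT x.
rewrite mulf_eq0 invr_eq0 negb_or tofrac0 => /andP [n0 td0].
have s0 := rat_var_neq0.
have [k [P P0 nE]] := multiplicity_XsubC n 0.
have [l [Q Q0 dE]] := multiplicity_XsubC d 0.
rewrite subr0 in nE dE.
have {}P0 : P.[0] != 0 by apply: implyP P0 n0.
have {}Q0 : Q.[0] != 0 by apply: implyP Q0 d0.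
exists (k%:Z - l%:Z), P, Q; split=> //.
rewrite expfzDr // -exprnP -exprnN mulrC mulf_div nE dE.
by rewrite !rat_mulXn mulrC [tofrac P * _]mulrC [tofrac Q * _]mulrC.
Qed.

Lemma rat_order_le (k l : int) (P Q R S : {poly L}) : P.[0] != 0 -> Q.[0] != 0 ->
    R.[0] != 0 -> S.[0] != 0 ->
  s ^ k * (tofrac P / tofrac Q) = s ^ l * (tofrac R / tofrac S) -> k <= l.
Proof.
move=> P0 Q0 R0 S0 e; rewrite leNgt; apply/negP => lt_lk.
have [m kE] : exists m : nat, k = l + m.+1%:Z.
  by exists (absz (k - l - 1)%R); move: lt_lk; clear; lia.
have sl0 : s ^ l != 0 by rewrite expfz_neq0 // rat_var_neq0.
have Q1 : tofrac Q != 0 by rewrite tofrac0 horner0_neq0.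
have S1 : tofrac S != 0 by rewrite tofrac0 horner0_neq0.
move: e; rewrite kE expfzDr ?rat_var_neq0 // -!mulrA => /(mulfI sl0) e.
have : tofrac (P * 'X^(m.+1)) / tofrac Q = tofrac R / tofrac S.
  by rewrite rat_mulXn mulrAC mulrC.
move=> /(fraction_eq fracT (horner0_neq0 Q0) (horner0_neq0 S0)).
move=> /(congr1 (fun q : {poly L} => q.[0])).
rewrite !hornerM hornerXn expr0n mulr0 mul0r => /esym /eqP.
by rewrite mulf_eq0 (negPf R0) (negPf Q0).
Qed.

(** The order at 0; its ultrametric inequality holds because fractions whose
    denominator does not vanish at 0 form a ring, and the residue of such a
    fraction is its value at 0. *)
Lemma rational_function_valuation : exists W : T -> int,
  [/\ rational_valuation g W, W s = 1
    & forall x, val_ge W 0 x -> exists P Q : {poly L},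
        Q.[0] != 0 /\ x = tofrac P / tofrac Q].
Proof.
have s0 := rat_var_neq0.
have /choice [W WP] : forall x, exists k : int, x != 0 -> exists P Q : {poly L},
    [/\ P.[0] != 0, Q.[0] != 0 & x = s ^ k * (tofrac P / tofrac Q)].
  move=> x; have [->|x0] := eqVneq x 0; first by exists 0.
  by have [k [P [Q PQ]]] := rat_normal_form x0; exists k => _; exists P, Q.
have WE x k P Q : x != 0 -> P.[0] != 0 -> Q.[0] != 0 ->
    x = s ^ k * (tofrac P / tofrac Q) -> W x = k.
  move=> x0 P0 Q0 xE; have [R [S [R0 S0 xE']]] := WP x x0.
  have e := etrans (esym xE') xE; apply/eqP; rewrite eq_le.
  by rewrite (rat_order_le R0 S0 P0 Q0 e) (rat_order_le P0 Q0 R0 S0 (esym e)).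
have WM x y : x != 0 -> y != 0 -> W (x * y) = W x + W y.
  move=> x0 y0; have [P [Q [P0 Q0 xE]]] := WP x x0; have [R [S [R0 S0 yE]]] := WP y y0.
  apply: (@WE _ _ (P * R) (Q * S)); rewrite ?hornerM ?mulf_neq0 //.
  have Q1 : tofrac Q != 0 by rewrite tofrac0 horner0_neq0.
  have S1 : tofrac S != 0 by rewrite tofrac0 horner0_neq0.
  by rewrite {1}xE {1}yE (expfzDr _ _ s0) mulrACA mulf_div !(rmorphM tofrac).
have frac_ge (P Q : {poly L}) : Q.[0] != 0 -> val_ge W 0 (tofrac P / tofrac Q).
  move=> Q0; have [->|P0] := eqVneq P 0; first by left; rewrite rmorph0 mul0r.
  right; have [n [R R0 PE]] := multiplicity_XsubC P 0.
  have Q1 : tofrac Q != 0 by rewrite tofrac0 horner0_neq0.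
  have {}R0 : R.[0] != 0 by apply: implyP R0 P0.
  have e : tofrac P / tofrac Q = s ^ n%:Z * (tofrac R / tofrac Q).
    by rewrite PE subr0 rat_mulXn mulrAC mulrC.
  have PQ0 : tofrac P / tofrac Q != 0.
    by rewrite mulf_neq0 ?invr_eq0 // tofrac0.
  by rewrite (WE _ _ _ _ PQ0 R0 Q0 e).
have ge_frac x : val_ge W 0 x -> exists P Q : {poly L},
    Q.[0] != 0 /\ x = tofrac P / tofrac Q.
  case=> [->|]; first by exists 0, 1; rewrite hornerC oner_eq0 rmorph0 mul0r.
  have [->|x0] := eqVneq x 0.
    by exists 0, 1; rewrite hornerC oner_eq0 rmorph0 mul0r.
  have [P [Q [P0 Q0 xE]]] := WP x x0; rewrite {2}xE; case: (W x) => // n _.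
  by exists (P * 'X^n), Q; rewrite rat_mulXn mulrAC mulrC.
have one0 : (1 : {poly L}).[0] != 0 by rewrite hornerC oner_eq0.
have W1 : W 1 = 0.
  apply: (WE _ _ 1 1 (oner_neq0 _) one0 one0).
  by rewrite divff ?mulr1 ?expr0z // rmorph1 oner_eq0.
have Ws : W s = 1.
  apply: (WE _ _ 1 1 s0 one0 one0).
  by rewrite divff ?mulr1 ?expr1z // rmorph1 oner_eq0.
have WV x : x != 0 -> W x^-1 = - W x.
  by move=> x0; apply/eqP; rewrite -addr_eq0 -WM ?invr_eq0 // mulVf // W1.
have ring_ge x y : val_ge W 0 x -> val_ge W 0 y -> val_ge W 0 (x + y).
  move=> /ge_frac [P [Q [Q0 ->]]] /ge_frac [R [S [S0 ->]]].
  have Q1 : tofrac Q != 0 by rewrite tofrac0 horner0_neq0.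
  have S1 : tofrac S != 0 by rewrite tofrac0 horner0_neq0.
  have -> : tofrac P / tofrac Q + tofrac R / tofrac S =
      tofrac (P * S + R * Q) / tofrac (Q * S).
    by rewrite addf_div // rmorphD !(rmorphM tofrac).
  by apply: frac_ge; rewrite hornerM mulf_neq0.
have vW : valuation W.
  apply: valuation_of_add1 => // z; apply: ring_ge; right.
  by rewrite W1.
have Ws_n (n : int) : W (s ^ n) = n by rewrite (valXz vW) // Ws mulrzz mul1r.
exists W; split=> //; split.
- case: vW => _ vW2; split=> // n.
  by exists (s ^ n); rewrite ?expfz_neq0.
- move=> c c0; have gc0 : g c != 0 by rewrite fmorph_eq0.
  have c0' : (c%:P).[0] != 0 by rewrite hornerC.
  apply: (WE _ _ c%:P 1 gc0 c0' one0).
  by rewrite expr0z mul1r rmorph1 divr1 gE.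
move=> x /ge_frac [P [Q [Q0 ->]]]; exists (P.[0] / Q.[0]).
have Q1 : tofrac Q != 0 by rewrite tofrac0 horner0_neq0.
have /factor_theorem [R RE] : root (P - (P.[0] / Q.[0])%:P * Q) 0.
  by rewrite rootE !hornerE divfK // subrr.
have -> : tofrac P / tofrac Q - g (P.[0] / Q.[0]) = s * (tofrac R / tofrac Q).
  apply: (mulIf Q1); rewrite mulrBl divfK // gE.
  rewrite -rmorphM -rmorphB RE subr0 rmorphM /=.
  by rewrite mulrA divfK // mulrC.
have s_ge : val_ge W 1 s by right; rewrite Ws.
by have := val_geM vW s_ge (frac_ge R Q Q0); rewrite addr0.
Qed.

End RationalFunctions.

(** With E packed as a field, E(t) is a finite extension of it, in which the
    separability of a generator passes to all elements. *)
Lemma separable_adjoin_one (F : fieldType) (E : F -> Prop) t x : subfield_pred E ->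
  separable_over_sub E t -> adjoin_one E t x -> separable_over_sub E x.
Proof.
move=> sE [q [sep_q Eq qt]] [P EP ->].
have [q' q'E] := subfield_lift_poly sE Eq; have [P' P'E] := subfield_lift_poly sE EP.
pose E1 : fieldType := subfield_type sE.
pose i1 : {rmorphism E1 -> F} := val.
have q0' : q' != 0.
  by rewrite -(map_poly_eq0 i1) [map_poly _ _]q'E separable_poly_neq0.
have ex_h : exists n, `[< exists h : {poly E1}, [/\ h != 0, root (map_poly i1 h) t & size h = n] >].
  by exists (size q'); apply/asboolP; exists q'; rewrite [map_poly _ _]q'E.
case: (ex_minnP ex_h) => n /asboolP [h [h0 ht hn]] min_n.
have irr_h : irreducible_poly h.
  apply/(subfx_irreducibleP ht h0) => r rt r0; rewrite hn; apply: min_n.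
  by apply/asboolP; exists r.
pose M : fieldExtType E1 := SubFieldExtType ht irr_h.
pose tM : M := subfx_root i1 t h.
pose iM : {rmorphism M -> F} := subfx_inj : {rmorphism subFExtend i1 t h -> F}.
have iMt : iM tM = t by apply: subfx_inj_root.
have iMb b : iM b%:A = i1 b by apply: subfx_inj_base.
have iM_map (r : {poly E1}) : map_poly iM (map_poly (in_alg M) r) = map_poly i1 r.
  by rewrite -map_poly_comp; apply: eq_map_poly => b; apply: iMb.
have sep_t : separable_element 1 tM.
  apply/separable_elementP; exists (map_poly (in_alg M) q'); split.
  - by apply/polyOver1P; exists q'.
  - by rewrite -(fmorph_root iM) iM_map iMt [map_poly _ _]q'E.
  by rewrite separable_map -(separable_map i1) [map_poly _ _]q'E.
have xM : (map_poly (in_alg M) P').[tM] \in <<1; tM>>%VS.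
  by apply: mempx_Fadjoin; apply/polyOver1P; exists P'.
have /separable_elementP [r [/polyOver1P [r' ->] r'x sep_r]] :=
  elimT adjoin_separableP sep_t _ xM.
exists (map_poly i1 r'); split.
- by rewrite separable_map -(separable_map (in_alg M)).
- exact: (subfield_map_poly (sE := sE)).
by rewrite -iM_map -P'E -[map_poly _ P']iM_map -iMt horner_map fmorph_root.
Qed.

(** P splits into linear factors over L. *)
Lemma algebraic_constant (L : closedFieldType) (T : fieldType)
    (g : {rmorphism L -> T}) (P : {poly L}) x :
  P != 0 -> root (map_poly g P) x -> exists b, x = g b.
Proof.
move=> P0 Px; have [rs PE] := closed_field_poly_normal P.
move: Px; rewrite PE map_polyZ rootZ ?fmorph_eq0 ?lead_coef_eq0 // rmorph_prod /=.
elim: rs {PE} => [|b rs IHrs]; first by rewrite big_nil (negPf (root1 _)).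
rewrite big_cons rootM map_polyXsubC root_XsubC => /orP [/eqP ->|/IHrs //].
by exists b.
Qed.

(** The field k(K)(s) as a type of its own. *)
Lemma generated_subfield (K T : fieldType) (k : {rmorphism K -> T}) (s : seq T) :
  exists (F : fieldType) (f : {rmorphism F -> T}) (iota : {rmorphism K -> F}),
    [/\ forall a, f (iota a) = k a, forall x, x \in s -> exists y, f y = x
      & forall r, map f r = s -> forall x, adjoin iota r x].
Proof.
have sE := adjoin_subfield k s; pose F : fieldType := subfield_type sE.
pose f : {rmorphism F -> T} := val.
pose iota0 a : F := sval (subfield_lift sE (adjoin_const k s a)).
have f_iota a : f (iota0 a) = k a by rewrite /iota0; case: subfield_lift.
have iB : zmod_morphism iota0.
  by move=> a b; apply: (fmorph_inj f); rewrite rmorphB !f_iota rmorphB.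
have iM : monoid_morphism iota0.
  split=> [|a b]; apply: (fmorph_inj f); first by rewrite f_iota !rmorph1.
  by rewrite rmorphM !f_iota rmorphM.
pose Z := GRing.isZmodMorphism.Build K F iota0 iB.
pose M := GRing.isMonoidMorphism.Build K F iota0 iM.
pose iota : {rmorphism K -> F} := HB.pack_for {rmorphism K -> F} iota0 Z M.
have lift x : adjoin k s x -> exists y, f y = x.
  by move=> /(subfield_lift sE) [y <-]; exists y.
exists F, f, iota; split=> // [x xs|r rs x].
  by apply: lift; apply: adjoin_gen.
have adj y : adjoin k s y -> forall x, f x = y -> adjoin iota r x.
  elim=> {x y} [a|y ys|y z Ey IHy Kz IHz|y z Ey IHy Kz IHz] x xE.
  - have -> : x = iota a by apply: (fmorph_inj f); rewrite f_iota.
    exact: adjoin_const.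
  - by apply: adjoin_gen; rewrite -(mem_map (fmorph_inj f)) rs xE.
  - have [y' yE] := lift y Ey; have [z' zE] := lift z Kz.
    have -> : x = y' - z' by apply: (fmorph_inj f); rewrite rmorphB yE zE.
    by apply: adjoin_sub; [apply: IHy | apply: IHz].
  have [y' yE] := lift y Ey; have [z' zE] := lift z Kz.
  have -> : x = y' / z' by apply: (fmorph_inj f); rewrite fmorph_div yE zE.
  by apply: adjoin_div; [apply: IHy | apply: IHz].
exact: adj (subfield_valP x) _ erefl.
Qed.

(** * The curve z^p = t^m + a *)

Section Construction.

Variables (p m : nat) (K : fieldType) (a : K).
Hypotheses (pK : p \in [pchar K]) (a_not_power : forall b, b ^+ p != a).
Variables (L : closedFieldType) (j : {rmorphism K -> L}).
Hypothesis algL : algebraic_closure j.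
Variables (T : fieldType) (tofrac : {rmorphism {poly L} -> T}).
Hypothesis fracT : fraction_map tofrac.
Variable g : {rmorphism L -> T}.
Hypothesis gE : forall c, g c = tofrac c%:P.
Local Notation s := (tofrac 'X).
Variables (W : T -> int) (rW : rational_valuation g W) (Ws : W s = 1).
Hypotheses (m_gt0 : (0 < m)%N) (pm : ~~ (p %| m)%N).
Variables (alpha : L) (alphaE : alpha ^+ p = j a).
Variables (F : fieldType) (f : {rmorphism F -> T}) (iota : {rmorphism K -> F}).
Hypothesis comm : forall b, f (iota b) = g (j b).
Variables (t z : F).
Hypotheses (ft : f t = s ^+ p) (fz : f z = s ^+ m + g alpha).
Hypothesis F_gen : forall x, adjoin iota [:: t; z] x.

Let p_pr := pcharf_prime pK.
Let p_gt0 := prime_gt0 p_pr.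
Let pF : p \in [pchar F] := rmorph_pchar iota pK.
Let pT : p \in [pchar T] := rmorph_pchar f pF.
Let pL : p \in [pchar L] := rmorph_pchar j pK.
Let vW : valuation W := discrete_valuation_valuation (let: And3 dW _ _ := rW in dW).
Let s0 : s != 0 := rat_var_neq0 fracT.

Lemma curve_equation : z ^+ p = t ^+ m + iota a.
Proof.
apply: (fmorph_inj f); rewrite rmorphD !rmorphXn ft fz comm (expr1p_add pT).
by rewrite -[g alpha ^+ p]rmorphXn alphaE -!exprM mulnC.
Qed.

Local Notation Kt := (adjoin iota [:: t]).
Let sKt : subfield_pred Kt := adjoin_subfield iota [:: t].
Let rKt := subfield_subring sKt.

(** The p-th powers of t, z and of the constants are in K(t). *)
Lemma expp_in_Kt x : Kt (x ^+ p).
Proof.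
elim: (F_gen x) => {x} [b|x|x y _ Ex _ Ey|x y _ Ex _ Ey].
- by rewrite -rmorphXn; apply: adjoin_const.
- have Et : Kt t by apply: adjoin_gen; rewrite inE.
  rewrite !inE => /orP [/eqP ->|/eqP ->]; first exact: subringX.
  rewrite curve_equation; apply: (subringD rKt); last exact: adjoin_const.
  exact: subringX.
- by rewrite (expr1p_sub pF); apply: adjoin_sub.
by rewrite expr_div_n; apply: adjoin_div.
Qed.

(** F = K(t)[z] is of degree at most p over K(t). *)
Lemma curve_span x : exists c : 'I_p -> F, (forall i, Kt (c i)) /\ x = \sum_i c i * z ^+ i.
Proof.
have [|c Ec ->] := adjoin_one_span pF rKt expp_in_Kt (t := z) (x := x); last by exists c.
apply: adjoin_min (F_gen x) => [|b|y].
- exact: (adjoin_one_subfield pF rKt expp_in_Kt).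
- by apply: adjoin_one_base => //; apply: adjoin_const.
rewrite !inE => /orP [/eqP ->|/eqP ->]; last exact: adjoin_one_gen.
by apply: adjoin_one_base => //; apply: adjoin_gen; rewrite inE.
Qed.

Let t0 : t != 0. Proof. by rewrite -(fmorph_eq0 f) ft expf_neq0. Qed.
Let Wt : W (f t) = p%:Z. Proof. by rewrite ft (valX vW) // Ws natz. Qed.

Local Notation kappa := (fun l => exists b, l = j b).

Lemma poly_leading (P : {poly K}) : P != 0 -> exists (n : nat) (b : K),
  b != 0 /\ val_ge W 1 (f ((map_poly iota P).[t] / t ^+ n) - g (j b)).
Proof.
move=> P0; have [n [Q Q0 PE]] := multiplicity_XsubC P 0.
have {}Q0 : Q.[0] != 0 by apply: implyP Q0 P0.
exists n, Q.[0]; split=> //; have tn0 : t ^+ n != 0 by rewrite expf_neq0.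
have -> : (map_poly iota P).[t] / t ^+ n = (map_poly iota Q).[t].
  by rewrite PE subr0 rmorphM /= map_polyXn hornerM hornerXn mulfK.
have /factor_theorem [R RE] : root (Q - Q.[0]%:P) 0 by rewrite rootE !hornerE subrr.
have -> : (map_poly iota Q).[t] = (map_poly iota R).[t] * t + iota Q.[0].
  rewrite -[Q in LHS](subrK Q.[0]%:P) RE subr0.
  by rewrite rmorphD rmorphM /= map_polyC map_polyX /= !hornerE.
rewrite -comm -rmorphB addrK rmorphM.
have B1 : subring_pred (val_ge W 0) := val_ge_subring vW.
have ft1 : val_ge W 1 (f t).
  by right; rewrite Wt lez_nat.
have fP : val_ge W 0 (f (map_poly iota R).[t]).
  rewrite -horner_map; apply: (subring_horner B1); last exact: val_geW ft1.
  by move=> i; rewrite !coef_map /= comm; apply: (rational_valC rW).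
by have := val_geM vW fP ft1; rewrite add0r.
Qed.

(** At s = 0 an element of K(t) is a power of t times a unit with residue in K. *)
Lemma Kt_leading_coefficient c : Kt c -> c != 0 -> exists (k : int) (b : K),
  b != 0 /\ val_ge W 1 (f c * f t ^ (- k) - g (j b)).
Proof.
move=> /adjoin_one_frac [P [Q [Q0 ->]]] c0.
have P0 : P != 0 by apply: contraNneq c0 => ->; rewrite rmorph0 horner0 mul0r.
have {}Q0 : Q != 0 by apply: contraNneq Q0 => ->; rewrite rmorph0 horner0.
have [n [b [b0 Pb]]] := poly_leading P0; have [l [d [d0 Qd]]] := poly_leading Q0.
exists (n%:Z - l%:Z), (b / d); split; first by rewrite mulf_neq0 ?invr_eq0.
have tn0 k : f t ^+ k != 0 by rewrite expf_neq0 // fmorph_eq0.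
move: Pb Qd; rewrite !fmorph_div !rmorphXn /=.
rewrite opprB expfzDr ?fmorph_eq0 // -exprnP -exprnN.
move: (f (map_poly iota P).[t]) (f (map_poly iota Q).[t]) => P1 Q1 Pb Qd.
have gd0 : g (j d) != 0 by rewrite !fmorph_eq0.
have Wgd : W (g (j d)) = 0 by case: rW => _ -> //; rewrite fmorph_eq0.
have [|Ql0 WQl] := val_dominant vW gd0 (y := Q1 / f t ^+ l - g (j d)).
  by case: Qd => [->|Qd]; [left | right; rewrite Wgd gtz0_ge1].
rewrite addrC subrK Wgd in Ql0 WQl.
have -> : P1 / Q1 * (f t ^+ l / f t ^+ n) - g (j b) / g (j d) =
   ((P1 / f t ^+ n - g (j b)) * g (j d) - g (j b) * (Q1 / f t ^+ l - g (j d)))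
     * (g (j d) * (Q1 / f t ^+ l))^-1.
  move: Ql0; rewrite mulf_eq0 negb_or => /andP [Q10 _].
  move: (f t ^+ n) (f t ^+ l) (tn0 n) (tn0 l) (g (j b)) (g (j d)) gd0 => u w u0 w0 b1 d1 d10.
  by field; rewrite d10 w0 u0 Q10.
have unit_ge : val_ge W 0 (g (j d) * (Q1 / f t ^+ l))^-1.
  have den0 : g (j d) * (Q1 / f t ^+ l) != 0 by rewrite mulf_neq0.
  by right; rewrite (valV vW den0) (valM vW gd0 Ql0) Wgd WQl.
have g_ge e : val_ge W 0 (g (j e)) by apply: (rational_valC rW).
have num_ge : val_ge W 1 ((P1 / f t ^+ n - g (j b)) * g (j d) -
    g (j b) * (Q1 / f t ^+ l - g (j d))).
  apply: (val_geB vW).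
    by have := val_geM vW Pb (g_ge d); rewrite addr0.
  by have := val_geM vW (g_ge b) Qd; rewrite add0r.
by have := val_geM vW num_ge unit_ge; rewrite addr0.
Qed.

Lemma kappa_subfield : subfield_pred kappa.
Proof.
split; last by move=> _ [b ->]; exists b^-1; rewrite fmorphV.
split; first by exists 1; rewrite rmorph1.
  by move=> _ _ [b ->] [c ->]; exists (b - c); rewrite rmorphB.
by move=> _ _ [b ->] [c ->]; exists (b * c); rewrite rmorphM.
Qed.

Lemma alpha_independent (k : 'I_p -> L) : (forall i, kappa (k i)) ->
  \sum_i k i * alpha ^+ i = 0 -> forall i, k i = 0.
Proof.
apply: (purely_inseparable_free pL kappa_subfield); first by exists a.
case=> b alphab; case/eqP: (a_not_power b); apply: (fmorph_inj j).
by rewrite rmorphXn -alphab.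
Qed.

Lemma curve_z_residue : val_ge W 1 (f z - g alpha).
Proof. by rewrite fz addrK; right; rewrite (valX vW) // Ws natz lez_nat. Qed.

(** The residue alpha of z has degree p over K, the residue field of K(t). *)
Lemma curve_value (c : 'I_p -> F) : (forall i, Kt (c i)) ->
    (exists i, c i != 0) ->
  exists k : int, [/\ \sum_i c i * z ^+ i != 0, W (f (\sum_i c i * z ^+ i)) = k * p%:Z
    & forall i, val_ge W (k * p%:Z) (f (c i))].
Proof.
move=> Ec c0.
have ft0 : f t != 0 by rewrite fmorph_eq0.
have Wft : 0 < W (f t) by rewrite Wt ltz_nat.
have kappa0 : kappa 0 by exists 0; rewrite rmorph0.
have E_res x : (exists2 c, Kt c & x = f c) -> x != 0 -> exists (k : int) (l : L),
    [/\ kappa l, l != 0 & val_ge W 1 (x * f t ^ (- k) - g l)].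
  case=> e Ee ->; rewrite fmorph_eq0 => e0; have [k [b [b0 eb]]] := Kt_leading_coefficient Ee e0.
  by exists k, (j b); split; [exists b | rewrite fmorph_eq0 |].
have Ec' i : exists2 d, Kt d & f (c i) = f d by exists (c i).
have fc0 : exists i, f (c i) != 0.
  by have [i ci] := c0; exists i; rewrite fmorph_eq0.
have [k []] := residue_independent_value rW ft0 Wft kappa0 E_res curve_z_residue alpha_independent Ec' fc0.
have -> : \sum_i f (c i) * f z ^+ i = f (\sum_i c i * z ^+ i).
  by rewrite rmorph_sum; apply: eq_bigr => i _; rewrite rmorphM rmorphXn.
by rewrite fmorph_eq0 Wt; exists k.
Qed.

(** W takes values divisible by p on F, so the division is exact. *)
Definition curve_val (x : F) : int := (W (f x) %/ p)%Z.

Lemma curve_valE x : x != 0 -> W (f x) = curve_val x * p%:Z.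
Proof.
move=> x0; have [c [Ec xE]] := curve_span x.
have [|k [_ Wk _]] := curve_value Ec.
  apply: contrapT => c0; move: x0; rewrite xE big1 ?eqxx // => i _.
  have [->|ci] := eqVneq (c i) 0; first by rewrite mul0r.
  by case: c0; exists i.
by rewrite /curve_val xE Wk mulzK // -lt0n.
Qed.

Let p_gt0z : 0 < p%:Z. Proof. by rewrite ltz_nat. Qed.

Lemma curve_val_t : curve_val t = 1.
Proof. by rewrite /curve_val Wt divzz -lt0n p_gt0. Qed.

Lemma curve_val_discrete : discrete_valuation curve_val.
Proof.
have fn0 x : x != 0 -> f x != 0 by rewrite fmorph_eq0.
have pI := mulIf (lt0r_neq0 p_gt0z); case: vW => vM vD.
have FM x y : x != 0 -> y != 0 -> curve_val (x * y) = curve_val x + curve_val y.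
  move=> x0 y0; apply: pI; rewrite mulrDl -!curve_valE ?mulf_neq0 // rmorphM vM ?fn0 //.
split=> // [x y x0 y0 xy0|n].
  have := vD (f x) (f y) (fn0 _ x0) (fn0 _ y0); rewrite -rmorphD => /(_ (fn0 _ xy0)).
  by rewrite !curve_valE // -(minr_pMl _ _ (ltW p_gt0z)) (ler_pM2r p_gt0z).
exists (t ^ n); first by rewrite expfz_neq0.
apply: pI; rewrite -curve_valE ?expfz_neq0 //.
by rewrite fmorphXz (valXz vW) ?fn0 // Wt mulrzz mulrC.
Qed.

Definition curve_ring : {pred F} := fun x => (x == 0) || (0 <= curve_val x).

Lemma curve_ringE x : (x \in curve_ring) = (x == 0) || (0 <= curve_val x).
Proof. by []. Qed.

Lemma curve_ringP x : x \in curve_ring <-> val_ge W 0 (f x).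
Proof.
rewrite curve_ringE; have [->|x0] := eqVneq x 0; first by rewrite rmorph0; split=> // _; left.
rewrite /= -(pmulr_lge0 _ p_gt0z) -curve_valE //; split=> [|/val_geP]; first by right.
by rewrite fmorph_eq0; apply.
Qed.

Lemma curve_ring_const b : iota b \in curve_ring.
Proof. by apply/curve_ringP; rewrite comm; apply: (rational_valC rW). Qed.

Lemma curve_prime : function_field_prime iota curve_ring.
Proof.
split; last exact: curve_ring_const.
by exists curve_val; [exact: curve_val_discrete | exact: curve_ringE].
Qed.

Lemma Kt_residue c : Kt c -> c \in curve_ring -> exists b, val_ge W 1 (f c - g (j b)).
Proof.
move=> Ec /curve_ringP Wc; have [->|c0] := eqVneq c 0.
  by exists 0; rewrite !rmorph0 subr0; left.
have fc0 : f c != 0 by rewrite fmorph_eq0.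
have [k [b [b0 cb]]] := Kt_leading_coefficient Ec c0.
have gb0 : g (j b) != 0 by rewrite !fmorph_eq0.
have Wgb : W (g (j b)) = 0 by case: rW => _ -> //; rewrite fmorph_eq0.
have [|_] := val_dominant vW gb0 (y := f c * f t ^ (- k) - g (j b)).
  by case: cb => [->|cb]; [left | right; rewrite Wgb gtz0_ge1].
have ft0 : f t != 0 by rewrite fmorph_eq0.
rewrite addrC subrK Wgb (valM vW) ?expfz_neq0 // (valXz vW) // Wt mulrzz => Wk.
have [k0|k0] := eqVneq k 0; first by exists b; move: cb; rewrite k0 oppr0 expr0z mulr1.
exists 0; rewrite !rmorph0 subr0; right; move/(val_geP _ _ fc0): Wc.
by move: Wk k0 p_gt0z; clear; nia.
Qed.

(** The p-th power of any element lies in K(t), where residues are in K. *)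
Lemma curve_purely_inseparable : purely_inseparable_prime p iota curve_ring.
Proof.
move=> x Ox; have [|b xb] := Kt_residue (expp_in_Kt x).
  exact: (subringX (valuation_ring_subring curve_val_discrete curve_ringE)).
exists 1%N, b; rewrite expn1; apply/(max_idealP curve_val_discrete curve_ringE).
move: xb; rewrite -comm -rmorphB; have [->|y0] := eqVneq (x ^+ p - iota b) 0.
  by left.
move=> /val_geP; rewrite fmorph_eq0 => /(_ y0); rewrite curve_valE // => Wy; right.
by rewrite -gtz0_ge1 -(pmulr_lgt0 _ p_gt0z) gtz0_ge1.
Qed.

Lemma algebraic_in_constants x : algebraicOver iota x -> exists b, f x = g b.
Proof.
case=> q q0 qx; apply: (@algebraic_constant _ _ g (map_poly j q)).
  by rewrite map_poly_eq0.
rewrite -map_poly_comp -(eq_map_poly comm) map_poly_comp.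
by rewrite fmorph_root.
Qed.

(** L is perfect and t = s^p. *)
Lemma Kt_ppower c : Kt c -> ppower p (f c).
Proof.
have rP := ppower_subring pT.
have sP : subfield_pred (ppower p) := subring_frobenius_subfield pT rP (@ppower_expp T p).
elim=> {c} [b|x|x y _ Px _ Py|x y _ Px _ Py].
- by rewrite comm; apply: ppower_const.
- by rewrite inE => /eqP ->; rewrite ft; apply: ppower_expp.
- by rewrite rmorphB; apply: subringB.
by rewrite fmorph_div; apply: subfield_div.
Qed.

(** z - alpha = s^m has value prime to p. *)
Lemma not_ppower_z : ~ ppower p (f z).
Proof.
move=> Pz; have Ps : ppower p (s ^+ m).
  have -> : s ^+ m = f z - g alpha by rewrite fz addrK.
  by apply: (subringB (ppower_subring pT)) => //; apply: ppower_const.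
have [k] := ppower_val rW pT Ps (expf_neq0 m s0).
rewrite (valX vW) // Ws natz => mk; case/negP: pm.
by have : (p%:Z %| m%:Z)%Z by apply/dvdzP; exists k.
Qed.

(** An algebraic element x is a constant of L, hence a p-th power in T; the powers
    of z being free over T^p, its coefficients on z, ..., z^(p-1) vanish, and x is
    in K(t).  The residue of x is then in K. *)
Lemma curve_algebraically_closed : algebraically_closed_in iota.
Proof.
move=> x /algebraic_in_constants [b xb]; have [c [Ec xE]] := curve_span x.
pose i0 := Ordinal p_gt0.
have xc : x = c i0.
  apply: (fmorph_inj f); rewrite xb.
  pose d (i : 'I_p) : T := if i == i0 then g b else 0.
  have := @ppower_gen_free _ _ pT _ not_ppower_z d (fun i => f (c i)).
  have Pd i : ppower p (d i).
    rewrite /d; case: eqP => _; first exact: ppower_const.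
    exact: (subring0 (ppower_subring pT)).
  move=> /(_ Pd (fun i => Kt_ppower (Ec i))) /(_ _ i0); rewrite {2}/d eqxx; apply.
  rewrite (bigD1 i0) //= big1 => [|i /negPf i0']; last by rewrite /d i0' mul0r.
  rewrite /d eqxx expr0 mulr1 addr0 -xb xE rmorph_sum.
  by apply: eq_bigr => i _; rewrite rmorphM rmorphXn.
have [||e xe] := @Kt_residue x; first by rewrite xc.
  by apply/curve_ringP; rewrite xb; apply: (rational_valC rW).
exists e; apply: (fmorph_inj f); rewrite comm xb; congr (g _).
apply/eqP; rewrite -subr_eq0; apply/eqP.
by apply: (rational_valC_eq0 rW (n := 1)); rewrite // rmorphB -xb.
Qed.

Local Notation Kz := (adjoin iota [:: z]).
Let sKz : subfield_pred Kz := adjoin_subfield iota [:: z].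
Let rKz := subfield_subring sKz.

(** X^m - (z^p - a) is separable because p does not divide m. *)
Lemma separable_t : separable_over_sub Kz t.
Proof.
have Kz_z : Kz z by apply: adjoin_gen; rewrite inE.
have tE : t ^+ m = z ^+ p - iota a by rewrite curve_equation addrK.
have mF : m%:R != 0 :> F by rewrite -(dvdn_pcharf pF).
exists ('X^m - (t ^+ m)%:P); split.
- rewrite unlock /separable_poly.body derivB derivC subr0 derivXn -scaler_nat coprimepZr //.
  by rewrite coprimep_expr // coprimepX rootE !hornerE expr0n eqn0Ngt m_gt0 sub0r oppr_eq0 expf_neq0.
- apply: (subringB (coefs_in_subring rKz)).
    by apply: (subringX (coefs_in_subring rKz)); apply: coefs_inX.
  apply: coefs_inC => //; rewrite tE; apply: (subringB rKz); last exact: adjoin_const.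
  exact: subringX.
by rewrite rootE !hornerE subrr.
Qed.

(** F is generated over K(z) by the separable element t. *)
Lemma curve_separable x : separable_over_sub Kz x.
Proof.
have sep y : adjoin_one Kz t y -> separable_over_sub Kz y.
  exact: separable_adjoin_one separable_t.
suff Ft : adjoin_one Kz t x by apply: sep.
have rKzt := adjoin_one_subring t rKz.
apply: adjoin_min (F_gen x) => [|b|y].
- split=> // y Ay; apply: (algebraic_inverse sKz) => // [w|]; first exact: adjoin_one_base.
  by have [q [sep_q Eq qy]] := sep y Ay; exists q; rewrite separable_poly_neq0.
- by apply: adjoin_one_base => //; apply: adjoin_const.
rewrite !inE => /orP [/eqP ->|/eqP ->]; first exact: adjoin_one_gen.
by apply: adjoin_one_base => //; apply: adjoin_gen; rewrite inE.
Qed.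

Lemma curve_separable_function_field : separable_function_field iota.
Proof.
split.
- by exists [:: t; z].
- exists t; split=> [/algebraic_in_constants [b tb]|x].
    have : b = 0 by apply: (rational_valC_eq0 rW (n := 1)) => //; right; rewrite -tb Wt.
    by move=> b0; case/eqP: t0; apply: (fmorph_inj f); rewrite tb b0 !rmorph0.
  exists ('X^p - (x ^+ p)%:P); split.
  + by rewrite -size_poly_eq0 size_XnsubC.
  + apply: (subringB (coefs_in_subring rKt)).
      by apply: (subringX (coefs_in_subring rKt)); apply: coefs_inX.
    by apply: coefs_inC => //; apply: expp_in_Kt.
  by rewrite rootE !hornerE subrr.
- exists z; split=> [/algebraic_in_constants [b zb]|]; last exact: curve_separable.
  by case: not_ppower_z; rewrite zb; apply: ppower_const.
exact: curve_algebraically_closed.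
Qed.

Lemma poly_in_t_neq0 (P : {poly K}) : P != 0 -> (map_poly iota P).[t] != 0.
Proof.
move=> P0; apply/eqP => /rootP Pt; have [b tb] : exists b, f t = g b.
  by apply: algebraic_in_constants; exists P.
have b0 : b = 0 by apply: (rational_valC_eq0 rW (n := 1)) => //; right; rewrite -tb Wt.
by case/eqP: t0; apply: (fmorph_inj f); rewrite tb b0 !rmorph0.
Qed.

(** This strengthens [poly_dvd_base] to polynomials which vanish at 0. *)
Lemma poly_divides_base (P : {poly L}) : P != 0 ->
  exists2 R : {poly K}, R != 0 & P %| map_poly j R.
Proof.
move=> P0; have [n [Q Q0 ->]] := multiplicity_XsubC P 0.
have {}Q0 : Q.[0] != 0 by apply: implyP Q0 P0.
have [R R0 QR] := poly_dvd_base algL Q0; exists (R * 'X^n).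
  rewrite mulf_neq0 ?expf_neq0 ?polyX_eq0 //.
  by apply: contraNneq R0 => ->; rewrite horner0.
by rewrite subr0 rmorphM /= map_polyXn dvdp_mul2r ?expf_neq0 ?polyX_eq0.
Qed.

(** Given u on F and w on L with values in S, the image of s has to be
    sigma = u(t)^k / y^l, where k p = l m + 1 and y = u(z) - w(alpha) is the image
    of s^m.  As y^p = u(t)^m, this sigma satisfies sigma^p = u(t) and
    sigma^m = y, and s |-> sigma extends to L[s].  The image of a nonzero P(s) is
    invertible: its p-th power is a polynomial over L in u(t), which divides a
    nonzero polynomial over K in u(t), the image of a nonzero element of F. *)
Lemma tensor_product_construction : is_tensor_product iota j f g.
Proof.
split=> // S u w uw; have pS : p \in [pchar S] := rmorph_pchar u pF.
have cancelR (x x' y z' : S) : x * x' = 1 -> y * x = z' * x -> y = z'.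
  by move=> xx yz; rewrite -[y]mulr1 -[z']mulr1 -xx !mulrA yz.
have unitX (x x' : S) n : x * x' = 1 -> x ^+ n * x' ^+ n = 1.
  by move=> xx; rewrite -exprMn xx expr1n.
have ut1 : u t * u t^-1 = 1 by rewrite -rmorphM mulfV ?rmorph1.
pose y := u z - w alpha.
have yp : y ^+ p = u t ^+ m.
  rewrite (expr1p_sub pS) -[u z ^+ p]rmorphXn -[w alpha ^+ p]rmorphXn alphaE -uw.
  by rewrite -rmorphB curve_equation addrK rmorphXn.
pose y' := y ^+ p.-1 * u t^-1 ^+ m.
have y1 : y * y' = 1 by rewrite mulrA -exprS prednK // yp unitX.
have [k [l kl]] : exists k l, (k * p = l * m + 1)%N.
  have [k l kl _] := egcdnP m p_gt0; exists k, l; rewrite kl; congr (_ + _)%N.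
  by apply/eqP; rewrite -/(coprime _ _) prime_coprime.
have [sigma sigma_y] : exists sigma, sigma * y ^+ l = u t ^+ k.
  by exists (u t ^+ k * y' ^+ l); rewrite -mulrA [y' ^+ l * _]mulrC unitX // mulr1.
have sigma_p : sigma ^+ p = u t.
  apply: (cancelR _ _ _ _ (unitX _ _ (m * l)%N ut1)).
  transitivity ((sigma * y ^+ l) ^+ p); first by rewrite exprMn exprM -yp exprAC.
  by rewrite sigma_y -exprM kl addn1 mulnC exprS.
have sigma_m : sigma ^+ m = y.
  apply: (cancelR _ _ _ _ (unitX _ _ (l * m)%N y1)).
  transitivity ((sigma * y ^+ l) ^+ m); first by rewrite exprMn -exprM.
  by rewrite sigma_y exprAC -yp -exprM mulnC kl addn1 exprS.
have comm_sigma : commr_rmorph w sigma by move=> c; apply: mulrC.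
pose phi : {rmorphism {poly L} -> S} := horner_morph comm_sigma.
have phi_unit P : P != 0 -> exists x, phi P * x = 1.
  move=> P0; pose P' := map_poly (pFrobenius_aut pL) P.
  have P'0 : P' != 0 by rewrite map_poly_eq0.
  have [R R0 /dvdpP [Q RE]] := poly_divides_base P'0.
  have phi_p : phi P ^+ p = (map_poly w P').[u t].
    have -> : phi P = (map_poly w P).[sigma] by [].
    rewrite !horner_coef !size_map_poly (expr1p_sum pS); apply: eq_bigr => i _.
    by rewrite !coef_map /= pFrobenius_autE exprMn exprAC sigma_p rmorphXn.
  exists (phi P ^+ p.-1 * ((map_poly w Q).[u t] * u ((map_poly iota R).[t])^-1)).
  have uR : (map_poly w (P' * Q)).[u t] = u (map_poly iota R).[t].
    rewrite mulrC -RE -map_poly_comp -(eq_map_poly uw) map_poly_comp /=.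
    by rewrite horner_map.
  rewrite mulrA -exprS prednK // phi_p mulrA -hornerM -rmorphM uR -rmorphM.
  by rewrite mulfV ?rmorph1 // poly_in_t_neq0.
have [h hE] := fraction_lift fracT phi_unit.
have hg b : h (g b) = w b by rewrite gE hE /= /horner_morph map_polyC hornerC.
have hs : h s = sigma by rewrite hE /= /horner_morph map_polyX hornerX.
exists h; split=> // [x|h' h'f h'g x].
  pose hf : {rmorphism F -> S} := h \o f.
  apply: (rmorphism_adjoin (u := hf) _ _ (F_gen x)) => [b|v].
    by rewrite /hf /= comm hg uw.
  rewrite !inE /hf => /orP [/eqP ->|/eqP ->] /=; first by rewrite ft rmorphXn hs.
  by rewrite fz rmorphD rmorphXn hs hg sigma_m subrK.
apply: (rmorphism_adjoin _ _ (rat_adjoin fracT gE x)) => [b|v].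
  by rewrite h'g hg.
rewrite inE => /eqP ->; rewrite hs.
apply: (cancelR _ _ _ _ (unitX _ _ l y1)); rewrite sigma_y.
have /(congr1 h') : s * (f z - g alpha) ^+ l = f t ^+ k.
  by rewrite fz addrK ft -!exprM -exprS [(p * k)%N]mulnC kl addn1 mulnC.
by rewrite rmorphM [h' (_ ^+ l)]rmorphXn rmorphB h'f h'g [h' (_ ^+ k)]rmorphXn h'f.
Qed.

(** If x has negative value, an integral equation divided by its leading power of
    x makes 1 a sum of elements of positive value. *)
Lemma val_ge_integrally_closed (A : T -> Prop) x : (forall y, A y -> val_ge W 0 y) ->
  integral_closure A x -> val_ge W 0 x.
Proof.
move=> AW [q [q_mon Aq /rootP qx]]; apply: contrapT => Wx.
have x0 : x != 0 by apply: contra_not_neq Wx => ->; left.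
have W_inv : val_ge W 1 x^-1.
  right; rewrite (valV vW) // -gtz0_ge1 oppr_gt0 ltNge; apply/negP => Wx'.
  by apply: Wx; right.
have q_size : size q = (size q).-1.+1.
  by rewrite prednK // size_poly_gt0 monic_neq0.
move: qx; rewrite horner_coef q_size big_ord_recr /= -/(lead_coef q).
rewrite (eqP q_mon) mul1r => /eqP; rewrite addrC addr_eq0 => /eqP xn.
set n := (size q).-1 in q_size xn *.
have one : 1 = - \sum_(i < n) q`_i * x^-1 ^+ (n - i).
  have xn0 : x ^+ n != 0 by rewrite expf_neq0.
  apply: (mulfI xn0); rewrite mulr1 {1}xn mulrN mulr_sumr; congr (- _).
  apply: eq_bigr => i _; rewrite mulrCA; congr (_ * _).
  have -> : x ^+ n = x ^+ (n - i) * x ^+ i by rewrite -exprD subnK // ltnW.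
  by rewrite mulrAC -exprMn mulfV // expr1n mul1r.
have : val_ge W 1 1.
  rewrite [X in val_ge _ _ X]one; apply: (val_geN vW); apply: (val_ge_sum vW) => i _.
  have ni : (n - i = (n - i).-1.+1)%N by rewrite prednK // subn_gt0.
  have := val_geM vW (AW _ (Aq i)) W_inv; rewrite add0r ni exprS mulrA => W1.
  have := val_geX vW (n - i).-1 (val_geW (ler01) W_inv); rewrite mul0rn.
  by move=> /(val_geM vW W1); rewrite addr0.
by move=> /(val_geP _ _ (oner_neq0 T)); rewrite (val1 vW).
Qed.

Local Notation Ob := (tensor_sub f g curve_ring).
Local Notation frobB := (frob_image p (val_ge W 0)).
Hypothesis W_frac : forall x, val_ge W 0 x -> exists P Q : {poly L},
  Q.[0] != 0 /\ x = tofrac P / tofrac Q.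

Let sOb : subring_pred Ob.
Proof. exact/tensor_sub_subring/(valuation_ring_subring curve_val_discrete curve_ringE). Qed.

Let frobB_const c : frobB (g c).
Proof.
apply: (ppower_val_ge0 rW pT); first exact: ppower_const.
by apply: (rational_valC rW); rewrite subr_le0 lez_nat.
Qed.

(** By [curve_value] the coefficients on the powers of z of an element of O have
    nonnegative values, and they are p-th powers in T; then z is replaced with
    z - alpha = s^m. *)
Lemma tensor_sub_direct_sum x : Ob x -> direct_sum (fun i : 'I_p => (s ^+ m) ^+ i) (fun=> frobB) x.
Proof.
have sD : subspace g (direct_sum (fun i : 'I_p => (s ^+ m) ^+ i) (fun=> frobB)).
  by apply: direct_sum_subspace => i; apply/frob_image_subspace/(val_ge_subspace rW).
apply: tensor_sub_ind => [|y1 y2|b c Ob_b]; first exact: (subspace0 sD).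
  exact: (subspaceD sD).
rewrite mulrC; case: (sD) => _ _; apply => {c}.
have rB := frob_image_subring pT (val_ge_subring vW).
have -> : s ^+ m = f z - g alpha by rewrite fz addrK.
apply: (direct_sum_shift rB (frobB_const alpha)).
have [c [Ec bE]] := curve_span b; exists (fun i => f (c i)); split=> [i|]; last first.
  by rewrite bE rmorph_sum; apply: eq_bigr => i _; rewrite rmorphM rmorphXn.
have [ci0|ci0] := eqVneq (c i) 0; first by rewrite ci0 rmorph0; apply: (subring0 rB).
have [k [b0 Wk Wc]] := curve_value Ec (ex_intro _ i ci0).
apply: (ppower_val_ge0 rW pT (Kt_ppower (Ec i))); apply: val_geW (Wc i).
rewrite -bE -(fmorph_eq0 f) in b0; move/curve_ringP/(val_geP _ _ b0): Ob_b.
by rewrite bE Wk; apply: le_trans; rewrite subr_le0 lez_nat.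
Qed.

Let Ob_t : Ob (f t).
Proof. by apply/tensor_sub_left; rewrite curve_ringE curve_val_t orbT. Qed.

(** (P(s) / Q(s))^p is a fraction in t = s^p whose denominator is a unit. *)
Lemma frob_image_tensor_sub x : frobB x -> Ob x.
Proof.
case=> _ /W_frac [P [Q [Q0 ->]]] ->.
have pow (R : {poly L}) : tofrac R ^+ p = (map_poly g (map_poly (pFrobenius_aut pL) R)).[f t].
  rewrite (rat_horner gE) !horner_coef !size_map_poly (expr1p_sum pT).
  by apply: eq_bigr => i _; rewrite !coef_map /= pFrobenius_autE exprMn exprAC ft rmorphXn.
have [|y Oy Qy] := horner_pi_unit comm algL curve_val_discrete curve_ringE curve_ring_const curve_val_t
    (Q := map_poly (pFrobenius_aut pL) Q).
  by rewrite -[X in _.[X]](rmorph0 (pFrobenius_aut pL)) horner_map fmorph_eq0.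
have QV : (map_poly g (map_poly (pFrobenius_aut pL) Q)).[f t]^-1 = y.
  have Q10 : (map_poly g (map_poly (pFrobenius_aut pL) Q)).[f t] != 0.
    by apply: contraTneq (oner_neq0 T) => Q10; rewrite -Qy Q10 mul0r eqxx.
  by apply: (mulfI Q10); rewrite Qy mulfV.
rewrite expr_div_n !pow QV.
apply: (subringM sOb) => //; apply: (subring_horner sOb) => // i.
by rewrite coef_map; apply/tensor_sub_right/(subring1 (valuation_ring_subring curve_val_discrete curve_ringE)).
Qed.

Lemma direct_sum_tensor_sub x :
  direct_sum (fun i : 'I_p => (s ^+ m) ^+ i) (fun=> frobB) x -> Ob x.
Proof.
case=> c [cB ->]; apply: (subring_sum sOb) => i _; apply: (subringM sOb).
  exact: frob_image_tensor_sub.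
apply: (subringX sOb); have -> : s ^+ m = f z - g alpha by rewrite fz addrK.
apply: (subringB sOb); last by apply: frob_image_tensor_sub.
apply/tensor_sub_left/curve_ringP; rewrite fz; apply: (val_geD vW).
  by right; rewrite (valX vW) // Ws natz.
exact: (rational_valC rW).
Qed.

(** The p-th power of an element of the valuation ring lies in Ob. *)
Lemma integral_closure_val_ge x : integral_closure Ob x <-> val_ge W 0 x.
Proof.
split=> [|Bx].
  apply: val_ge_integrally_closed; apply: tensor_sub_ind => [|y1 y2|b c].
  - by left.
  - exact: (val_geD vW).
  move=> /curve_ringP Wb.
  by have := val_geM vW Wb (rational_valC rW c (lexx 0)); rewrite addr0.
apply: (frob_closure_integral pK curve_val_discrete curve_ringE); exists 1%N.
by rewrite expn1; apply: frob_image_tensor_sub; exists x.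
Qed.

(** Ob is B^p[s^m], with B the valuation ring of W. *)
Lemma construction_singularity_degree :
  geometric_singularity_degree iota curve_ring (\sum_(i < p) m * i %/ p).
Proof.
exists L, j, T, f, g; split=> //; first exact: tensor_product_construction.
have sm0 : s ^+ m != 0 by rewrite expf_neq0.
have Wsm : W (s ^+ m) = m%:Z by rewrite (valX vW) // Ws natz.
have rP := ppower_subring pT.
have T_gen x : adjoin_one (ppower p) (s ^+ m) x.
  have sA : subfield_pred (adjoin_one (ppower p) (s ^+ m)).
    exact: (adjoin_one_subfield pT rP (@ppower_expp T p)).
  have rA := subfield_subring sA.
  apply: adjoin_min (rat_adjoin fracT gE x) => // [c|v].
    by apply: adjoin_one_base => //; apply: ppower_const.
  rewrite inE => /eqP ->.
  have [k l kl _] := egcdnP m p_gt0.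
  have gcd1 : gcdn p m = 1%N.
    by apply/eqP; rewrite -/(coprime _ _) prime_coprime.
  have sE : s = (s ^+ k) ^+ p / (s ^+ m) ^+ l.
    by rewrite -!exprM kl gcd1 mulnC exprD expr1 mulrAC mulfV ?mul1r // expf_neq0.
  rewrite [X in adjoin_one _ _ X]sE.
  apply: (subfield_div sA); first by apply: adjoin_one_base => //; apply: ppower_expp.
  by apply: (subringX rA); apply: adjoin_one_gen.
have := has_codim_power_basis rW s0 Ws pT sm0 Wsm m_gt0 pm T_gen.
apply: eq_has_codim => x.
  by split; [apply: direct_sum_tensor_sub | apply: tensor_sub_direct_sum].
by rewrite integral_closure_val_ge.
Qed.

End Construction.

(** * Conclusion *)
Lemma construction_admissible (p d : nat) (K : fieldType) (a : K)
    (L : closedFieldType) (j : {rmorphism K -> L}) (T : fieldType)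
    (tofrac : {rmorphism {poly L} -> T}) :
    p \in [pchar K] -> (forall b, b ^+ p != a) -> algebraic_closure j ->
    fraction_map tofrac -> ~~ (p %| d.+1)%N ->
  admissible p d.
Proof.
move=> pK a_not_power algL fracT pm; have p_pr := pcharf_prime pK.
pose g : {rmorphism L -> T} := tofrac \o polyC.
have gE c : g c = tofrac c%:P by [].
have [W [rW Ws W_frac]] := rational_function_valuation fracT gE.
have [alpha alphaE] := closed_field_root (j a) (prime_gt0 p_pr).
pose tT := tofrac 'X ^+ p; pose zT := tofrac 'X ^+ d.+1 + g alpha.
pose gK : {rmorphism K -> T} := g \o j.
have [F [f [iota [comm lift gen]]]] := generated_subfield gK [:: tT; zT].
have [t ft] : exists t, f t = tT by apply: lift; rewrite !inE eqxx.
have [z fz] : exists z, f z = zT by apply: lift; rewrite !inE eqxx orbT.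
have F_gen x : adjoin iota [:: t; z] x by apply: gen; rewrite /= ft fz.
have m_gt0 : (0 < d.+1)%N by [].
exists K, F, iota, (curve_ring p W f), (\sum_(i < p) d.+1 * i %/ p)%N; split=> //.
- exact: (curve_separable_function_field pK a_not_power fracT rW Ws m_gt0 pm alphaE comm ft fz F_gen).
- split.
    exact: (curve_prime pK a_not_power fracT rW Ws m_gt0 alphaE comm ft fz F_gen).
  exact: (curve_purely_inseparable pK a_not_power fracT rW Ws m_gt0 alphaE comm ft fz F_gen).
- exact: (construction_singularity_degree pK a_not_power algL fracT gE rW Ws m_gt0 pm alphaE comm ft fz F_gen W_frac).
by rewrite (sum_floor_multiples m_gt0 p_pr pm) [(d.+1 - 1)%N]subn1.
Qed.

(** In n^p = X d^p the degrees are 0 and 1 modulo p. *)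
Lemma variable_not_power (k K : fieldType) (tofrac : {rmorphism {poly k} -> K})
    (p : nat) (b : K) : fraction_map tofrac -> prime p -> b ^+ p != tofrac 'X.
Proof.
move=> fracK p_pr; have [tofrac0 frac] := fracK.
have [[n d] /= [d0 ->]] := frac b.
have dp0 : tofrac d ^+ p != 0 by rewrite expf_neq0 // tofrac0.
apply/eqP; rewrite expr_div_n => /(canRL (divfK dp0)) e.
have {}e : n ^+ p = 'X * d ^+ p.
  by apply/eqP; rewrite -subr_eq0 -tofrac0 rmorphB rmorphM !rmorphXn e subrr.
have dp : d ^+ p != 0 by rewrite expf_neq0.
have n0 : n != 0.
  apply: contraTneq dp => n0; move: e; rewrite n0 expr0n gtn_eqF ?prime_gt0 //.
  by move/esym/eqP; rewrite mulf_eq0 polyX_eq0 /= => /eqP ->; rewrite eqxx.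
have : (p %| 1)%N.
  have := congr1 (fun q : {poly k} => (size q).-1) e.
  rewrite size_exp mulrC size_mulX //= -(prednK (n := size (d ^+ p))) ?size_poly_gt0 //.
  rewrite size_exp => np; have : (p %| ((size d).-1 * p).+1)%N by rewrite -np dvdn_mull.
  by rewrite -addn1 dvdn_addr // dvdn_mull.
by rewrite dvdn1 => /eqP p1; move: p_pr; rewrite p1.
Qed.

(** The rational function field over k is countable, so that a countable
    algebraic closure exists. *)
Lemma countable_base_closure (k : countFieldType) :
  exists (L : closedFieldType) (j : {rmorphism {fraction {poly k}} -> L}),
    algebraic_closure j.
Proof.
pose K := {fraction {poly k}}.
pose code (x : K) : {poly k} * {poly k} := frac (generic_quotient.repr x).
have codeK : pcancel code (fun nd => Some (\pi_K (Ratio nd.1 nd.2))%qT).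
  by move=> x; rewrite /code Ratio_numden generic_quotient.reprK.
pose C := PCanIsCountable codeK.
pose Kc : countFieldType := HB.pack_for countFieldType K C.
have [L [j jint]] := countable_algebraic_closure Kc.
exists L, (j : {rmorphism {fraction {poly k}} -> L}) => y.
exact/integral_algebraic/jint.
Qed.

Lemma admissible_sufficient (p d : nat) : prime p -> ~~ (p %| d.+1)%N -> admissible p d.
Proof.
move=> p_pr pd; have [L [j algL]] := countable_base_closure 'F_p.
have pK : p \in [pchar {fraction {poly 'F_p}}].
  by apply: (rmorph_pchar (@FracField.tofrac _ \o polyC)); apply: pchar_Fp.
have a_not_power b := variable_not_power b (fraction_mapP {poly 'F_p}) p_pr.
exact: construction_admissible pK a_not_power algL (fraction_mapP {poly L}) pd.
Qed.

Theorem proposition3p2 (p : nat) (hp : prime p) (d : nat) (hd : (0 < d)%N) :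
  admissible p d <-> ~ (d%:Z = -1 %[mod p%:Z])%Z.
Proof.
split=> [|dm]; first exact: admissible_necessary.
apply: admissible_sufficient => //; apply/negP => pd; apply: dm.
by apply/eqP; rewrite eqz_mod_dvd opprK -[1]/(1%:Z) -PoszD addn1.
Qed.
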